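(* Let $\mathbb{G}=(\mathscr{A},\Delta)$ be a finite quantum group and let $\mathbb{H}$ be the quantum automorphism group of $\mathbb{G}$. Then $\mathbb{H}$ is the classical group $\mathrm{Aut}(\mathscr{A},\Delta)$ of Hopf $*$-algebra automorphisms of $\mathscr{A}$, i.e. $\mathrm{C}(\mathbb{H})$ is commutative and $(\mathrm{C}(\mathbb{H}),\Delta_{\mathbb{H}})$ is isomorphic, as a compact quantum group, to $\mathrm{C}(\mathrm{Aut}(\mathscr{A},\Delta))$ with the comultiplication $f\mapsto\bigl((\theta_1,\theta_2)\mapsto f(\theta_1\circ\theta_2)\bigr)$. In particular, any compact quantum group $\mathbb{K}$ acting faithfully on $\mathbb{G}$ by automorphisms is a classical group, i.e. $\mathrm{C}(\mathbb{K})$ is commutative.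
   Context: A finite quantum group is a finite-dimensional Hopf $*$-algebra $(\mathscr{A},\Delta)$ over $\mathbb{C}$ such that $\mathscr{A}$ admits a faithful positive functional; then $\mathscr{A}$ is a $\mathrm{C}^*$-algebra. Let $S$ be its antipode and $\mathbf{1}$ denote units. The Haar functional $\boldsymbol{h}$ is the (unique, faithful) normalized positive functional on $\mathscr{A}$ with $(\boldsymbol{h}\otimes\mathrm{id})\Delta(a)=(\mathrm{id}\otimes\boldsymbol{h})\Delta(a)=\boldsymbol{h}(a)\mathbf{1}$ for all $a\in\mathscr{A}$. The dual space $\mathscr{A}^*$ is a unital $*$-algebra (dual Hopf $*$-algebra) with product $\varphi\cdot\psi=(\varphi\otimes\psi)\circ\Delta$, unit the counit of $\mathscr{A}$, and involution $\varphi^*(a)=\overline{\varphi(S(a)^* )}$. The Fourier transform is the linear isomorphism $\mathscr{F}:\mathscr{A}\to\mathscr{A}^*$, $\mathscr{F}(a)=\boldsymbol{h}(\,\cdot\,a)$. For a compact quantum group $\mathbb{K}$ (a unital $\mathrm{C}^*$-algebra $\mathrm{C}(\mathbb{K})$ with comultiplication $\Delta_{\mathbb{K}}$, in the sense of Woronowicz), an action of $\mathbb{K}$ on $\mathscr{A}$ is a unital $*$-homomorphism $\alpha:\mathscr{A}\to\mathscr{A}\otimes\mathrm{C}(\mathbb{K})$ such that $(\alpha\otimes\mathrm{id})\circ\alpha=(\mathrm{id}\otimes\Delta_{\mathbb{K}})\circ\alpha$ and the linear span of $\alpha(\mathscr{A})(\mathbf{1}\otimes\mathrm{C}(\mathbb{K}))$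 is $\mathscr{A}\otimes\mathrm{C}(\mathbb{K})$. It is an action on $\mathbb{G}$ by automorphisms if $(\mathscr{F}\otimes\mathrm{id})\circ\alpha\circ\mathscr{F}^{-1}:\mathscr{A}^*\to\mathscr{A}^*\otimes\mathrm{C}(\mathbb{K})$ is a unital $*$-homomorphism. The action is faithful if $\{(\varrho\otimes\mathrm{id})\alpha(a):\varrho\in\mathscr{A}^*,\ a\in\mathscr{A}\}$ generates $\mathrm{C}(\mathbb{K})$ as a $\mathrm{C}^*$-algebra. The quantum automorphism group $\mathbb{H}$ of $\mathbb{G}$ is the universal compact quantum group acting on $\mathbb{G}$ by automorphisms (it is known to exist): it comes with an action $\alpha:\mathscr{A}\to\mathscr{A}\otimes\mathrm{C}(\mathbb{H})$ by automorphisms such that for every compact quantum group $\mathbb{K}$ with an action $\alpha'$ on $\mathbb{G}$ by automorphisms there is a unique unital $*$-homomorphism $\pi:\mathrm{C}(\mathbb{H})\to\mathrm{C}(\mathbb{K})$ with $(\pi\otimes\pi)\circ\Delta_{\mathbb{H}}=\Delta_{\mathbb{K}}\circ\pi$ and $\alpha'=(\mathrm{id}\otimes\pi)\circ\alpha$. The $\mathrm{C}^*$-algebra $\mathrm{C}(\mathbb{H})$ is generated by $\{(\varrho\otimes\mathrm{id})\alpha(a):\varrho\in\mathscr{A}^*,\ a\in\mathscr{A}\}$. $\mathrm{Aut}(\mathscr{A},\Delta)$ is the group of $*$-algebra automorphisms $\theta$ of $\mathscr{A}$ with $(\theta\otimes\theta)\circ\Delta=\Delta\circ\theta$, a compact group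 in the topology inherited from linear maps on $\mathscr{A}$. *)

(* Defs.v *)
From HB Require Import structures.
From mathcomp Require Import all_boot all_order all_algebra all_field.
From mathcomp Require Import all_classical all_reals all_analysis.
From mathcomp Require Import complex.

Set Implicit Arguments.
Unset Strict Implicit.
Unset Printing Implicit Defensive.

Import Order.TTheory GRing.Theory Num.Theory.
Import numFieldNormedType.Exports.

Local Open Scope classical_set_scope.
Local Open Scope complex_scope.
Local Open Scope ring_scope.

HB.mixin Record hasStar (R : realType) A & GRing.Algebra R[i] A := {
  star : A -> A;
  starK : involutive star;
  star_semilinear : forall (c : R[i]) (x y : A),
    star (c *: x + y) = c^* *: star x + star y;
  starM : forall x y : A, star (x * y) = star y * star x
}.

#[short(type="starAlgType")]
HB.structure Definition StarAlgebra (R : realType) :=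
  {A of GRing.Algebra R[i] A & hasStar R A}.

#[short(type="finStarAlgType")]
HB.structure Definition FinStarAlgebra (R : realType) :=
  {A of Falgebra R[i] A & StarAlgebra R A}.

(* The library has no class of normed algebras, and none can be declared on top
   of its rings and normed modules. The norm of a C*-algebra A is therefore
   cnorm, and the topological notions refer to the copy normed_space A of A,
   which is a normed module with norm (cnorm x)%:C. *)
HB.mixin Record hasCstarNorm (R : realType) A & StarAlgebra R A := {
  cnorm : A -> R;
  cnormD : forall x y : A, cnorm (x + y) <= cnorm x + cnorm y;
  cnormZ : forall (c : R[i]) (x : A), (cnorm (c *: x))%:C = `|c| * (cnorm x)%:C;
  cnorm_eq0 : forall x : A, cnorm x = 0 -> x = 0;
  cnormM : forall x y : A, cnorm (x * y) <= cnorm x * cnorm y;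
  cnorm_star_mul : forall x : A, cnorm (star x * x) = cnorm x ^+ 2
}.

#[short(type="preCstarAlgType")]
HB.structure Definition PreCstarAlgebra (R : realType) :=
  {A of StarAlgebra R A & hasCstarNorm R A}.

Definition normed_space (R : realType) (A : preCstarAlgType R) : Type := A.

Section NormedSpace.
Variables (R : realType) (A : preCstarAlgType R).
Local Notation V := (normed_space A).
HB.instance Definition _ := GRing.Lmodule.on V.

Let norm (x : V) : R[i] := (cnorm (x : A))%:C.

Let normD (x y : V) : norm (x + y) <= norm x + norm y.
Proof. by rewrite /norm -rmorphD /= lecR cnormD. Qed.

Let normZ (c : R[i]) (x : V) : norm (c *: x) = `|c| * norm x.
Proof. exact: cnormZ. Qed.

Let norm_eq0 (x : V) : norm x = 0 -> x = 0.
Proof. by move=> /eqP; rewrite /norm fmorph_eq0 => /eqP /cnorm_eq0. Qed.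

HB.instance Definition _ :=
  Lmodule_isNormed.Build R[i] V normD normZ norm_eq0.
End NormedSpace.

HB.mixin Record isCstarComplete (R : realType) A & PreCstarAlgebra R A := {
  cstar_complete : forall F : set_system (normed_space A),
    ProperFilter F -> cauchy F -> cvg F
}.

#[short(type="cstarAlgType")]
HB.structure Definition CstarAlgebra (R : realType) :=
  {A of PreCstarAlgebra R A & isCstarComplete R A}.


(* Unital *-homomorphisms have to be considered between algebras of several
   origins (C*-algebras, tensor products, duals, functions), hence the bare
   record of operations. *)
Record star_ops (R : realType) (V : lmodType R[i]) := StarOps {
  sone : V;
  smul : V -> V -> V;
  sstar : V -> V
}.

Definition alg_star (R : realType) (A : starAlgType R) : star_ops A :=
  StarOps 1 *%R star.

Definition is_star_hom (R : realType) (V W : lmodType R[i])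
    (v : star_ops V) (w : star_ops W) (f : V -> W) : Prop :=
  [/\ linear f, f (sone v) = sone w,
      forall x y, f (smul v x y) = smul w (f x) (f y)
    & forall x, f (sstar v x) = sstar w (f x)].

Definition lin_span (R : realType) (V : lmodType R[i]) (S : set V) : set V :=
  [set x | exists n (c : 'I_n -> R[i]) (v : 'I_n -> V),
     (forall i, S (v i)) /\ x = \sum_i c i *: v i].

Section AlgebraicTensor.
Variable R : realType.

(* The algebraic tensor product of a finite-dimensional space V with B: the
   family (b_i) stands for \sum_i e_i (x) b_i, with (e_i) the chosen basis of
   V. *)
Definition tensor (V : vectType R[i]) (B : lmodType R[i]) : Type :=
  {ffun 'I_(\dim {:V}) -> B}.

HB.instance Definition _ (V : vectType R[i]) (B : lmodType R[i]) :=
  GRing.Lmodule.on (tensor V B).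

Definition tens (V : vectType R[i]) (B : lmodType R[i]) (v : V) (b : B) :
    tensor V B :=
  [ffun i => coord (vbasis {:V}) i v *: b].

(* The map on the tensor product induced by v (x) b |-> f v b; it does not
   depend on the basis when f is biadditive and f (c *: v) b = f v (c *: b). *)
Definition tlift (V : vectType R[i]) (B : lmodType R[i]) (W : zmodType)
    (f : V -> B -> W) (x : tensor V B) : W :=
  \sum_(i < \dim {:V}) f (vbasis {:V})`_i (x i).

Lemma tensDl (V : vectType R[i]) (B : lmodType R[i]) (b : B) :
  {morph (fun v : V => tens v b) : v w / v + w}.
Proof. by move=> v w; apply/ffunP => i; rewrite !ffunE linearD scalerDl. Qed.

Lemma tensDr (V : vectType R[i]) (B : lmodType R[i]) (v : V) :
  {morph (fun b : B => tens v b) : b c / b + c}.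
Proof. by move=> b c; apply/ffunP => i; rewrite !ffunE scalerDr. Qed.

Lemma tensZ (V : vectType R[i]) (B : lmodType R[i]) c (v : V) (b : B) :
  tens (c *: v) b = tens v (c *: b).
Proof.
by apply/ffunP => i; rewrite !ffunE linearZ /= scalerA mulrC.
Qed.

Lemma tliftD (V : vectType R[i]) (B : lmodType R[i]) (W : zmodType)
    (f : V -> B -> W) :
    (forall v, {morph f v : b c / b + c}) ->
  {morph tlift f : x y / x + y}.
Proof.
move=> fD x y; rewrite /tlift -big_split; apply: eq_bigr => i _.
by rewrite ffunE fD.
Qed.

Lemma tlift_tens (V : vectType R[i]) (B : lmodType R[i]) (W : zmodType)
    (f : V -> B -> W) (v : V) (b : B) :
    (forall b, {morph f^~ b : v w / v + w}) ->
    (forall c v b, f (c *: v) b = f v (c *: b)) ->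
  tlift f (tens v b) = f v b.
Proof.
move=> fD fZ; have f0 : f 0 b = 0.
  by apply: (addrI (f 0 b)); rewrite -fD !addr0.
rewrite /tlift [in RHS](coord_vbasis (memvf v)).
rewrite (big_morph (f^~ b) (fD b) f0).
by apply: eq_bigr => i _; rewrite ffunE fZ.
Qed.

Lemma tlift_id (V : vectType R[i]) (B : lmodType R[i]) (x : tensor V B) :
  tlift (@tens V B) x = x.
Proof.
have eb := vbasisP {:V}.
apply/ffunP => j; rewrite sum_ffunE (bigD1 j) //= big1 => [|i ij].
  by rewrite ffunE (coord_free _ _ (basis_free eb)) eqxx scale1r addr0.
by rewrite ffunE (coord_free _ _ (basis_free eb)) (negPf ij) scale0r.
Qed.

Definition tensor_star (V : vectType R[i]) (B : lmodType R[i])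
    (v : star_ops V) (b : star_ops B) : star_ops (tensor V B) :=
  StarOps (tens (sone v) (sone b))
    (fun x y => tlift (fun v1 b1 =>
       tlift (fun v2 b2 => tens (smul v v1 v2) (smul b b1 b2)) y) x)
    (tlift (fun v1 b1 => tens (sstar v v1) (sstar b b1))).

Lemma smul_tens (A : finStarAlgType R) (B : starAlgType R) (a c : A) (b d : B) :
  smul (tensor_star (alg_star A) (alg_star B)) (tens a b) (tens c d) =
  tens (a * c) (b * d).
Proof.
rewrite /= tlift_tens => [|{}b v w|e v {}b].
- rewrite tlift_tens // => [{}d v w|e v {}d].
    by rewrite mulrDr tensDl.
  by rewrite -scalerAr tensZ scalerAr.
- rewrite /tlift -big_split; apply: eq_bigr => i _.
  by rewrite mulrDl tensDl.
- by apply: eq_bigr => i _; rewrite -scalerAl tensZ scalerAl.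
Qed.

End AlgebraicTensor.

Section MinimalTensor.
Variable R : realType.

Definition is_state (A : starAlgType R) (phi : A -> R[i]) : Prop :=
  [/\ scalar phi, forall a, 0 <= phi (star a * a) & phi 1 = 1].

Variables A B : cstarAlgType R.

(* The sequence [:: (a_1, b_1); ...; (a_n, b_n)] stands for the element
   a_1 (x) b_1 + ... + a_n (x) b_n of the algebraic tensor product. *)
Definition formal_tensor := seq (A * B).

Definition ft_mul (x y : formal_tensor) : formal_tensor :=
  [seq (p.1 * q.1, p.2 * q.2) | p <- x, q <- y].

Definition ft_star (x : formal_tensor) : formal_tensor :=
  [seq (star p.1, star p.2) | p <- x].

Definition ft_eval (phi : A -> R[i]) (psi : B -> R[i]) (x : formal_tensor) :
    R[i] :=
  \sum_(p <- x) phi p.1 * psi p.2.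

(* The spatial norm, i.e. the supremum of the norms of the images in the GNS
   representations of the product states. *)
Definition min_norm (x : formal_tensor) : \bar R :=
  ereal_sup [set r | exists (phi : A -> R[i]) (psi : B -> R[i])
      (y : formal_tensor),
    let ev z := complex.Re (ft_eval phi psi (ft_mul (ft_star z) z)) in
    [/\ is_state phi, is_state psi, ev y != 0 &
        r = (Num.sqrt (ev (ft_mul x y) / ev y))%:E]].

(* T, with (a, b) |-> t a b, is the minimal C*-tensor product of A and B. *)
Record is_min_tensor (T : cstarAlgType R) (t : A -> B -> T) : Prop := {
  mint_linl : forall b, linear (t^~ b);
  mint_linr : forall a, linear (t a);
  mint_one : t 1 1 = 1;
  mint_mul : forall a a' b b', t (a * a') (b * b') = t a b * t a' b';
  mint_star : forall a b, t (star a) (star b) = star (t a b);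
  mint_norm : forall x : formal_tensor,
    (cnorm (\sum_(p <- x) t p.1 p.2))%:E = min_norm x;
  mint_dense :
    closure (lin_span [set t a b | a in setT & b in setT]
             : set (normed_space T)) = setT
}.

End MinimalTensor.

(* cqg_alg2 and cqg_alg3 are the twofold and threefold minimal tensor powers
   of cqg_alg. In cqg_coassoc, cqg_tensl u c is u (x) c, cqg_tensr a u is
   a (x) u, and the existentially quantified maps are comul (x) id and
   id (x) comul. *)
Record compact_quantum_group (R : realType) : Type := CompactQuantumGroup {
  cqg_alg :> cstarAlgType R;
  cqg_alg2 : cstarAlgType R;
  cqg_tens : cqg_alg -> cqg_alg -> cqg_alg2;
  cqg_tensP : is_min_tensor cqg_tens;
  cqg_alg3 : cstarAlgType R;
  cqg_tensl : cqg_alg2 -> cqg_alg -> cqg_alg3;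
  cqg_tenslP : is_min_tensor cqg_tensl;
  cqg_tensr : cqg_alg -> cqg_alg2 -> cqg_alg3;
  cqg_tensrP : is_min_tensor cqg_tensr;
  cqg_tensA : forall a b c,
    cqg_tensl (cqg_tens a b) c = cqg_tensr a (cqg_tens b c);
  cqg_comul : cqg_alg -> cqg_alg2;
  cqg_comul_hom : is_star_hom (alg_star cqg_alg) (alg_star cqg_alg2) cqg_comul;
  cqg_coassoc : exists comul_id id_comul : cqg_alg2 -> cqg_alg3,
    [/\ is_star_hom (alg_star cqg_alg2) (alg_star cqg_alg3) comul_id,
        forall a b, comul_id (cqg_tens a b) = cqg_tensl (cqg_comul a) b,
        is_star_hom (alg_star cqg_alg2) (alg_star cqg_alg3) id_comul,
        forall a b, id_comul (cqg_tens a b) = cqg_tensr a (cqg_comul b)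
      & forall a, comul_id (cqg_comul a) = id_comul (cqg_comul a)];
  cqg_densel :
    closure (lin_span [set cqg_comul a * cqg_tens b 1 | a in setT & b in setT]
             : set (normed_space cqg_alg2)) = setT;
  cqg_denser :
    closure (lin_span [set cqg_comul a * cqg_tens 1 b | a in setT & b in setT]
             : set (normed_space cqg_alg2)) = setT
}.

(* The data needed to speak of morphisms of compact quantum groups: an algebra
   A, its tensor square, and a comultiplication. *)
Record comul_alg (R : realType) := ComulAlg {
  ca_alg : lmodType R[i];
  ca_star : star_ops ca_alg;
  ca_alg2 : lmodType R[i];
  ca_star2 : star_ops ca_alg2;
  ca_tens : ca_alg -> ca_alg -> ca_alg2;
  ca_comul : ca_alg -> ca_alg2
}.

Definition cqg_comul_alg (R : realType) (K : compact_quantum_group R) :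
    comul_alg R :=
  ComulAlg (alg_star K) (alg_star (cqg_alg2 K)) (@cqg_tens _ K) (@cqg_comul _ K).

(* pi2 is pi (x) pi. *)
Definition is_comul_hom (R : realType) (H K : comul_alg R)
    (pi : ca_alg H -> ca_alg K) : Prop :=
  is_star_hom (ca_star H) (ca_star K) pi /\
  exists pi2 : ca_alg2 H -> ca_alg2 K,
    [/\ is_star_hom (ca_star2 H) (ca_star2 K) pi2,
        forall a b, pi2 (ca_tens a b) = ca_tens (pi a) (pi b)
      & forall a, pi2 (ca_comul a) = ca_comul (pi a)].

Definition comul_isomorphic (R : realType) (H K : comul_alg R) : Prop :=
  exists pi : ca_alg H -> ca_alg K, is_comul_hom pi /\ bijective pi.

Section FiniteQuantumGroup.
Variable R : realType.

Definition dual (A : finStarAlgType R) := 'Hom(A, R[i]^o).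

Record finite_quantum_group : Type := FiniteQuantumGroup {
  fqg_alg :> finStarAlgType R;
  comul : fqg_alg -> tensor fqg_alg fqg_alg;
  comul_hom :
    is_star_hom (alg_star fqg_alg)
      (tensor_star (alg_star fqg_alg) (alg_star fqg_alg)) comul;
  comulA : forall a,
    tlift (fun b c => tlift (fun b1 b2 => tens b1 (tens b2 c)) (comul b))
      (comul a) =
    tlift (fun b c => tens b (comul c)) (comul a);
  counit : dual fqg_alg;
  counit1 : counit 1 = 1;
  counitM : forall a b, counit (a * b) = counit a * counit b;
  counitl : forall a, tlift (fun b c => counit b *: c) (comul a) = a;
  counitr : forall a, tlift (fun b c => counit c *: b) (comul a) = a;
  antipode : 'End(fqg_alg);
  antipodel : forall a,
    tlift (fun b c => antipode b * c) (comul a) = counit a *: 1;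
  antipoder : forall a,
    tlift (fun b c => b * antipode c) (comul a) = counit a *: 1;
  faithful_positive : exists omega : dual fqg_alg,
    (forall a, 0 <= omega (star a * a)) /\
    (forall a, omega (star a * a) = 0 -> a = 0)
}.

Variable G : finite_quantum_group.

Record is_haar (h : dual G) : Prop := {
  haar_positive : forall a, 0 <= h (star a * a);
  haar1 : h 1 = 1;
  haarl : forall a, tlift (fun b c => h b *: c) (comul a) = h a *: 1;
  haarr : forall a, tlift (fun b c => h c *: b) (comul a) = h a *: 1
}.

Definition dual_star : star_ops (dual G) :=
  StarOps (counit G)
    (fun phi psi => linfun (fun a : G =>
       tlift (fun b c => phi b * psi c : R[i]^o) (comul a)))
    (fun phi => linfun (fun a : G =>
       ((phi (star (antipode G a)) : R[i])^* : R[i]^o))).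

(* fourier h a is x |-> h (x * a). It is bijective when h is the Haar
   functional (which is faithful), so that its lfun inverse is its inverse. *)
Definition fourier (h : dual G) : 'Hom(G, dual G) :=
  linfun (fun a => (h \o amulr a)%VF).

Section Action.
Variables (K : compact_quantum_group R) (alpha : G -> tensor G K).

Let GK := tensor_star (alg_star G) (alg_star K).

Record is_action : Prop := {
  action_hom : is_star_hom (alg_star G) GK alpha;
  action_coassoc : forall a,
    tlift (fun b k => tlift (fun c l => tens c (cqg_tens l k)) (alpha b))
      (alpha a) =
    tlift (fun b k => tens b (cqg_comul k)) (alpha a);
  action_span :
    lin_span [set smul GK (alpha a) (tens 1 k) | a in setT & k in setT] = setT
}.

Definition acts_by_automorphisms (h : dual G) : Prop :=
  is_action /\
  is_star_hom dual_star (tensor_star dual_star (alg_star K))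
    (fun phi : dual G => tlift (fun b k => tens (fourier h b) k)
       (alpha ((fourier h)^-1%VF phi))).

Definition coefficients : set K :=
  [set tlift (fun b k => rho b *: k) (alpha a) | rho in [set: dual G]
                                               & a in [set: G]].

End Action.

Definition is_cstar_subalg (A : cstarAlgType R) (B : set A) : Prop :=
  [/\ closed (B : set (normed_space A)), B 0,
      forall (c : R[i]) x y, B x -> B y -> B (c *: x + y),
      forall x y, B x -> B y -> B (x * y)
    & forall x, B x -> B (star x)].

Definition is_faithful (K : compact_quantum_group R) (alpha : G -> tensor G K) :
    Prop :=
  smallest (@is_cstar_subalg K) (coefficients alpha) = setT.

Definition is_quantum_automorphism_group (h : dual G)
    (H : compact_quantum_group R) (alpha : G -> tensor G H) : Prop :=
  [/\ acts_by_automorphisms alpha h, is_faithful alpha &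
      forall (K : compact_quantum_group R) (alpha' : G -> tensor G K),
        acts_by_automorphisms alpha' h ->
        exists! pi : H -> K,
          @is_comul_hom R (cqg_comul_alg H) (cqg_comul_alg K) pi /\
          forall a, alpha' a = tlift (fun b k => tens b (pi k)) (alpha a)].

Definition is_hopf_aut (theta : 'End(G)) : Prop :=
  [/\ bijective theta, is_star_hom (alg_star G) (alg_star G) theta
    & forall a, tlift (fun b c => tens (theta b) (theta c)) (comul a) =
                comul (theta a)].

Definition hopf_aut := {theta : 'End(G) | `[< is_hopf_aut theta >]}.

End FiniteQuantumGroup.

Section FunctionAlgebra.
Variables (R : realType) (X : topologicalType).

Definition contfun : Type := continuousType X R[i]^o.
HB.instance Definition _ := Choice.on contfun.
Coercion fun_of_contfun (f : contfun) : X -> R[i]^o := f : continuousType _ _.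

Definition Contfun (f : X -> R[i]^o) (fc : continuous f) : contfun := mkcts fc.

Lemma contfun_continuous (f : contfun) : continuous f.
Proof. exact: (@cts_fun _ _ (f : continuousType _ _)). Qed.

Lemma contfunP (f g : contfun) : f =1 g -> f = g.
Proof. by move=> fg; apply/continuousEP. Qed.

Lemma contfun_add_subproof (f g : contfun) :
  continuous (fun x => f x + g x : R[i]^o).
Proof. by move=> x; apply: cvgD; apply: contfun_continuous. Qed.

Lemma contfun_scale_subproof (c : R[i]) (f : contfun) :
  continuous (fun x => c *: f x : R[i]^o).
Proof. by move=> x; apply: cvgZr; apply: contfun_continuous. Qed.

Lemma contfun_opp_subproof (f : contfun) : continuous (fun x => - f x : R[i]^o).
Proof. by move=> x; apply: cvgN; apply: contfun_continuous. Qed.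

Lemma contfun_cst_subproof (c : R[i]) : continuous (fun _ : X => c : R[i]^o).
Proof. by move=> x; apply: cvg_cst. Qed.

Lemma contfun_mul_subproof (f g : contfun) :
  continuous (fun x => f x * g x : R[i]^o).
Proof. by move=> x; apply: cvgM; apply: contfun_continuous. Qed.

Lemma contfun_conj_subproof (f : contfun) :
  continuous (fun x => (f x : R[i])^* : R[i]^o).
Proof.
move=> x; apply/cvgrPdist_lt => e e0.
have /cvgrPdist_lt/(_ e e0) := @contfun_continuous f x.
by apply: filterS => y; rewrite -rmorphB norm_conjC.
Qed.

Definition contfun0 : contfun := Contfun (@contfun_cst_subproof 0).
Definition contfun1 : contfun := Contfun (@contfun_cst_subproof 1).
Definition contfun_add (f g : contfun) := Contfun (@contfun_add_subproof f g).
Definition contfun_opp (f : contfun) := Contfun (@contfun_opp_subproof f).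
Definition contfun_scale c (f : contfun) :=
  Contfun (@contfun_scale_subproof c f).
Definition contfun_mul (f g : contfun) := Contfun (@contfun_mul_subproof f g).
Definition contfun_conj (f : contfun) := Contfun (@contfun_conj_subproof f).

Lemma contfun_addA : associative contfun_add.
Proof. by move=> f g h; apply: contfunP => x; apply: addrA. Qed.
Lemma contfun_addC : commutative contfun_add.
Proof. by move=> f g; apply: contfunP => x; apply: addrC. Qed.
Lemma contfun_add0 : left_id contfun0 contfun_add.
Proof. by move=> f; apply: contfunP => x; apply: add0r. Qed.
Lemma contfun_addN : left_inverse contfun0 contfun_opp contfun_add.
Proof. by move=> f; apply: contfunP => x; apply: addNr. Qed.

HB.instance Definition _ := GRing.isZmodule.Build contfun
  contfun_addA contfun_addC contfun_add0 contfun_addN.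

Lemma contfun_scaleA c d f :
  contfun_scale c (contfun_scale d f) = contfun_scale (c * d) f.
Proof. by apply: contfunP => x; apply: scalerA. Qed.
Lemma contfun_scale1 : left_id 1 contfun_scale.
Proof. by move=> f; apply: contfunP => x; apply: scale1r. Qed.
Lemma contfun_scaleDr : right_distributive contfun_scale +%R.
Proof. by move=> c f g; apply: contfunP => x; apply: scalerDr. Qed.
Lemma contfun_scaleDl f : {morph contfun_scale^~ f : c d / c + d}.
Proof. by move=> c d; apply: contfunP => x; apply: scalerDl. Qed.

HB.instance Definition _ := GRing.Zmodule_isLmodule.Build R[i] contfun
  contfun_scaleA contfun_scale1 contfun_scaleDr contfun_scaleDl.

Definition contfun_star : star_ops contfun :=
  StarOps contfun1 contfun_mul contfun_conj.

End FunctionAlgebra.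

Section ClassicalGroup.
Variables (R : realType) (X : topologicalType) (op : X * X -> X).
Hypothesis op_continuous : continuous op.

Lemma contfun_tens_subproof (f g : contfun R X) :
  continuous (fun p : X * X => f p.1 * g p.2 : R[i]^o).
Proof.
move=> p; apply: cvgM.
  apply: (@cvg_comp _ _ _ fst f _ (nbhs p.1)); first exact: cvg_fst.
  exact: contfun_continuous.
apply: (@cvg_comp _ _ _ snd g _ (nbhs p.2)); first exact: cvg_snd.
exact: contfun_continuous.
Qed.

Lemma contfun_comul_subproof (f : contfun R X) :
  continuous (fun p : X * X => f (op p)).
Proof.
move=> p; apply: continuous_comp; first exact: op_continuous.
exact: contfun_continuous.
Qed.

(* C(X) (x) C(X) is identified with C(X * X). *)
Definition group_comul_alg : comul_alg R :=
  ComulAlg (contfun_star R X) (contfun_star R (X * X)%type)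
    (fun f g => Contfun (@contfun_tens_subproof f g))
    (fun f => Contfun (@contfun_comul_subproof f)).

End ClassicalGroup.

Section AutomorphismGroup.
Variables (R : realType) (G : finite_quantum_group R).

Lemma is_hopf_aut_comp (theta1 theta2 : 'End(G)) :
  is_hopf_aut theta1 -> is_hopf_aut theta2 ->
  is_hopf_aut (theta1 \o theta2)%VF.
Proof.
move=> [b1 [_ one1 mul1 star1] co1] [b2 [_ one2 mul2 star2] co2]; split.
- apply: (eq_bij (bij_comp b1 b2)) => x; exact/esym/comp_lfunE.
- split=> [c x y||x y|x]; first exact: linearP.
  + by rewrite comp_lfunE one2 one1.
  + by rewrite !comp_lfunE mul2 mul1.
  + by rewrite !comp_lfunE star2 star1.
- move=> a; rewrite comp_lfunE -co1 -co2.
  pose t12 (b c : G) := tens (theta1 b) (theta1 c).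
  have tD : {morph tlift t12 : x y / x + y}.
    by apply: tliftD => v x y; rewrite /t12 linearD tensDr.
  have t0 : tlift t12 0 = 0 by apply: (addrI (tlift t12 0)); rewrite -tD !addr0.
  rewrite -/t12 [X in _ = tlift t12 X]/tlift (big_morph _ tD t0).
  apply: eq_bigr => i _; rewrite tlift_tens ?comp_lfunE// => [b x y|c x b].
    by rewrite /t12 linearD tensDl.
  by rewrite /t12 !linearZ /= tensZ.
Qed.

HB.instance Definition _ := Choice.on (hopf_aut G).

Definition hopf_aut_mx (theta : hopf_aut G) : 'M[R[i]^o]_(\dim {:G}) :=
  passmx.mxof (vbasis {:G}) (vbasis {:G}) (val theta).

(* The topology inherited from the linear maps, identified with matrices. *)
HB.instance Definition _ :=
  Topological.copy (hopf_aut G) (initial_topology hopf_aut_mx).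

Definition hopf_aut_comp (p : hopf_aut G * hopf_aut G) : hopf_aut G :=
  exist _ (val p.1 \o val p.2)%VF
    (introT (asboolP _)
      (is_hopf_aut_comp (asboolW (valP p.1)) (asboolW (valP p.2)))).

Lemma hopf_aut_mx_comp p :
  hopf_aut_mx (hopf_aut_comp p) = hopf_aut_mx p.2 *m hopf_aut_mx p.1.
Proof. by apply: passmx.mxof_comp; apply: vbasisP. Qed.

Lemma hopf_aut_comp_continuous : continuous hopf_aut_comp.
Proof.
apply: continuous_comp_initial => p A [P nP sPA].
have mx_cont k1 k2 : continuous (fun theta => hopf_aut_mx theta k1 k2).
  move=> theta; apply: (@cvg_comp _ _ _ hopf_aut_mx
    (fun M : 'M[R[i]^o]_(\dim {:G}) => M k1 k2) _ (nbhs (hopf_aut_mx theta))).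
    exact: (@initial_continuous _ _ hopf_aut_mx theta).
  exact: (@coord_continuous R[i] _ _ k1 k2 (hopf_aut_mx theta)).
have entry i j : continuous (fun q => hopf_aut_mx (hopf_aut_comp q) i j).
  rewrite (_ : (fun q => _) = fun q =>
      \sum_k hopf_aut_mx q.2 i k * hopf_aut_mx q.1 k j); last first.
    by apply/funext => q; rewrite hopf_aut_mx_comp mxE.
  apply: (@continuous_big R[i]^o) => [|k _ q]; first exact: add_continuous.
  apply: cvgM.
    apply: (@cvg_comp _ _ _ snd
      (fun theta => hopf_aut_mx theta i k) _ (nbhs q.2)).
      exact: cvg_snd.
    exact: mx_cont.
  apply: (@cvg_comp _ _ _ fst
    (fun theta => hopf_aut_mx theta k j) _ (nbhs q.1)).
    exact: cvg_fst.
  exact: mx_cont.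
have F : Filter (nbhs p) by exact: nbhs_filter.
have Pp i : nbhs p (fun q =>
    forall j, P i j (hopf_aut_mx (hopf_aut_comp q) i j)).
  apply: (@filter_forall _ _ (fun j q =>
    P i j (hopf_aut_mx (hopf_aut_comp q) i j)) _ F) => j.
  exact: (entry i j p _ (nP i j)).
by apply: filterS (filter_forall F Pp) => q Pq; apply: sPA.
Qed.

Definition hopf_aut_comul_alg : comul_alg R :=
  group_comul_alg R hopf_aut_comp_continuous.

End AutomorphismGroup.

(* Main.v *)
(** Conjugating by the Fourier transform, multiplicativity and *-preservation
    on the dual say that an action alpha by automorphisms intertwines the
    comultiplication of the algebra, its legs in C(K) being multiplied, while
    the Haar functional is invariant. In every Hopf algebra
    b (x) a = S(a_1) (a_2 b_1) (x) (a_3 b_2) S(b_3), and the right-hand side is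
    assembled from the product and the coproduct; applying alpha shows that the
    coefficients of alpha commute. If alpha is faithful they generate C(K), so
    C(K) is commutative.

    A character chi of C(H) thus gives the Hopf automorphism (id (x) chi) alpha.
    Conversely C(Aut) is itself a compact quantum group acting by
    automorphisms, and the universal property yields pi : C(H) -> C(Aut) with
    pi(z)((id (x) chi) alpha) = chi(z). Commutative C*-algebras have enough
    characters to attain the norm, so pi is isometric; its range is closed and
    separates points, so pi is onto by the Stone-Weierstrass theorem. *)

From HB Require Import structures.
Require Import Defs.
From mathcomp Require Import all_boot all_order all_algebra all_field.
From mathcomp Require Import all_classical all_reals all_analysis.
From mathcomp Require Import complex ring lra.

Set Implicit Arguments.
Unset Strict Implicit.
Unset Printing Implicit Defensive.

Import Order.TTheory GRing.Theory Num.Theory.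
Import numFieldNormedType.Exports.
Local Open Scope classical_set_scope.
Local Open Scope complex_scope.
Local Open Scope ring_scope.

(** The delicate point of the commutation argument is the order of the factors in C(K).
    Multiplicativity on the dual, combined with the invariance of h, first gives the coefficient of
    a convolution product rho sigma at x as the sum of the products u_sigma(x2) u_rho(x1), in
    reversed order. Since alpha and the comultiplication preserve the involution, whereas the star
    of C(K) reverses products, taking adjoints restores the order.

    Characters come from an order on the self-adjoint elements: square roots, obtained as fixed
    points of contractions, supply sums of squares, and a maximal quadratic module makes the order
    total. A character attaining the norm at x0 is enforced by putting y - 1, with y = star x0 * x0,
    into the module; this is consistent because 1 - y is not invertible.

    For C(Aut), h is again the tool: its positivity and invariance bound the matrix entries, and its
    non-degeneracy keeps ultrafilter limits of automorphisms bijective. The minimal tensor norm of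
    function algebras is the supremum norm on the product, because point evaluations are states and
    every state is monotone. *)

Section Linearity.
Variable C : fieldType.

Lemma lin_id (U : lmodType C) : linear (fun x : U => x).
Proof. by []. Qed.

Lemma lin_mulr (U : lmodType C) (B : algType C) (g : U -> B) (c : B) :
  linear g -> linear (fun x => c * g x).
Proof. by move=> lg k x y; rewrite lg mulrDr scalerAr. Qed.

Lemma lin_mull (U : lmodType C) (B : algType C) (g : U -> B) (c : B) :
  linear g -> linear (fun x => g x * c).
Proof. by move=> lg k x y; rewrite lg mulrDl scalerAl. Qed.

Lemma lin_scaler (U W : lmodType C) (g : U -> W) (c : C) :
  linear g -> linear (fun x => c *: g x).
Proof. by move=> lg k x y; rewrite lg scalerDr !scalerA mulrC. Qed.

Lemma lin_scalel (U W : lmodType C) (g : U -> C^o) (w : W) :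
  linear g -> linear (fun x => g x *: w).
Proof. by move=> lg k x y; rewrite lg scalerDl scalerA. Qed.

Lemma lin_comp (U V W : lmodType C) (f : V -> W) (g : U -> V) :
  linear f -> linear g -> linear (fun x => f (g x)).
Proof. by move=> lf lg k x y; rewrite lg lf. Qed.

Lemma lin0 (U W : lmodType C) (f : U -> W) : linear f -> f 0 = 0.
Proof.
move=> lf; have := lf (-1) 0 0.
by rewrite scaler0 addr0 scaleN1r addNr.
Qed.

Lemma linZ (U W : lmodType C) (f : U -> W) : linear f ->
  forall k x, f (k *: x) = k *: f x.
Proof. by move=> lf k x; have := lf k x 0; rewrite !addr0 (lin0 lf) addr0. Qed.

Lemma linD (U W : lmodType C) (f : U -> W) : linear f ->
  {morph f : x y / x + y}.
Proof. by move=> lf x y; have := lf 1 x y; rewrite !scale1r. Qed.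

End Linearity.

(** * Contractions of algebraic tensors *)

Section Tensor.
Variable R : realType.
Local Notation C := R[i].
Implicit Types (V : vectType C) (B W : lmodType C).

Lemma lin_tens_l V B (U : lmodType C) (g : U -> V) (b : B) :
  linear g -> linear (fun x => tens (g x) b).
Proof.
move=> lg k x y; rewrite lg; apply/ffunP => i.
by rewrite !ffunE linearP /= scalerDl scalerA.
Qed.

Lemma lin_tens_r V B (U : lmodType C) (g : U -> B) (v : V) :
  linear g -> linear (fun x => tens v (g x)).
Proof.
move=> lg k x y; rewrite lg; apply/ffunP => i.
by rewrite !ffunE scalerDr !scalerA mulrC.
Qed.

Lemma lin_tlift_body V B W (U : lmodType C) (T : U -> V -> B -> W)
    (z : tensor V B) :
  (forall v b, linear (fun x => T x v b)) -> linear (fun x => tlift (T x) z).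
Proof.
move=> lT k x y; rewrite /tlift scaler_sumr -big_split.
by apply: eq_bigr => i _; rewrite lT.
Qed.

Lemma lin_tlift_arg V B W (U : lmodType C) (T : V -> B -> W)
    (z : U -> tensor V B) :
  (forall v, linear (T v)) -> linear z -> linear (fun x => tlift T (z x)).
Proof.
move=> lT lz k x y; rewrite lz /tlift scaler_sumr -big_split.
by apply: eq_bigr => i _; rewrite !ffunE lT.
Qed.

Lemma eq_tlift V B (W : zmodType) (S T : V -> B -> W) (z : tensor V B) :
  (forall v b, S v b = T v b) -> tlift S z = tlift T z.
Proof. by move=> ST; apply: eq_bigr => i _; rewrite ST. Qed.

Definition bilin V B W (T : V -> B -> W) :=
  (forall b, linear (T^~ b)) /\ (forall v, linear (T v)).

Lemma tlift_tensE V B W (T : V -> B -> W) v b :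
  bilin T -> tlift T (tens v b) = T v b.
Proof.
move=> [lT1 lT2]; rewrite tlift_tens // => [{}b x y|k {}v {}b].
  exact: linD (lT1 b) x y.
by rewrite (linZ (lT1 b)) (linZ (lT2 v)).
Qed.

Lemma tlift_bind V B V' B' W (T : V -> B -> W) (S : V' -> B' -> tensor V B) z :
  (forall v, linear (T v)) ->
  tlift T (tlift S z) = tlift (fun v b => tlift T (S v b)) z.
Proof.
move=> lT; have tD : {morph tlift T : x y / x + y}.
  by apply: tliftD => v; apply: linD.
have t0 : tlift T 0 = 0 by apply: (addrI (tlift T 0)); rewrite -tD !addr0.
by rewrite [tlift S z]/tlift (big_morph _ tD t0).
Qed.

Lemma tlift_lin V B W W' (f : W -> W') (S : V -> B -> W) z :
  linear f -> f (tlift S z) = tlift (fun v b => f (S v b)) z.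
Proof.
by move=> lf; rewrite /tlift (big_morph f (linD lf) (lin0 lf)).
Qed.

Lemma exchange_tlift V B V' B' (W : zmodType) (T : V -> B -> V' -> B' -> W) z z' :
  tlift (fun v b => tlift (T v b) z') z =
  tlift (fun v' b' => tlift (fun v b => T v b v' b') z) z'.
Proof. by rewrite /tlift exchange_big. Qed.

End Tensor.

Lemma lin_lfun (C : fieldType) (U : lmodType C) (V W : vectType C)
    (f : 'Hom(V, W)) (g : U -> V) : linear g -> linear (fun x => f (g x)).
Proof. by move=> lg k x y; rewrite lg linearP. Qed.

(** Linearity in one variable of an expression in Sweedler form. Only one factor contains the
    variable, and the test for a constant function finds out which. Maps such as [comul] and [alpha]
    are not recognised by their shape: their linearity is taken from the context, where the proofs
    below place it beforehand ([lc], [la], [c2]). *)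
Ltac lin_step :=
  lazymatch goal with
  | |- forall _, _ => intro
  | |- bilin _ => split; intro; cbv beta
  | |- @GRing.linear_for _ _ _ _ ?F =>
    lazymatch F with
    | (fun x => x) => exact: lin_id
    | (fun x => @tlift _ _ _ _ (@?T x) _) =>
      lazymatch T with
      | (fun _ => ?u) => refine (lin_tlift_arg _ _)
      | _ => refine (lin_tlift_body _ _)
      end
    | @tlift _ _ _ _ ?T =>
      refine (@lin_tlift_arg _ _ _ _ _ T (fun x => x) _ _)
    | (fun x => @tens _ _ _ (@?v x) _) =>
      lazymatch v with
      | (fun _ => ?u) => refine (lin_tens_r _ _)
      | _ => refine (lin_tens_l _ _)
      end
    | (fun x => @GRing.mul _ (@?v x) _) =>
      lazymatch v with
      | (fun _ => ?u) => refine (lin_mulr _ _)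
      | _ => refine (lin_mull _ _)
      end
    | (fun x => @GRing.scale _ _ (@?v x) _) =>
      lazymatch v with
      | (fun _ => ?u) => refine (lin_scaler _ _)
      | _ => refine (lin_scalel _ _)
      end
    | (fun x => @fun_of_lfun _ _ _ ?f (@?g x)) => refine (lin_lfun _ _)
    | @GRing.mul _ ?c => refine (@lin_mulr _ _ _ (fun x => x) c _)
    | @GRing.scale _ _ ?c => refine (@lin_scaler _ _ _ (fun x => x) c _)
    | @tens _ _ _ ?v => refine (@lin_tens_r _ _ _ _ (fun x => x) v _)
    | @fun_of_lfun _ _ _ ?f => exact: linearP
    | _ =>
      match goal with
      | H : @GRing.linear_for _ _ _ _ _ |- _ => exact: H
      | H : forall _, @GRing.linear_for _ _ _ _ _ |- _ => exact: H
      | H : forall _ _, @GRing.linear_for _ _ _ _ _ |- _ => exact: H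
      | H : forall _ _ _, @GRing.linear_for _ _ _ _ _ |- _ => exact: H
      | H : @GRing.linear_for _ _ _ _ _ |- _ => refine (lin_comp H _)
      | H : forall _, @GRing.linear_for _ _ _ _ _ |- _ => refine (lin_comp (H _) _)
      | H : forall _ _, @GRing.linear_for _ _ _ _ _ |- _ => refine (lin_comp (H _ _) _)
      | H : forall _ _ _, @GRing.linear_for _ _ _ _ _ |- _ => refine (lin_comp (H _ _ _) _)
      end
    end
  end; cbv beta.
Ltac lin := repeat (progress lin_step).

(** * Homomorphisms into a tensor product, and the involution *)

Section Hom.
Variables (R : realType) (G : finStarAlgType R).

(** Multiplicativity tested against a bilinear map, the form in which Sweedler calculations use it.
    It serves for [comul] and for [alpha] alike. *)
Lemma hom_tliftM (B : starAlgType R) (f : G -> tensor G B) (W : lmodType R[i])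
    (T : G -> B -> W) (a b : G) :
  is_star_hom (alg_star G) (tensor_star (alg_star G) (alg_star B)) f ->
  bilin T ->
  tlift T (f (a * b)) =
  tlift (fun x k => tlift (fun y l => T (x * y) (k * l)) (f b)) (f a).
Proof.
move=> [_ _ fM _] bT; have [T1 T2] := bT.
rewrite [f _]fM /= tlift_bind //; apply: eq_tlift => x k.
by rewrite tlift_bind //; apply: eq_tlift => y l; rewrite tlift_tensE.
Qed.

Lemma hom_tlift1 (B : starAlgType R) (f : G -> tensor G B) (W : lmodType R[i])
    (T : G -> B -> W) :
  is_star_hom (alg_star G) (tensor_star (alg_star G) (alg_star B)) f ->
  bilin T -> tlift T (f 1) = T 1 1.
Proof. by move=> [_ f1 _ _] bT; rewrite [f 1]f1 /= tlift_tensE. Qed.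

Lemma starD (A : starAlgType R) (x y : A) : star (x + y) = star x + star y.
Proof. by have := star_semilinear 1 x y; rewrite rmorph1 !scale1r. Qed.

Lemma star0 (A : starAlgType R) : star 0 = 0 :> A.
Proof. by apply: (addrI (star 0)); rewrite -starD !addr0. Qed.

Lemma starZ (A : starAlgType R) (c : R[i]) (x : A) :
  star (c *: x) = c^* *: star x.
Proof. by have := star_semilinear c x 0; rewrite star0 !addr0. Qed.

Lemma star1 (A : starAlgType R) : star 1 = 1 :> A.
Proof. by rewrite -[RHS](@starK R) -[star 1 in RHS]mul1r starM starK mul1r. Qed.

Lemma starN (A : starAlgType R) (x : A) : star (- x) = - star x.
Proof. by apply: (addrI (star x)); rewrite -starD !subrr star0. Qed.

Lemma star_sum (A : starAlgType R) (I : Type) (r : seq I) (F : I -> A) :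
  star (\sum_(i <- r) F i) = \sum_(i <- r) star (F i).
Proof. exact: (big_morph _ (@starD A) (@star0 A)). Qed.

Lemma hom_tlift_star (B : starAlgType R) (f : G -> tensor G B)
    (W : lmodType R[i]) (T : G -> B -> W) (a : G) :
  is_star_hom (alg_star G) (tensor_star (alg_star G) (alg_star B)) f ->
  bilin T ->
  tlift T (f (star a)) = tlift (fun x k => T (star x) (star k)) (f a).
Proof.
move=> [_ _ _ fS] bT; have [T1 T2] := bT.
rewrite [f _]fS /= tlift_bind //; apply: eq_tlift => x k.
by rewrite tlift_tensE.
Qed.

End Hom.

(** * Elementary estimates in a C*-algebra *)

Section CstarNorm.
Variables (R : realType) (A : preCstarAlgType R).
Implicit Types x y : A.

Lemma cnormN x : cnorm (- x) = cnorm x.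
Proof.
by apply: complexI; rewrite -scaleN1r cnormZ normrN1 mul1r.
Qed.

Lemma cnorm0 : cnorm (0 : A) = 0.
Proof.
have := cnormZ 0 (0 : A); rewrite scale0r normr0 mul0r => /eqP.
by rewrite fmorph_eq0 => /eqP.
Qed.

Lemma cnormB x y : cnorm (x - y) = cnorm (y - x).
Proof. by rewrite -cnormN opprB. Qed.

Lemma cnorm_ge0 x : 0 <= cnorm x.
Proof.
have := cnormD x (- x); rewrite subrr cnorm0 cnormN.
by rewrite -mulr2n pmulrn_lge0.
Qed.

Lemma cnorm_le0 x : cnorm x <= 0 -> x = 0.
Proof.
by move=> x0; apply: cnorm_eq0; apply/eqP; rewrite eq_le x0 cnorm_ge0.
Qed.

Lemma cnorm_distD x y z : cnorm (x - z) <= cnorm (x - y) + cnorm (y - z).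
Proof. have -> : x - z = (x - y) + (y - z) by rewrite addrA subrK.
exact: cnormD. Qed.

Lemma cnorm1 : cnorm (1 : A) = 1.
Proof.
have n1 : cnorm (1 : A) != 0.
  by apply/eqP => /cnorm_eq0 /eqP; rewrite oner_eq0.
have := cnorm_star_mul (1 : A); rewrite star1 mulr1 expr2 => e.
by apply: (mulfI n1); rewrite -e mulr1.
Qed.

Lemma cnorm_star x : cnorm (star x) = cnorm x.
Proof.
suff le y : cnorm y <= cnorm (star y).
  by apply/eqP; rewrite eq_le le andbT; have := le (star x); rewrite starK.
have [->|y0] := eqVneq (cnorm y) 0; first exact: cnorm_ge0.
have y1 : 0 < cnorm y by rewrite lt_def y0 cnorm_ge0.
by rewrite -(ler_pM2r y1) -expr2 -cnorm_star_mul cnormM.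
Qed.

(** The norm of [normed_space A] takes values in [R[i]], where a positive radius equals its real
    part. This passes to real radii. *)
Lemma cnorm_closureP (S : set A) x :
  closure (S : set (normed_space A)) x <->
  forall e : R, 0 < e -> exists2 y, S y & cnorm (x - y) < e.
Proof.
split=> [cl e e0|cl B].
  have e1 : 0 < e%:C by rewrite ltcR.
  have [y [Sy]] := cl _ (nbhsx_ballx (x : normed_space A) _ e1).
  rewrite -ball_normE /= => xy; exists y => //.
  by rewrite -ltcR.
move=> /nbhs_ballP[e /= e0 eB].
have eE : e = (complex.Re e)%:C.
  by apply/esym/RRe_real/gtr0_real.
have [|y Sy xy] := cl (complex.Re e); first by rewrite -ltcR -eE.
exists y; split=> //; apply: eB; rewrite -ball_normE /= eE.
by rewrite ltcR.
Qed.

Lemma closed_cnorm (S : set A) :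
  (forall x, (forall e : R, 0 < e -> exists2 y, S y & cnorm (x - y) < e) -> S x) ->
  closed (S : set (normed_space A)).
Proof. by move=> cS x /cnorm_closureP; apply: cS. Qed.

End CstarNorm.

Section CstarComplete.
Variables (R : realType) (A : cstarAlgType R).

Lemma cnorm_cauchy_cvg (u : nat -> A) :
  (forall e : R, 0 < e -> exists N, forall m n, (N <= m)%N -> (N <= n)%N ->
     cnorm (u m - u n) < e) ->
  exists l, forall e : R, 0 < e -> exists N, forall n, (N <= n)%N ->
     cnorm (l - u n) < e.
Proof.
move=> cu; pose v : nat -> normed_space A := u.
have /cvg_ex[l lv] : cvg (v @ \oo).
  apply: cstar_complete; apply/cauchy_ballP => e e0.
  have eE : e = (complex.Re e)%:C by apply/esym/RRe_real/gtr0_real.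
  have [|N NP] := cu (complex.Re e); first by rewrite -ltcR -eE.
  exists (v @` [set n | (N <= n)%N], v @` [set n | (N <= n)%N]) => /=.
    by split; exists N => // n Nn; exists n.
  move=> [_ _] [[m Nm <-] [n Nn <-]]; rewrite -ball_normE /= eE ltcR.
  exact: NP.
exists (l : A) => e e0; have e1 : 0 < e%:C by rewrite ltcR.
have [N _ NP] := cvgr_dist_lt _ _ lv _ e1.
by exists N => n /NP; rewrite /= ltcR.
Qed.

End CstarComplete.

(** * Commutation of the coefficients *)

Section Hopf.
Variables (R : realType) (G : finite_quantum_group R).
Local Notation C := R[i].
Implicit Types (W : lmodType C).

Definition trilin (V B D W : lmodType C) (T : V -> B -> D -> W) :=
  [/\ forall b d, linear (fun v => T v b d), forall v d, linear (fun b => T v b d)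
    & forall v b, linear (T v b)].

Lemma comul_linear : linear (@comul R G).
Proof. by have [] := @comul_hom R G. Qed.

Lemma comul_coassoc W (T : G -> G -> G -> W) (a : G) : trilin T ->
  tlift (fun b c => tlift (fun b1 b2 => T b1 b2 c) (comul b)) (comul a) =
  tlift (fun b c => tlift (T b) (comul c)) (comul a).
Proof.
move=> [T1 T2 T3]; have lc := comul_linear.
have T1' b d : linear (T^~ b ^~ d) by exact: T1.
pose E (b : G) (t : tensor G G) := tlift (T b) t.
have E1 t : linear (E^~ t) by apply: lin_tlift_body.
have E2 b : linear (E b) by apply: (lin_tlift_arg (T3 b)) => //; apply: lin_id.
have bE : bilin E by split.
have := congr1 (tlift E) (comulA a).
rewrite !tlift_bind //.
have -> : tlift (fun v b => tlift E (tlift (fun b1 b2 => tens b1 (tens b2 b))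
    (comul v))) (comul a) =
  tlift (fun b c => tlift (fun b1 b2 => T b1 b2 c) (comul b)) (comul a).
  apply: eq_tlift => b c; rewrite tlift_bind //; apply: eq_tlift => b1 b2.
  by rewrite tlift_tensE // /E tlift_tensE //; split.
by move=> ->; apply: eq_tlift => b c; rewrite tlift_tensE.
Qed.

Lemma comul_counitl W (f : G -> W) (a : G) : linear f ->
  tlift (fun b c => f (counit G b *: c)) (comul a) = f a.
Proof. by move=> lf; rewrite -(tlift_lin _ _ lf) counitl. Qed.

Lemma comul_counitr W (f : G -> W) (a : G) : linear f ->
  tlift (fun b c => f (counit G c *: b)) (comul a) = f a.
Proof. by move=> lf; rewrite -(tlift_lin _ _ lf) counitr. Qed.

Lemma comul_antipodel W (f : G -> W) (a : G) : linear f ->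
  tlift (fun b c => f (antipode G b * c)) (comul a) = counit G a *: f 1.
Proof.
by move=> lf; rewrite -(tlift_lin _ _ lf) antipodel (linZ lf).
Qed.

Lemma comul_antipoder W (f : G -> W) (a : G) : linear f ->
  tlift (fun b c => f (b * antipode G c)) (comul a) = counit G a *: f 1.
Proof.
by move=> lf; rewrite -(tlift_lin _ _ lf) antipoder (linZ lf).
Qed.

Variable h : dual G.
Hypothesis haar_h : is_haar h.

Lemma haar_linear : linear (h : G -> C^o).
Proof. exact: linearP. Qed.

(** Strong invariance of h: inserting S(x1) x2 in front of a1 and moving brackets by coassociativity
    produces S(x1) (id ⊗ h) comul(x2 a), to which [haarr] applies. *)
Lemma haar_stronginv W (f : G -> W) (x a : G) : linear f ->
  tlift (fun a1 a2 => h (x * a2) *: f a1) (comul a) =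
  tlift (fun x1 x2 => h (x2 * a) *: f (antipode G x1)) (comul x).
Proof.
move=> lf.
have lh := haar_linear; have lc := comul_linear.
have h1 y : h y *: f 1 = tlift (fun b c => h c *: f b) (comul y).
  rewrite -(linZ lf) -(haarr haar_h y) (tlift_lin _ _ lf).
  by apply: eq_tlift => b c; rewrite (linZ lf).
transitivity (tlift (fun x1 x2 => tlift (fun y z => tlift (fun a1 a2 =>
   h (z * a2) *: f (antipode G x1 * (y * a1))) (comul a)) (comul x2)) (comul x)).
  rewrite -(@comul_coassoc _ (fun x1 y z => tlift (fun a1 a2 =>
   h (z * a2) *: f (antipode G x1 * (y * a1))) (comul a))); last first.
    by split; lin.
  pose E b c := tlift (fun a1 a2 => h (c * a2) *: f (b * a1)) (comul a).
  transitivity (tlift (fun b c => E 1 (counit G b *: c)) (comul x)); last first.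
    apply: eq_tlift => b c.
    rewrite (linZ (f := E 1)); last by rewrite /E; lin.
    rewrite -(@comul_antipodel _ (fun b => E b c)); last by rewrite /E; lin.
    by apply: eq_tlift => b1 b2; apply: eq_tlift => a1 a2; rewrite mulrA.
  rewrite (@comul_counitl _ (E 1)); last by rewrite /E; lin.
  by apply: eq_tlift => a1 a2; rewrite mul1r.
apply: eq_tlift => x1 x2.
pose F (y : G) := f (antipode G x1 * y).
have lF : linear F by rewrite /F; lin.
rewrite -[in RHS](mulr1 (antipode G x1)) -/(F 1) -(linZ lF) -(haarr haar_h) (tlift_lin _ _ lF).
rewrite (hom_tliftM _ _ (@comul_hom R G)); last by lin.
by apply: eq_tlift => y z; apply: eq_tlift => a1 a2; rewrite (linZ lF).
Qed.

(** By strong invariance the right legs of [comul y] inherit the condition imposed on y. Hence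
    counit(y) = h(S(y1) y2) = 0 for every such y, and a = a1 counit(a2) = 0. *)
Lemma haar_nondegenerate (a : G) : (forall x, h (x * a) = 0) -> a = 0.
Proof.
have coideal y : (forall x, h (x * y) = 0) -> forall i x, h (x * comul y i) = 0.
  move=> hy i x.
  have := @haar_stronginv _ id x y (@lin_id _ _).
  rewrite [RHS]big1 => [|j _]; last by rewrite hy scale0r.
  move=> /(congr1 (coord (vbasis {:G}) i)); rewrite linear_sum linear0 /=.
  rewrite (bigD1 i) //= big1 => [|j ji]; rewrite linearZ /= coord_free;
    rewrite ?(basis_free (vbasisP _)) ?eqxx//.
    by rewrite addr0 mulr1.
  by move: ji; case: eqP => // _ _; rewrite mulr0.
have eps0 y : (forall x, h (x * y) = 0) -> counit G y = 0.
  move=> /coideal hy; have := comul_antipodel y haar_linear.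
  rewrite haar1 // => e; rewrite -[LHS]mulr1; apply: etrans (esym e) _.
  by rewrite /tlift big1 ?mul0r // => i _; exact: hy.
move=> /coideal ha; rewrite -(comul_counitr a (@lin_id _ _)).
by rewrite /tlift big1 // => i _; rewrite eps0 ?scale0r.
Qed.
End Hopf.

Lemma linfunE (C : fieldType) (V W : vectType C) (f : V -> W) : linear f ->
  linfun f =1 f.
Proof.
move=> lf x; pose F : {linear V -> W} :=
  HB.pack f (GRing.isLinear.Build C V W *:%R f lf).
exact: (lfunE F x).
Qed.

(** * The Fourier transform and the coefficients of an action *)

Section Fourier.
Variables (R : realType) (G : finite_quantum_group R) (h : dual G).
Local Notation C := R[i].
Hypothesis haar_h : is_haar h.

Lemma fourierE (a x : G) : fourier h a x = h (x * a).
Proof.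
rewrite /fourier linfunE; first by rewrite comp_lfunE lfunE.
move=> k u v; apply/lfunP => y.
by rewrite !(add_lfunE, scale_lfunE, comp_lfunE, lfunE) /= mulrDr -scalerAr linearP.
Qed.

Lemma fourier_ker : lker (fourier h) == 0%VS.
Proof.
apply/lker0P => a b ab; apply/eqP; rewrite -subr_eq0; apply/eqP.
apply: (haar_nondegenerate haar_h) => x.
by rewrite -fourierE linearB /= ab subrr zero_lfunE.
Qed.

Lemma fourierK : cancel (fourier h) (fourier h)^-1%VF.
Proof. exact: lker0_lfunK fourier_ker. Qed.

Lemma fourierVK : cancel (fourier h)^-1%VF (fourier h).
Proof.
move=> phi; apply: limg_lfunVK.
suff -> : limg (fourier h) = fullv by exact: memvf.
apply/eqP; rewrite eqEdim subvf /=.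
rewrite limg_dim_eq; last by rewrite (eqP fourier_ker) capv0.
by rewrite !dimvf /= /dim /= muln1.
Qed.

Lemma fourier1 : fourier h 1 = h.
Proof. by apply/lfunP => x; rewrite fourierE mulr1. Qed.

Definition dual_conv (phi psi : dual G) : dual G := smul (dual_star G) phi psi.

Lemma dual_convE (phi psi : dual G) (a : G) :
  dual_conv phi psi a = tlift (fun b c => phi b * psi c : C^o) (comul a).
Proof.
rewrite /dual_conv /= linfunE //; have lc := @comul_linear _ G.
by apply: lin_tlift_arg => // v k x y; rewrite linearP mulrDr scalerAr.
Qed.

Lemma dual_conv_linl (psi : dual G) : linear (dual_conv^~ psi).
Proof.
move=> k x y; apply/lfunP => a.
rewrite !(add_lfunE, scale_lfunE, dual_convE) /tlift scaler_sumr -big_split /=.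
by apply: eq_bigr => i _; rewrite !(add_lfunE, scale_lfunE) mulrDl scalerAl.
Qed.

Lemma dual_conv_linr (phi : dual G) : linear (dual_conv phi).
Proof.
move=> k x y; apply/lfunP => a.
rewrite !(add_lfunE, scale_lfunE, dual_convE) /tlift scaler_sumr -big_split /=.
by apply: eq_bigr => i _; rewrite !(add_lfunE, scale_lfunE) mulrDr scalerAr.
Qed.

(** The Haar functional is an integral of the dual algebra, phi h = phi(1) h; this is [haarr],
    multiplied by a and integrated. *)
Lemma dual_conv_haar (a : G) : dual_conv (fourier h a) h = h a *: h.
Proof.
apply/lfunP => x; rewrite dual_convE scale_lfunE.
have la : linear (fun y : G => h (y * a)) by lin.
transitivity (h (tlift (fun b c => h c *: b) (comul x) * a)).
  rewrite (tlift_lin _ _ la); apply: eq_tlift => b c.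
  by rewrite -scalerAl linearZ /= fourierE; apply: mulrC.
by rewrite haarr // -scalerAl mul1r linearZ /=; apply: mulrC.
Qed.

Section Action.
Variables (K : compact_quantum_group R) (alpha : G -> tensor G K).
Hypothesis auth : acts_by_automorphisms alpha h.

Let alpha_hom := action_hom (proj1 auth).

Lemma action_linear : linear alpha.
Proof. by have [] := alpha_hom. Qed.

Definition coefficient (rho : dual G) (a : G) : K :=
  tlift (fun b k => rho b *: k) (alpha a).

Lemma coefficient_linl a : linear (coefficient^~ a).
Proof.
apply: lin_tlift_body => b k c x y.
by rewrite add_lfunE scale_lfunE scalerDl scalerA.
Qed.

Lemma coefficient_linr rho : linear (coefficient rho).
Proof. have la := action_linear; rewrite /coefficient; lin. Qed.

(** Multiplicativity of the conjugated action, read back on G through the Fourier transform and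
    contracted with [T]. Naming the preimage [c] of the convolution product keeps the inverse
    transform out of the formula. *)
Lemma dual_action_mul (W : lmodType C) (T : dual G -> K -> W) (a b c : G) :
  bilin T -> fourier h c = dual_conv (fourier h a) (fourier h b) ->
  tlift (fun x k => T (fourier h x) k) (alpha c) =
  tlift (fun x k => tlift (fun y l =>
    T (dual_conv (fourier h x) (fourier h y)) (k * l)) (alpha b)) (alpha a).
Proof.
move=> bT cE; have [T1 T2] := bT; have [_ [_ _ dM _]] := auth.
have := dM (fourier h a) (fourier h b).
rewrite -/(dual_conv _ _) -cE !fourierK => /(congr1 (tlift T)).
have ev d : tlift T (tlift (fun x k => tens (fourier h x) k) (alpha d)) =
    tlift (fun x k => T (fourier h x) k) (alpha d).
  by rewrite tlift_bind //; apply: eq_tlift => x k; rewrite tlift_tensE.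
have cl := dual_conv_linl; have cr := dual_conv_linr.
pose Q phi k := tlift (fun y l => T (dual_conv phi (fourier h y)) (k * l)) (alpha b).
have bQ : bilin Q by rewrite /Q; lin.
rewrite ev => -> /=; rewrite tlift_bind //.
transitivity (tlift Q (tlift (fun x k => tens (fourier h x) k) (alpha a))).
  apply: eq_tlift => phi k; rewrite tlift_bind // tlift_bind //; last first.
    by move=> psi; rewrite -/(dual_conv _ _); lin.
  apply: eq_tlift => y l.
  rewrite tlift_tensE; first by rewrite tlift_tensE.
  by split=> ?; rewrite -/(dual_conv _ _); lin.
rewrite tlift_bind; last by case: bQ.
by apply: eq_tlift => x k; rewrite tlift_tensE.
Qed.

(** Since F(1) = h is an integral, F(a) F(1) = h(a) F(1). Multiplicativity of the dual action on
    this identity, with functionals evaluated at 1, yields the claim; alpha(1) = 1 ⊗ 1 removes the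
    second factor. *)
Lemma action_haar (a : G) : coefficient h a = h a *: 1.
Proof.
have cl := dual_conv_linl; have cr := dual_conv_linr; have la := action_linear.
pose T (phi : dual G) (k : K) := phi 1 *: k.
have bT : bilin T.
  by split=> [k|phi] e x y; rewrite /T ?add_lfunE ?scale_lfunE;
    rewrite ?scalerDl -?scalerA // scalerDr !scalerA mulrC.
have ha : fourier h (h a *: 1) = dual_conv (fourier h a) (fourier h 1).
  by rewrite linearZ /= fourier1 dual_conv_haar.
have := dual_action_mul bT ha.
have lT : linear (fun x => tlift (fun x k => T (fourier h x) k) (alpha x)).
  by have [T1 T2] := bT; lin.
rewrite (linZ lT) (hom_tlift1 alpha_hom); last first.
  by have [T1 T2] := bT; lin.
rewrite {1}/T fourier1 haar1 // scale1r => ->.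
apply: eq_tlift => x k; rewrite (hom_tlift1 alpha_hom); last first.
  by have [T1 T2] := bT; lin.
by rewrite fourier1 dual_conv_haar /T scale_lfunE haar1 // mulr1 [_ *: 1%R]mulr1.
Qed.

(** Invariance of h at the product x a, expanded by multiplicativity of alpha. It is an
    orthogonality relation: multiplying by the C(K)-leg of alpha(a) turns coefficients into
    scalars. *)
Lemma action_orth (x a : G) :
  tlift (fun y k => coefficient (fourier h y) x * k) (alpha a) = h (x * a) *: 1.
Proof.
have la := action_linear.
rewrite -action_haar /coefficient (hom_tliftM _ _ alpha_hom); last by lin.
rewrite /coefficient.
transitivity (tlift (fun y l => tlift (fun z k => h (z * y) *: (k * l))
    (alpha x)) (alpha a)); last by rewrite exchange_tlift.
apply: eq_tlift => y l.
have lm : linear (fun k : K => k * l) by lin.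
rewrite (tlift_lin _ _ lm); apply: eq_tlift => z k.
by rewrite fourierE scalerAl.
Qed.

(** By the span condition of an action, [tens x 1] is a combination of elements alpha(a)(1 ⊗ k), and
    E vanishes on each of them. *)
Lemma action_cancel (W : lmodType C) (E : G -> K -> W) : bilin E ->
  (forall a k, tlift (fun x l => E x (l * k)) (alpha a) = 0) ->
  forall x, E x 1 = 0.
Proof.
move=> bE E0 x; have [E1 E2] := bE.
have : [set: tensor G K] (tens x 1) by [].
rewrite -(action_span (proj1 auth)) => -[n [c [v [vP xE]]]].
have lE : linear (tlift E).
  by apply: (@lin_tlift_arg _ _ _ _ _ E (fun x => x)) => //; apply: lin_id.
rewrite -(tlift_tensE _ _ bE) xE.
rewrite (big_morph (tlift E) (linD lE) (lin0 lE)) big1 // => i _.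
rewrite (linZ lE).
have [a _ [k _ <-]] := vP i; rewrite /= tlift_bind //.
rewrite (_ : tlift _ (alpha a) = 0) ?scaler0 //.
rewrite -[RHS](E0 a k); apply: eq_tlift => y l.
rewrite tlift_bind // tlift_tensE; last by lin.
by rewrite tlift_tensE // mulr1.
Qed.

(** Contracted with alpha(a) and alpha(b), both sides become h(x1 a) h(x2 b) by [action_orth]. In
    the product u(x2) u(x1) k l the factor u(x1) has to stand next to k to be contracted, which
    forces the reversed order. The span condition then removes alpha(a) and alpha(b). *)
Lemma coefficient_conv_op (rho sigma : dual G) (x : G) :
  coefficient (dual_conv rho sigma) x =
  tlift (fun x1 x2 => coefficient sigma x2 * coefficient rho x1) (comul x).
Proof.
have cl := dual_conv_linl; have cr := dual_conv_linr; have la := action_linear.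
have c1 := coefficient_linl; have c2 := coefficient_linr.
have lc := @comul_linear _ G.
have lF : linear (fourier h) by exact: linearP.
pose E (a b : G) := coefficient (dual_conv (fourier h a) (fourier h b)) x -
  tlift (fun x1 x2 => coefficient (fourier h b) x2 *
                      coefficient (fourier h a) x1) (comul x).
have lsub (U V : lmodType C) (f g : U -> V) : linear f -> linear g ->
    linear (fun x => f x - g x).
  by move=> lf lg k u v; rewrite lf lg scalerBr opprD addrACA.
have E1 b : linear (E^~ b) by rewrite /E; refine (lsub _ _ _ _ _ _); lin.
have E2 a : linear (E a) by rewrite /E; refine (lsub _ _ _ _ _ _); lin.
have key a b : tlift (fun y k => tlift (fun z l => E y z * (k * l)) (alpha b))
    (alpha a) = 0.
  pose c := (fourier h)^-1%VF (dual_conv (fourier h a) (fourier h b)).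
  have cE : fourier h c = dual_conv (fourier h a) (fourier h b) by rewrite fourierVK.
  pose T phi k := coefficient phi x * k.
  have bT : bilin T by rewrite /T; lin.
  (* The convolution side: [action_orth] at [c], whose transform is the product of F(a) and F(b). *)
  have := dual_action_mul bT cE; rewrite {1}/T action_orth -fourierE cE => e.
  transitivity (tlift (fun y k => tlift (fun z l =>
      T (dual_conv (fourier h y) (fourier h z)) (k * l)) (alpha b)) (alpha a) -
    tlift (fun y k => tlift (fun z l => tlift (fun x1 x2 =>
      coefficient (fourier h z) x2 * coefficient (fourier h y) x1 * (k * l))
      (comul x)) (alpha b)) (alpha a)).
    rewrite /tlift -sumrB; apply: eq_bigr => i _; rewrite -sumrB.
    apply: eq_bigr => j _; rewrite /E mulrBl; congr (_ - _).
    by rewrite /tlift mulr_suml.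
  rewrite -e; apply/eqP; rewrite subr_eq0; apply/eqP.
  transitivity (tlift (fun z l => tlift (fun x1 x2 => tlift (fun y k =>
    coefficient (fourier h z) x2 * coefficient (fourier h y) x1 * (k * l))
      (alpha a)) (comul x)) (alpha b)); last first.
    rewrite [RHS]exchange_tlift; apply: eq_tlift => z l.
    exact: exchange_tlift.
  transitivity (tlift (fun z l => tlift (fun x1 x2 =>
    h (x1 * a) *: (coefficient (fourier h z) x2 * l)) (comul x)) (alpha b)).
    rewrite exchange_tlift dual_convE.
    have l1 : linear (fun c : C^o => c *: (1 : K)) by lin.
    rewrite [LHS](tlift_lin _ _ l1); apply: eq_tlift => x1 x2.
    have l2 : linear (fun u : K => h (x1 * a) *: u) by lin.
    by rewrite -(tlift_lin _ _ l2) action_orth !fourierE scalerA.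
  apply: eq_tlift => z l; apply: eq_tlift => x1 x2.
  have l3 : linear (fun u : K => coefficient (fourier h z) x2 * u * l) by lin.
  transitivity (coefficient (fourier h z) x2 * (h (x1 * a) *: 1) * l).
    by rewrite -scalerAr mulr1 scalerAl.
  rewrite -action_orth (tlift_lin _ _ l3); apply: eq_tlift => y k.
  by rewrite !mulrA.
have E0 a b : E a b = 0.
  rewrite -[LHS]mulr1.
  (* Cancellation acts on one variable at a time and needs a spare factor of C(K) on the right. *)
  pose E' (y : G) (u : K) := E y b * u.
  apply: (@action_cancel _ E') => [|a' u]; first by rewrite /E'; lin.
  pose E'' (z : G) (w : K) := tlift (fun y k => E y z * (k * w)) (alpha a').
  transitivity (E'' b 1 * u).
    rewrite /E'' /E'; rewrite /tlift mulr_suml; apply: eq_bigr => i _.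
    by rewrite mulr1 mulrA.
  rewrite (@action_cancel _ E'') ?mul0r// => [|b' w]; first by rewrite /E''; lin.
  transitivity (0 * w : K); last by rewrite mul0r.
  rewrite -(key a' b') exchange_tlift /E''.
  rewrite {1 3}/tlift mulr_suml; apply: eq_bigr => i _.
  rewrite /tlift mulr_suml; apply: eq_bigr => j _.
  by rewrite !mulrA.
have := E0 ((fourier h)^-1%VF rho) ((fourier h)^-1%VF sigma).
by rewrite /E !fourierVK => /eqP; rewrite subr_eq0 => /eqP.
Qed.

(** Unlike the involution of the dual, this conjugation involves no antipode, and it preserves the
    order of convolution products. *)
Definition dual_conj (rho : dual G) : dual G :=
  linfun (fun a : G => ((rho (star a) : C)^* : C^o)).

Lemma dual_conjE rho a : dual_conj rho a = (rho (star a) : C)^*.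
Proof.
rewrite /dual_conj linfunE // => k x y.
by rewrite star_semilinear linearP rmorphD rmorphM /= conjCK.
Qed.

Lemma dual_conj_conv rho sigma :
  dual_conj (dual_conv rho sigma) = dual_conv (dual_conj rho) (dual_conj sigma).
Proof.
apply/lfunP => a; rewrite dual_conjE !dual_convE.
have lc := @comul_linear _ G.
rewrite (hom_tlift_star _ (@comul_hom R G)); last by lin.
rewrite /tlift rmorph_sum; apply: eq_bigr => i _.
by rewrite !dual_conjE; apply: rmorphM.
Qed.

Lemma coefficient_star rho a :
  coefficient rho (star a) = star (coefficient (dual_conj rho) a).
Proof.
rewrite /coefficient (hom_tlift_star _ alpha_hom); last by lin.
rewrite /tlift star_sum; apply: eq_bigr => i _.
by rewrite starZ dual_conjE conjCK.
Qed.

(** Adjoint of [coefficient_conv_op] at [star x]: conjugating functionals keeps the order of rho and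
    sigma, while the star of C(K) reverses the product of coefficients. *)
Lemma coefficient_conv (rho sigma : dual G) (x : G) :
  coefficient (dual_conv rho sigma) x =
  tlift (fun x1 x2 => coefficient rho x1 * coefficient sigma x2) (comul x).
Proof.
have c2 := coefficient_linr.
rewrite -[x](@starK R); move: (star x) => y.
rewrite coefficient_star dual_conj_conv coefficient_conv_op.
rewrite (hom_tlift_star _ (@comul_hom R G)); last by lin.
rewrite /tlift star_sum; apply: eq_bigr => i _.
by rewrite starM !coefficient_star.
Qed.

Definition dual_coord i : dual G :=
  linfun (fun a : G => coord (vbasis {:G}) i a : C^o).

Lemma dual_coordE i a : dual_coord i a = coord (vbasis {:G}) i a.
Proof. by rewrite linfunE // => k x y; rewrite linearP. Qed.

Lemma dual_coordK (a : G) : a = \sum_i dual_coord i a *: (vbasis {:G})`_i.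
Proof.
by rewrite [LHS](coord_vbasis (memvf a)); apply: eq_bigr => i _; rewrite dual_coordE.
Qed.

(** Compatibility of alpha with the coproduct. Expanding [T] over pairs of basis vectors reduces it
    to [coefficient_conv] for coordinate functionals. *)
Lemma action_comul (W : lmodType C) (T : G -> G -> K -> W) (a : G) : trilin T ->
  tlift (fun x k => tlift (fun x1 x2 => T x1 x2 k) (comul x)) (alpha a) =
  tlift (fun a1 a2 => tlift (fun x1 k1 => tlift (fun x2 k2 =>
    T x1 x2 (k1 * k2)) (alpha a2)) (alpha a1)) (comul a).
Proof.
move=> [T1 T2 T3].
pose e := vbasis {:G}.
have TE x1 x2 k : T x1 x2 k = \sum_(i < \dim {:G}) \sum_(j < \dim {:G}) T e`_i e`_j
    ((dual_coord i x1 * dual_coord j x2) *: k).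
  rewrite {1}[x1]dual_coordK (big_morph (fun x => T x x2 k)
    (linD (T1 x2 k)) (lin0 (T1 x2 k))).
  apply: eq_bigr => i _; rewrite (linZ (T1 x2 k)).
  rewrite {1}[x2]dual_coordK (big_morph (fun x => T _ x k)
    (linD (T2 _ k)) (lin0 (T2 _ k))) scaler_sumr.
  by apply: eq_bigr => j _; rewrite (linZ (T2 _ k)) (linZ (T3 _ _)) scalerA.
transitivity (\sum_(i < \dim {:G}) \sum_(j < \dim {:G}) T e`_i e`_j
    (coefficient (dual_conv (dual_coord i) (dual_coord j)) a)).
  transitivity (\sum_(i < \dim {:G}) \sum_(j < \dim {:G}) tlift (fun x k => T e`_i e`_j
    (dual_conv (dual_coord i) (dual_coord j) x *: k)) (alpha a)).
    rewrite [LHS](_ : _ = tlift (fun x k => \sum_(i < \dim {:G}) \sum_(j < \dim {:G}) T e`_i e`_j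
       (dual_conv (dual_coord i) (dual_coord j) x *: k)) (alpha a)).
      rewrite /tlift exchange_big; apply: eq_bigr => i _.
      by rewrite exchange_big.
    apply: eq_tlift => x k; under eq_tlift => x1 x2 do rewrite TE.
    rewrite /tlift exchange_big; apply: eq_bigr => i _.
    rewrite exchange_big; apply: eq_bigr => j _.
    rewrite dual_convE /tlift scaler_suml.
    by rewrite (big_morph (T _ _) (linD (T3 _ _)) (lin0 (T3 _ _))).
  apply: eq_bigr => i _; apply: eq_bigr => j _.
  by rewrite /coefficient (tlift_lin _ _ (T3 _ _)).
under eq_bigr => i _ do under eq_bigr => j _ do
  rewrite coefficient_conv (tlift_lin _ _ (T3 _ _)).
rewrite (eq_bigr (fun i : 'I_(\dim {:G}) => tlift (fun x1 x2 => \sum_(j < \dim {:G}) T e`_i e`_j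
    (coefficient (dual_coord i) x1 * coefficient (dual_coord j) x2)) (comul a)));
  last by move=> i _; rewrite /tlift exchange_big.
rewrite /tlift exchange_big /= -/(tlift _ _).
apply: eq_bigr => m _; set a1 := (vbasis _)`_m; set a2 := comul a m.
rewrite -/(tlift _ (alpha a1)).
transitivity (\sum_(i < \dim {:G}) tlift (fun x1 k1 => tlift (fun x2 k2 => \sum_(j < \dim {:G}) T e`_i e`_j
    ((dual_coord i x1 * dual_coord j x2) *: (k1 * k2))) (alpha a2)) (alpha a1)).
  apply: eq_bigr => i _.
  transitivity (\sum_(j < \dim {:G}) tlift (fun x1 k1 => tlift (fun x2 k2 => T e`_i e`_j
    ((dual_coord i x1 * dual_coord j x2) *: (k1 * k2))) (alpha a2)) (alpha a1)).
    apply: eq_bigr => j _; rewrite /coefficient.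
    have l1 : linear (fun u => T e`_i e`_j
      (u * tlift (fun b k => dual_coord j b *: k) (alpha a2))) by lin.
    rewrite (tlift_lin _ _ l1); apply: eq_tlift => x1 k1.
    have l2 : linear (fun u => T e`_i e`_j ((dual_coord i x1 *: k1) * u)) by lin.
    rewrite (tlift_lin _ _ l2); apply: eq_tlift => x2 k2.
    by rewrite -scalerAl -scalerAr scalerA.
  rewrite /tlift exchange_big; apply: eq_bigr => p _.
  by rewrite exchange_big.
rewrite /tlift exchange_big; apply: eq_bigr => p _.
rewrite exchange_big; apply: eq_bigr => q _ /=.
by rewrite [RHS]TE.
Qed.

Local Notation "\D_ ( b , c <- a ) E" := (tlift (fun b c => E) (comul a))
  (at level 36, b name, c name, a at level 35, E at level 36).
Local Notation "\A_ ( x , k <- a ) E" := (tlift (fun x k => E) (alpha a))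
  (at level 36, x name, k name, a at level 35, E at level 36).

Lemma comul_absorbl (W : lmodType C) (Q : G -> G -> W) (a : G) : bilin Q ->
  \D_(a1, a2 <- a) \D_(b, c <- a2) Q (antipode G a1 * b) c = Q 1 a.
Proof.
move=> [Q1 Q2]; have lc := @comul_linear _ G.
rewrite -(@comul_coassoc _ _ W (fun a1 b c => Q (antipode G a1 * b) c));
  last by split; lin.
rewrite -[RHS](comul_counitl a (Q2 1)); apply: eq_tlift => b c.
by rewrite (comul_antipodel b (Q1 c)) (linZ (Q2 1)).
Qed.

Lemma comul_absorbr (W : lmodType C) (Q : G -> G -> W) (b : G) : bilin Q ->
  \D_(b1, b2 <- b) \D_(c, d <- b1) Q c (d * antipode G b2) = Q b 1.
Proof.
move=> [Q1 Q2]; have lc := @comul_linear _ G.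
rewrite (@comul_coassoc _ _ W (fun c d b2 => Q c (d * antipode G b2)));
  last by split; lin.
rewrite -[RHS](comul_counitr b (Q1 1)); apply: eq_tlift => c d.
by rewrite (comul_antipoder d (Q2 c)) (linZ (Q1 1)).
Qed.

(** The image of [comul_absorbl] under alpha: compatibility with the coproduct replaces the legs of
    comul(x) by two copies of alpha, and then alpha(S(a1)) alpha(a2) = alpha(S(a1) a2) collapses. *)
Lemma action_absorbl (W : lmodType C) (F : G -> G -> K -> W) (a : G) : trilin F ->
  \D_(a1, a2 <- a) \A_(x, k <- a2) \D_(x1, x2 <- x) \A_(c, l <- antipode G a1)
    F (c * x1) x2 (l * k) =
  \A_(x, k <- a) F 1 x k.
Proof.
move=> [F1 F2 F3]; have lc := @comul_linear _ G; have la := action_linear.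
transitivity (\D_(a1, a2 <- a) \D_(b, c <- a2) \A_(x, k <- antipode G a1 * b)
    \A_(y, l <- c) F x y (k * l)).
  apply: eq_tlift => a1 a2.
  rewrite (@action_comul _ (fun x1 x2 k => \A_(c, l <- antipode G a1)
    F (c * x1) x2 (l * k))); last by split; lin.
  apply: eq_tlift => b c; rewrite (hom_tliftM _ _ alpha_hom); last by lin.
  rewrite [RHS]exchange_tlift; apply: eq_tlift => x k.
  rewrite [RHS]exchange_tlift; apply: eq_tlift => y l.
  by apply: eq_tlift => z m; rewrite mulrA.
pose Q (u c : G) : W := \A_(x, k <- u) \A_(y, l <- c) F x y (k * l).
rewrite (@comul_absorbl _ Q); last by rewrite /Q; lin.
rewrite /Q (hom_tlift1 alpha_hom); last by lin.
by apply: eq_tlift => y l; rewrite mul1r.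
Qed.

Lemma action_absorbr (W : lmodType C) (F : G -> G -> K -> W) (b : G) : trilin F ->
  \D_(b1, b2 <- b) \A_(y, k <- b1) \D_(y1, y2 <- y) \A_(d, l <- antipode G b2)
    F y1 (y2 * d) (k * l) =
  \A_(y, k <- b) F y 1 k.
Proof.
move=> [F1 F2 F3]; have lc := @comul_linear _ G; have la := action_linear.
transitivity (\D_(b1, b2 <- b) \D_(c, d <- b1) \A_(x, k <- c)
    \A_(y, l <- d * antipode G b2) F x y (k * l)).
  apply: eq_tlift => b1 b2.
  rewrite (@action_comul _ (fun y1 y2 k => \A_(d, l <- antipode G b2)
    F y1 (y2 * d) (k * l))); last by split; lin.
  apply: eq_tlift => c d; apply: eq_tlift => x k.
  rewrite (hom_tliftM _ _ alpha_hom); last by lin.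
  by apply: eq_tlift => y l; apply: eq_tlift => z m; rewrite mulrA.
pose Q (c u : G) : W := \A_(x, k <- c) \A_(y, l <- u) F x y (k * l).
rewrite (@comul_absorbr _ Q); last by rewrite /Q; lin.
rewrite /Q; apply: eq_tlift => x k; rewrite (hom_tlift1 alpha_hom); last by lin.
by rewrite mulr1.
Qed.

(** Two computations of the coproduct on the first leg of alpha(a b): through the coproduct of a b,
    and through the product alpha(a) alpha(b). *)
Lemma action_comulM (W : lmodType C) (T : G -> G -> K -> W) (a b : G) : trilin T ->
  \D_(a1, a2 <- a) \D_(b1, b2 <- b) \A_(x, k <- a1 * b1) \A_(y, l <- a2 * b2)
    T x y (k * l) =
  \A_(x, k <- a) \A_(y, l <- b) \D_(x1, x2 <- x) \D_(y1, y2 <- y)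
    T (x1 * y1) (x2 * y2) (k * l).
Proof.
move=> tT; have [T1 T2 T3] := tT.
have lc := @comul_linear _ G; have la := action_linear.
have := action_comul (a * b) tT.
rewrite (hom_tliftM _ _ alpha_hom); last by lin.
rewrite (hom_tliftM _ _ (@comul_hom R G)); last by lin.
move=> <-; apply: eq_tlift => x k; apply: eq_tlift => y l.
by rewrite (hom_tliftM _ _ (@comul_hom R G)) //; lin.
Qed.

(* [b (x) a = S(a1) (a2 b1) (x) (a3 b2) S(b3)], and the right-hand side only
   involves the product and the coproduct, both of which alpha preserves. *)
Lemma action_flip (W : lmodType C) (E : G -> G -> K -> W) (a b : G) : trilin E ->
  \A_(y, l <- b) \A_(x, k <- a) E y x (l * k) =
  \A_(x, k <- a) \A_(y, l <- b) E y x (k * l).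
Proof.
move=> tE; have [E1 E2 E3] := tE.
have lc := @comul_linear _ G; have la := action_linear.
(* [T] supplies the outer factors alpha(S(a1)), on the left, and alpha(S(b2)), on the right. *)
pose T a1 b2 (u v : G) (w : K) : W := \A_(c, k <- antipode G a1)
  \A_(d, l <- antipode G b2) E (c * u) (v * d) (k * w * l).
have tT a1 b2 : trilin (T a1 b2) by rewrite /T; split; lin.
transitivity (\D_(a1, a2 <- a) \D_(b1, b2 <- b) \D_(a21, a22 <- a2)
  \D_(b11, b12 <- b1) \A_(x, k <- a21 * b11) \A_(y, l <- a22 * b12)
  T a1 b2 x y (k * l)).
  pose Q (u v : G) : W := \A_(y, l <- u) \A_(x, k <- v) E y x (l * k).
  have lQ1 v : linear (Q^~ v) by rewrite /Q; lin.
  have lQ2 u : linear (Q u) by rewrite /Q; lin.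
  transitivity (\D_(a1, a2 <- a) \D_(b1, b2 <- b) \D_(a21, a22 <- a2)
    \D_(b11, b12 <- b1) Q (antipode G a1 * (a21 * b11))
                          (a22 * b12 * antipode G b2)).
    rewrite -/(Q b a) -[a in LHS]mulr1.
    rewrite -(@comul_absorbr _ (fun u v => Q u (a * v))); last by lin.
    transitivity (\D_(b1, b2 <- b) \D_(b11, b12 <- b1) \D_(a1, a2 <- a)
      \D_(a21, a22 <- a2) Q (antipode G a1 * a21 * b11)
                            (a22 * (b12 * antipode G b2))).
      apply: eq_tlift => b1 b2; apply: eq_tlift => b11 b12.
      rewrite (@comul_absorbl _ (fun u v => Q (u * b11) (v * (b12 * antipode G b2))));
        last by lin.
      by rewrite mul1r.
    rewrite [RHS]exchange_tlift; apply: eq_tlift => b1 b2.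
    transitivity (\D_(a1, a2 <- a) \D_(b11, b12 <- b1)
      \D_(a21, a22 <- a2) Q (antipode G a1 * a21 * b11)
                            (a22 * (b12 * antipode G b2))).
      exact: exchange_tlift.
    apply: eq_tlift => a1 a2; rewrite [RHS]exchange_tlift.
    apply: eq_tlift => b11 b12; apply: eq_tlift => a21 a22.
    by rewrite !mulrA.
  apply: eq_tlift => a1 a2; apply: eq_tlift => b1 b2.
  apply: eq_tlift => a21 a22; apply: eq_tlift => b11 b12.
  move: (a21 * b11) (a22 * b12) => u v.
  rewrite /Q (hom_tliftM _ _ alpha_hom); last by lin.
  transitivity (\A_(x, k <- u) \A_(y, l <- v) \A_(d, n <- antipode G b2)
    \A_(c, m <- antipode G a1) E (c * x) (y * d) (m * (k * l) * n)).
    rewrite [LHS]exchange_tlift; apply: eq_tlift => x k.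
    rewrite [RHS](_ : _ = \A_(z, w <- v * antipode G b2) \A_(c, m <- antipode G a1)
      E (c * x) z (m * k * w)); first exact: exchange_tlift.
    rewrite (hom_tliftM _ _ alpha_hom); last by lin.
    apply: eq_tlift => y l; apply: eq_tlift => d n; apply: eq_tlift => c m.
    by rewrite !mulrA.
  apply: eq_tlift => x k; apply: eq_tlift => y l.
  by rewrite /T exchange_tlift.
(* The order changes here: coefficients of a, b, a, b become one coefficient of a followed by one of
   b. It remains to absorb S(a1) into the first and S(b2) into the second. *)
transitivity (\D_(a1, a2 <- a) \D_(b1, b2 <- b) \A_(x, k <- a2)
  \A_(y, l <- b1) \D_(x1, x2 <- x) \D_(y1, y2 <- y)
    T a1 b2 (x1 * y1) (x2 * y2) (k * l)).
  apply: eq_tlift => a1 a2; apply: eq_tlift => b1 b2.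
  by rewrite action_comulM.
pose Z (u v : G) (w : K) := \D_(b1, b2 <- b) \A_(y, l <- b1)
  \D_(y1, y2 <- y) \A_(d, n <- antipode G b2) E (u * y1) (v * y2 * d) (w * l * n).
transitivity (\D_(a1, a2 <- a) \A_(x, k <- a2) \D_(x1, x2 <- x)
    \A_(c, l <- antipode G a1) Z (c * x1) x2 (l * k)).
  apply: eq_tlift => a1 a2; rewrite [LHS]exchange_tlift; apply: eq_tlift => x k.
  transitivity (\D_(x1, x2 <- x) \D_(b1, b2 <- b) \A_(y, l <- b1)
    \D_(y1, y2 <- y) T a1 b2 (x1 * y1) (x2 * y2) (k * l)).
    rewrite [RHS]exchange_tlift; apply: eq_tlift => b1 b2.
    exact: exchange_tlift.
  apply: eq_tlift => x1 x2; rewrite /Z [RHS]exchange_tlift.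
  apply: eq_tlift => b1 b2; rewrite [RHS]exchange_tlift.
  apply: eq_tlift => y l; rewrite [RHS]exchange_tlift.
  apply: eq_tlift => y1 y2; apply: eq_tlift => c m; apply: eq_tlift => d n.
  by rewrite !mulrA.
rewrite (@action_absorbl _ Z); last by rewrite /Z; split; lin.
apply: eq_tlift => x k; rewrite /Z.
transitivity (\D_(b1, b2 <- b) \A_(y, l <- b1) \D_(y1, y2 <- y)
    \A_(d, n <- antipode G b2) E (1 * y1) (x * (y2 * d)) (k * (l * n))).
  apply: eq_tlift => b1 b2; apply: eq_tlift => y l.
  by apply: eq_tlift => y1 y2; apply: eq_tlift => d n; rewrite !mulrA.
rewrite (@action_absorbr _ (fun u v w => E (1 * u) (x * v) (k * w)));
  last by split; lin.
by apply: eq_tlift => y l; rewrite mul1r mulr1.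
Qed.

Lemma coefficient_comm rho sigma (a b : G) :
  coefficient rho a * coefficient sigma b = coefficient sigma b * coefficient rho a.
Proof.
pose E (y x : G) (k : K) := (rho x * sigma y) *: k.
have tE : trilin E.
  by rewrite /E; split=> *; lin.
have := action_flip a b tE.
rewrite /E => e.
have lc (c : K) : linear (fun k : K => c * k) by lin.
have rc (c : K) : linear (fun k : K => k * c) by lin.
transitivity (\A_(x, k <- a) \A_(y, l <- b) ((rho x * sigma y) *: (k * l))).
  rewrite /coefficient (tlift_lin _ _ (rc _)); apply: eq_tlift => x k.
  rewrite (tlift_lin _ _ (lc _)); apply: eq_tlift => y l.
  by rewrite -scalerAl -scalerAr scalerA.
rewrite -e /coefficient (tlift_lin _ _ (rc _)); apply: eq_tlift => y l.
rewrite (tlift_lin _ _ (lc _)); apply: eq_tlift => x k.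
by rewrite -scalerAl -scalerAr scalerA mulrC.
Qed.

End Action.
End Fourier.

(** * From commuting generators to a commutative algebra *)

Section Commutant.
Variables (R : realType) (K : cstarAlgType R).

(** Closedness: for y in the commutant, the commutator of x and s equals that of x - y and s, whose
    norm is at most twice cnorm (x - y) times cnorm s. *)
Lemma commutant_cstar_subalg (S : set K) :
  (forall s, S s -> S (star s)) ->
  is_cstar_subalg [set x : K | forall s, S s -> x * s = s * x].
Proof.
move=> Sstar; split=> /=.
- apply: closed_cnorm => x clx s Ss /=.
  apply/eqP; rewrite -subr_eq0; apply/eqP/cnorm_le0.
  rewrite leNgt; apply/negP => x0.
  pose M := cnorm s + 1; have M0 : 0 < M.
    by rewrite ltr_wpDl ?ltr01 ?cnorm_ge0.
  have [|y yP xy] := clx (cnorm (x * s - s * x) / (M + M)).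
    by rewrite divr_gt0 // addr_gt0.
  move: xy; rewrite ltr_pdivlMr; last by rewrite addr_gt0.
  rewrite ltNge => /negP; apply.
  have -> : x * s - s * x = (x - y) * s - s * (x - y).
    by rewrite mulrBl mulrBr yP // opprB addrA addrNK.
  apply: le_trans (cnormD _ _) _; rewrite cnormN [leRHS]mulrDr.
  by apply: lerD; apply: le_trans (cnormM _ _) _; rewrite ?[cnorm s * _]mulrC;
     rewrite ler_wpM2l ?cnorm_ge0// lerDl.
- by move=> s _; rewrite mul0r mulr0.
- move=> c x y xP yP s Ss.
  by rewrite mulrDl mulrDr yP // -scalerAl xP // scalerAr.
- by move=> x y xP yP s Ss; rewrite -mulrA yP // !mulrA xP.
- move=> x xP s Ss; apply: (can_inj (@starK R K)).
  by rewrite !starM !starK xP //; apply: Sstar.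
Qed.

(** Two passes through commutants: the generators commute with each other, so everything commutes
    with them; hence they lie in the centre, which is again a C*-subalgebra. *)
Lemma comm_of_generators (S : set K) :
  (forall s, S s -> S (star s)) -> (forall s t, S s -> S t -> s * t = t * s) ->
  smallest (@is_cstar_subalg R K) S = setT ->
  forall x y : K, x * y = y * x.
Proof.
move=> Sstar Scomm gen.
have all (P : set K) : is_cstar_subalg P -> S `<=` P -> forall x, P x.
  by move=> Pa SP x; have : setT x by []; rewrite -gen => /(_ P); apply.
have c1 x s : S s -> x * s = s * x.
  move: s; move: x; apply: all; first exact: commutant_cstar_subalg.
  by move=> s Ss t St; apply: Scomm.
move=> x y; move: y; move: x; apply: all.
  have := @commutant_cstar_subalg setT (fun _ _ => I).
  by congr is_cstar_subalg; apply/seteqP; split=> z /=; auto.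
by move=> s Ss y; apply/esym/c1.
Qed.

End Commutant.

Lemma faithful_action_comm (R : realType) (G : finite_quantum_group R)
    (h : dual G) (K : compact_quantum_group R) (alpha : G -> tensor G K) :
  is_haar h -> acts_by_automorphisms alpha h -> is_faithful alpha ->
  forall x y : K, x * y = y * x.
Proof.
move=> haar_h auth faith; apply: comm_of_generators faith.
- move=> _ [rho _ [a _ <-]]; exists (dual_conj rho) => //; exists (star a) => //.
  rewrite -[RHS]/(star (coefficient alpha rho a)).
  rewrite -[rho in RHS](_ : dual_conj (dual_conj rho) = rho); last first.
    by apply/lfunP => b; rewrite !dual_conjE starK conjCK.
  by rewrite -(coefficient_star auth).
- move=> _ _ [rho _ [a _ <-]] [sigma _ [b _ <-]].
  exact: (coefficient_comm haar_h auth).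
Qed.

(** * Characters of commutative C*-algebras *)

Section FixedPoint.
Variables (R : realType) (A : cstarAlgType R).

Lemma contraction_fixpoint (D : set A) (f : A -> A) (q : R) (x0 : A) :
  closed (D : set (normed_space A)) -> 0 <= q -> q < 1 -> D x0 ->
  (forall x, D x -> D (f x)) ->
  (forall x y, D x -> D y -> cnorm (f x - f y) <= q * cnorm (x - y)) ->
  exists2 l, D l & f l = l.
Proof.
move=> cD q0 q1 Dx0 fD fq; pose u n := iter n f x0.
have Du n : D (u n) by elim: n => //= n; apply: fD.
have uS n : u n.+1 = f (u n) by [].
have q1' : 0 < 1 - q by rewrite subr_gt0.
(* The length of the geometric series of steps: no iterate is farther than [c] from [x0]. *)
pose c := cnorm (x0 - u 1%N) / (1 - q).
have c0 : 0 <= c by rewrite divr_ge0 ?cnorm_ge0 // ltW.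
have dist0 k : cnorm (x0 - u k) <= c.
  elim: k => [|k IH]; first by rewrite subrr cnorm0.
  apply: le_trans (cnorm_distD _ (u 1%N) _) _; rewrite [u k.+1]uS.
  apply: le_trans (lerD (lexx _) (fq x0 (u k) Dx0 (Du k))) _.
  apply: le_trans (lerD (lexx _) (ler_wpM2l q0 IH)) _.
  have -> : cnorm (x0 - u 1%N) = c * (1 - q).
    by rewrite /c divfK // gt_eqF.
  by rewrite mulrBr mulr1 mulrC subrK.
have distn n k : cnorm (u n - u (n + k)%N) <= q ^+ n * c.
  elim: n => [|n IH]; first by rewrite mul1r.
  rewrite addSn !uS; apply: le_trans (fq _ _ (Du _) (Du _)) _.
  by rewrite exprS -mulrA ler_wpM2l.
have small e : 0 < e -> exists N, forall n, (N <= n)%N -> q ^+ n * c < e.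
  move=> e0; have c1 : 0 < c + 1 by rewrite ltr_wpDl.
  have q1n : `|q| < 1 by rewrite ger0_norm.
  have := @cvg_expr R q q1n => /cvgrPdist_lt/(_ (e / (c + 1))).
  case=> [|N _ NP]; first by rewrite divr_gt0.
  exists N => n /NP; rewrite /= sub0r normrN ger0_norm ?exprn_ge0//.
  rewrite ltr_pdivlMr // => h; apply: le_lt_trans h.
  by rewrite ler_wpM2l ?exprn_ge0 // lerDl.
have cau e : 0 < e -> exists N, forall m n, (N <= m)%N -> (N <= n)%N ->
    cnorm (u m - u n) < e.
  move=> /small[N NP]; exists N => m n Nm Nn.
  wlog mn : m n Nm Nn / (m <= n)%N => [hw|].
    have [|/ltnW] := leqP m n; first exact: hw.
    by rewrite cnormB; apply: hw.
  by rewrite -(subnKC mn); apply: le_lt_trans (distn _ _) (NP _ Nm).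
have [l lu] := cnorm_cauchy_cvg cau.
have Dl : D l.
  apply: cD; apply/cnorm_closureP => e /lu[N NP].
  by exists (u N) => //; apply: NP.
exists l => //; apply/eqP; rewrite -subr_eq0; apply/eqP/cnorm_le0.
apply/ler_addgt0Pr => e e0; rewrite add0r.
have [N NP] := lu (e / 2) (divr_gt0 e0 (ltr0Sn _ _)).
apply: le_trans (cnorm_distD _ (u N.+1) _) _.
rewrite [e]splitr; apply: lerD; last by rewrite cnormB ltW // NP.
rewrite uS; apply: le_trans (fq _ _ Dl (Du N)) _.
rewrite -[leRHS]mul1r; apply: ler_pM => //; rewrite ?cnorm_ge0 // ltW //.
exact: NP.
Qed.

End FixedPoint.

(** * Square roots and inverses by fixed points *)

Section Spectral.
Variables (R : realType) (A : cstarAlgType R).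
Implicit Types (x y a b : A) (S : set A).

Lemma cnormZr (r : R) x : cnorm (r%:C *: x) = `|r| * cnorm x.
Proof.
apply: complexI; rewrite cnormZ rmorphM /=; congr (_ * _).
by rewrite normc_def /= expr0n addr0 sqrtr_sqr.
Qed.

Lemma starZr (r : R) x : star (r%:C *: x) = r%:C *: star x.
Proof. by rewrite starZ; congr (_ *: _); apply: conjc_real. Qed.

Definition is_sa x := star x = x.

Lemma sa_closed : closed (is_sa : set (normed_space A)).
Proof.
apply: closed_cnorm => x xS; apply/eqP; rewrite -subr_eq0; apply/eqP/cnorm_le0.
apply/ler_addgt0Pr => e e0; rewrite add0r.
have [y ys xy] := xS (e / 2) (divr_gt0 e0 (ltr0Sn _ _)).
apply: le_trans (cnorm_distD _ y _) _.
rewrite [e]splitr; apply: lerD; last by rewrite cnormB ltW.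
by rewrite -[X in _ - X]ys -starN -starD cnorm_star ltW.
Qed.

Lemma ball_closed (q : R) : closed ([set x : A | cnorm x <= q] : set (normed_space A)).
Proof.
apply: closed_cnorm => x xS /=; apply/ler_addgt0Pr => e e0.
have [y ys xy] := xS e e0.
have -> : x = y + (x - y) by rewrite addrC subrK.
by apply: le_trans (cnormD _ _) _; apply: lerD => //; apply: ltW.
Qed.

Lemma cstar_subalgT : is_cstar_subalg [set: A].
Proof. by split=> //; apply: closedT. Qed.

(* [w] is the fixed point of [w |-> (a + w^2) / 2] in the ball of radius
   [cnorm a]. *)
Lemma cstar_sqrt S a : is_cstar_subalg S -> S a -> is_sa a -> cnorm a < 1 ->
  exists2 w, [/\ S w, is_sa w & cnorm w < 1] & (1 - w) * (1 - w) = 1 - a.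
Proof.
move=> [cS S0 SL SM Sst] Sa sa a1; pose q := cnorm a.
have q0 : 0 <= q by exact: cnorm_ge0.
pose D := S `&` (is_sa `&` [set x | cnorm x <= q]).
pose f w := (2^-1 : R)%:C *: (a + w * w).
have half : `|2^-1 : R| = 2^-1 by rewrite ger0_norm // invr_ge0.
have [||w ww|w v [_ [_ wq]] [_ [_ vq]]|w [Sw [sw wq]] fw] :=
    @contraction_fixpoint R A D f q 0 _ q0 a1.
- by apply: closedI => //; apply: closedI; [exact: sa_closed|exact: ball_closed].
- by split=> //; split; [exact: star0|rewrite /= cnorm0].
- have [Sw [sw wq]] := ww; split.
    have -> : f w = (2^-1 : R)%:C *: (a + w * w) + 0 by rewrite addr0.
    apply: (SL) => //; rewrite -[a]scale1r; apply: (SL) => //; exact: SM.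
  split; first by rewrite /is_sa /f starZr starD starM sa sw.
  rewrite /= /f cnormZr half ler_pdivrMl //.
  apply: le_trans (cnormD _ _) _; rewrite mulr_natl mulr2n lerD2l.
  apply: le_trans (cnormM _ _) _; rewrite -[leRHS]mul1r.
  by apply: ler_pM; rewrite ?cnorm_ge0 //; apply: le_trans wq (ltW a1).
- rewrite /f -scalerBr cnormZr half ler_pdivrMl //.
  have -> : a + w * w - (a + v * v) = w * (w - v) + (w - v) * v.
    by rewrite mulrBr mulrBl opprD addrACA subrr add0r addrA subrK.
  apply: le_trans (cnormD _ _) _.
  rewrite mulr_natl mulr2n; apply: lerD.
    by apply: le_trans (cnormM _ _) _; rewrite ler_wpM2r ?cnorm_ge0.
  apply: le_trans (cnormM _ _) _.
  by rewrite [leRHS]mulrC ler_wpM2l ?cnorm_ge0.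
exists w; first by split=> //; apply: le_lt_trans wq a1.
have {}fw : a + w * w = w + w.
  rewrite -[in RHS]fw /f -scalerDl -rmorphD /= -[2^-1]mul1r -splitr.
  by rewrite rmorph1 scale1r.
transitivity (1 - (w + w) + w * w).
  by rewrite mulrBl !mulrBr !mul1r mulr1 opprB opprD [w * w - w]addrC !addrA.
by rewrite -fw opprD addrA addrNK.
Qed.

(** The Neumann series, summed as the fixed point of [b |-> 1 + b * a]. *)
Lemma cstar_neumann a : cnorm a < 1 -> exists b, b * (1 - a) = 1.
Proof.
move=> a1; pose q := cnorm a; pose f b := 1 + b * a.
have [|||b _ fb] := @contraction_fixpoint R A setT f q 0 closedT (cnorm_ge0 a) a1.
- by [].
- by [].
- move=> x y _ _; rewrite /f opprD addrACA subrr add0r -mulrBl mulrC.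
  exact: cnormM.
by exists b; rewrite mulrBr mulr1 -{1}fb /f addrK.
Qed.

(** [cstar_sqrt] rescaled by r. All positivity arguments below draw their squares from it. *)
Lemma cstar_sqrtr a (r : R) : is_sa a -> cnorm a < r ->
  exists2 v, is_sa v & v * v = r%:C *: 1 - a.
Proof.
move=> sa ar; have r0 : 0 < r by apply: le_lt_trans ar; apply: cnorm_ge0.
pose b := (r^-1)%:C *: a.
have [||w [_ sw _] ww] := @cstar_sqrt setT b cstar_subalgT I.
- by rewrite /is_sa starZr sa.
- by rewrite cnormZr ger0_norm ?invr_ge0 ?(ltW r0)// mulrC ltr_pdivrMr // mul1r.
exists ((Num.sqrt r)%:C *: (1 - w)).
  by rewrite /is_sa starZr starD starN star1 sw.
rewrite -scalerAl -scalerAr scalerA ww -rmorphM /= -expr2 sqr_sqrtr ?(ltW r0)//.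
rewrite scalerBr /b scalerA -rmorphM /= divff ?gt_eqF // rmorph1 scale1r.
by [].
Qed.

Definition rpart x : A := (2^-1 : R)%:C *: (x + star x).
Definition ipart x : A := (2^-1 * 'i : R[i]) *: (star x - x).

End Spectral.

(** * Identities in commutative rings *)

Section RingIdentities.
Variable C : comNzRingType.
Implicit Types a b c d e j k r u v : C.

(** Scalars of the algebra enter as ring elements tied by an equation, here [k * (2 * d) = 1], so
    that [ring] can handle them. *)
Lemma sq_decomp_aux k d a e : k * (2 * d) = 1 -> d * d = e ->
  e - a * a = k * ((d - a) * (d - a) * (a + d) + (a + d) * (a + d) * (d - a)).
Proof. by move=> k1 <-; rewrite -[LHS]mul1r -{1}k1; ring. Qed.

(** Elimination of a: s2 times the first relation plus s1 times the second. *)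
Lemma adjoin_aux s1 s2 a q1 q2 : - 1 = q1 + s1 * a -> - 1 = q2 + s2 * - a ->
  - s1 = s2 + (s2 * q1 + s1 * q2) :> C.
Proof.
move=> e1 e2; have -> : q1 = - 1 - s1 * a by rewrite {1}e1 addrK.
have -> : q2 = - 1 - s2 * - a by rewrite {1}e2 addrK.
ring.
Qed.

Lemma shift_sq_aux a r : a * a = (a - r) * (a - r) + (2 * r * (a - r) + r * r).
Proof. ring. Qed.

Lemma polar_aux k a b n : k * 4 = 1 -> n = - 1 ->
  a * b = k * ((a + b) * (a + b) + n * ((a + n * b) * (a + n * b))).
Proof. by move=> k1 ->; rewrite -[LHS]mul1r -{1}k1; ring. Qed.

Lemma sum_sq_aux k s a : k * 4 = 1 ->
  s * a = k * ((a + 1) * (a + 1)) * s + k * ((a - 1) * (a - 1)) * - s.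
Proof. by move=> k1; rewrite -[LHS]mul1r -{1}k1; ring. Qed.

Lemma complex_lin_aux j u v a b c d : j * j = - 1 ->
  (u + j * v) * (a + j * b) + (c + j * d) =
  (u * a + (- v * b + c)) + j * (u * b + (v * a + d)).
Proof. by move=> j2; ring: j2. Qed.

Lemma complex_mul_aux j a b c d n : j * j = - 1 -> n = - 1 ->
  (a + j * b) * (c + j * d) = (a * c + n * (b * d)) + j * (a * d + b * c).
Proof. by move=> j2 ->; ring: j2. Qed.

End RingIdentities.

(** * Sums of squares in a commutative C*-algebra *)

Section Commutative.
Variables (R : realType) (A : cstarAlgType R).
Hypothesis comm : forall x y : A, x * y = y * x.
Implicit Types (x y z a b p q s t u v w : A).

Let CA : comNzRingType :=
  HB.pack (CstarAlgebra.sort A) (GRing.PzSemiRing_hasCommutativeMul.Build A comm).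

Lemma sumsq_unitary v t : is_sa v -> is_sa t ->
  star (v + ('i : R[i]) *: t) * (v + ('i : R[i]) *: t) = v * v + t * t.
Proof.
move=> sv st; rewrite starD starZ sv st conjCi scaleNr.
set T := 'i *: t; have TT : T * T = - (t * t).
  by rewrite -scalerAl -scalerAr scalerA -expr2 sqrCi scaleN1r.
by rewrite mulrDl !mulrDr !mulNr [T * v]comm TT opprK addrA addrK.
Qed.

(** The element u = v + i t satisfies star u * u = c, so its norm is the square root of c, and v is
    its real part. *)
Lemma cnorm_sumsq v t (c : R) : is_sa v -> is_sa t -> 0 <= c ->
  v * v + t * t = c%:C *: 1 -> cnorm v ^+ 2 <= c.
Proof.
move=> sv st c0 e; pose u := v + ('i : R[i]) *: t.
have u2 : cnorm u ^+ 2 = c.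
  rewrite -cnorm_star_mul sumsq_unitary // e cnormZr cnorm1 mulr1.
  by rewrite ger0_norm.
have vE : v = (2^-1 : R)%:C *: (u + star u).
  rewrite /u starD starZ sv st conjCi scaleNr addrACA subrr addr0.
  by rewrite scalerDr -scalerDl -rmorphD /= -[2^-1]mul1r -splitr rmorph1 scale1r.
have vu : cnorm v <= cnorm u.
  rewrite {1}vE cnormZr ger0_norm ?invr_ge0 // ler_pdivrMl // mulr_natl mulr2n.
  by apply: le_trans (cnormD _ _) _; rewrite cnorm_star.
by rewrite -u2 lerXn2r // nnegrE cnorm_ge0.
Qed.

Definition sc (r : R) : A := r%:C *: 1.

Lemma scE (r : R) x : sc r * x = r%:C *: x.
Proof. by rewrite /sc -scalerAl mul1r. Qed.
Lemma sc1 : sc 1 = 1. Proof. by rewrite /sc rmorph1 scale1r. Qed.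
Lemma sc0 : sc 0 = 0. Proof. by rewrite /sc rmorph0 scale0r. Qed.
Lemma scD (r s : R) : sc (r + s) = sc r + sc s.
Proof. by rewrite /sc rmorphD scalerDl. Qed.
Lemma scN (r : R) : sc (- r) = - sc r.
Proof. by rewrite /sc rmorphN scaleNr. Qed.
Lemma scM (r s : R) : sc (r * s) = sc r * sc s.
Proof. by rewrite /sc -scalerAl mul1r scalerA rmorphM. Qed.
Lemma sc_nat n : n%:R = sc n%:R.
Proof. by rewrite /sc rmorph_nat scaler_nat. Qed.
Lemma sc_sa (r : R) : is_sa (sc r).
Proof. by rewrite /is_sa /sc starZr star1. Qed.
Lemma saD a b : is_sa a -> is_sa b -> is_sa (a + b).
Proof. by rewrite /is_sa starD => -> ->. Qed.
Lemma saN a : is_sa a -> is_sa (- a).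
Proof. by rewrite /is_sa starN => ->. Qed.
Lemma saB a b : is_sa a -> is_sa b -> is_sa (a - b).
Proof. by move=> sa sb; apply: saD => //; apply: saN. Qed.
Lemma saM a b : is_sa a -> is_sa b -> is_sa (a * b).
Proof. by rewrite /is_sa starM => -> ->; rewrite comm. Qed.

Lemma rpart_sa x : is_sa (rpart x).
Proof. by rewrite /is_sa /rpart starZr starD starK addrC. Qed.

Lemma ipart_sa x : is_sa (ipart x).
Proof.
rewrite /is_sa /ipart starZ starD starN starK rmorphM /= conjCi fmorphV rmorph_nat.
by rewrite mulrN scaleNr -scalerN opprB.
Qed.

Lemma cart_decomp x : x = rpart x + ('i : R[i]) *: ipart x.
Proof.
rewrite /rpart /ipart scalerA mulrCA -expr2 sqrCi mulrN1 scaleNr -scalerN opprB.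
rewrite fmorphV rmorph_nat -scalerDr addrACA subrr addr0 scalerDr -scalerDl.
by rewrite -[2^-1]mul1r -splitr scale1r.
Qed.

Inductive sos : A -> Prop :=
| sos0 : sos 0
| sos_cons z p : sos p -> sos (star z * z + p).

Lemma sosD p q : sos p -> sos q -> sos (p + q).
Proof.
by elim=> [|z {}p _ IH] sq; rewrite ?add0r // -addrA; apply: sos_cons; apply: IH.
Qed.

Lemma sos_star z : sos (star z * z).
Proof. by rewrite -[star z * z]addr0; apply: sos_cons; apply: sos0. Qed.

Lemma sosM_star z q : sos q -> sos (star z * z * q).
Proof.
elim=> [|w {}q _ IH]; first by rewrite mulr0; apply: sos0.
rewrite mulrDr; apply: sosD => //.
rewrite (_ : _ * _ = star (z * w) * (z * w)); first exact: sos_star.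
rewrite starM [star w * star z]comm -!mulrA; congr (_ * _).
by rewrite mulrA [z * star w]comm -mulrA.
Qed.

Lemma sosM p q : sos p -> sos q -> sos (p * q).
Proof.
move=> sp sq; elim: sp => [|z {}p _ IH]; first by rewrite mul0r; apply: sos0.
by rewrite mulrDl; apply: sosD => //; apply: sosM_star.
Qed.

Lemma sos_sq v : is_sa v -> sos (v * v).
Proof. by move=> sv; rewrite -[X in X * _]sv; apply: sos_star. Qed.

Lemma sos_sa p : sos p -> is_sa p.
Proof.
elim=> [|z {}p _ IH]; first exact: star0.
by apply: saD => //; rewrite /is_sa starM starK.
Qed.

Lemma sos_sc (r : R) : 0 <= r -> sos (sc r).
Proof.
move=> r0; rewrite -(sqr_sqrtr r0) expr2 scM; apply: sos_sq; exact: sc_sa.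
Qed.

Lemma sos_arch b (r : R) : is_sa b -> cnorm b < r -> sos (sc r - b).
Proof. by move=> sb br; have [v sv <-] := cstar_sqrtr sb br; apply: sos_sq. Qed.

(** Positivity in terms of the norm, a form stable under sums. For a single square s s and M above
    its norm, M - s s = v v with v self-adjoint, and v v + s s = M bounds the norm of v v by M. *)
Lemma sos_bound p : sos p -> exists2 M, 0 <= M & cnorm (sc M - p) <= M.
Proof.
have sq s : is_sa s -> exists2 M, 0 <= M & cnorm (sc M - s * s) <= M.
  move=> ss; exists (cnorm (s * s) + 1); first by rewrite addr_ge0 ?cnorm_ge0.
  have [|v sv ve] := @cstar_sqrtr _ _ (s * s) (cnorm (s * s) + 1) (saM ss ss).
    by rewrite ltrDl.
  rewrite -ve -{1}sv cnorm_star_mul.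
  apply: (@cnorm_sumsq v s) => //; last by rewrite ve subrK.
  by rewrite addr_ge0 ?cnorm_ge0.
have add p1 p2 M1 M2 : cnorm (sc M1 - p1) <= M1 -> cnorm (sc M2 - p2) <= M2 ->
    cnorm (sc (M1 + M2) - (p1 + p2)) <= M1 + M2.
  move=> h1 h2; rewrite scD opprD addrACA.
  by apply: le_trans (cnormD _ _) (lerD h1 h2).
elim=> [|z {}p _ [M M0 hM]].
  by exists 0 => //; rewrite sc0 subr0 cnorm0.
have [Ms Ms0 hs] := sq _ (rpart_sa z); have [Mt Mt0 ht] := sq _ (ipart_sa z).
exists (Ms + Mt + M); first by rewrite !addr_ge0.
rewrite [star z * z](_ : _ = rpart z * rpart z + ipart z * ipart z).
  exact: (add _ _ _ _ (add _ _ _ _ hs ht) hM).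
by rewrite {1 2}[z]cart_decomp sumsq_unitary //; [exact: rpart_sa|exact: ipart_sa].
Qed.

Lemma sos_inv p : sos p -> exists b, b * (1 + p) = 1.
Proof.
move=> /sos_bound[M M0 hM]; have M1 : 0 < M + 1 by rewrite ltr_wpDl.
(* 1 + p is M + 1 times 1 - (M - p) / (M + 1), and the subtracted term has norm below 1. *)
have [|b hb] := @cstar_neumann _ A (sc (M + 1)^-1 * (sc M - p)).
  rewrite scE cnormZr ger0_norm ?invr_ge0 ?(ltW M1)// ltr_pdivrMl // mulr1.
  by apply: le_lt_trans hM _; rewrite ltrDl.
exists (b * sc (M + 1)^-1); rewrite -mulrA -[RHS]hb; congr (_ * _).
have e : sc (M + 1)^-1 * sc (M + 1) = 1 by rewrite -scM mulVf ?gt_eqF // sc1.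
rewrite -[X in X - _]e -mulrBr; congr (_ * _).
by rewrite scD sc1 [sc M + 1]addrC opprB addrA addrAC addrK.
Qed.

(* From an inverse [d] one builds a self-adjoint [g] with
   [t * t + g * g = 1 - eps], which forces [cnorm t ^+ 2 <= 1 - eps]. *)
Lemma sq_noninvertible t d : is_sa t -> cnorm t = 1 -> d * (1 - t * t) <> 1.
Proof.
move=> st t1 dt; pose e := t * t.
have se : is_sa e by apply: saM.
have s1e : is_sa (1 - e) by rewrite -sc1; apply: saB => //; exact: sc_sa.
have sd : is_sa d.
  have d' : (1 - e) * star d = 1 by rewrite -[in LHS]s1e -starM dt star1.
  by rewrite /is_sa -[LHS]mul1r -dt -mulrA d' mulr1.
(* This size makes the norm of f = eps d less than 1/4; then 1 + f is invertible, and both 1 - f and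
   the inverse [k] of 1 + f have square roots. *)
pose eps := (4 * (cnorm d + 1))^-1.
have d1 : 0 < cnorm d + 1 by rewrite ltr_wpDl ?cnorm_ge0.
have eps0 : 0 < eps by rewrite invr_gt0 mulr_gt0.
have epsd : eps * cnorm d < 4^-1.
  rewrite /eps invfM -mulrA gtr_pMr ?invr_gt0 // ltr_pdivrMl // mulr1.
  by rewrite ltrDl.
have half1 : (4^-1 : R) < 1 by rewrite invf_lt1 // ltr1n.
pose f := sc eps * d.
have sf : is_sa f by apply: saM => //; exact: sc_sa.
have nf : cnorm f < 4^-1 by rewrite /f scE cnormZr ger0_norm // ltW.
have [v sv ve] : exists2 v, is_sa v & v * v = sc (1 + eps) - e.
  apply: cstar_sqrtr => //.
  have -> : cnorm e = 1 by rewrite /e -{1}st cnorm_star_mul t1 expr1n.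
  by rewrite ltrDl.
have [|k hk] := @cstar_neumann _ A (- f).
  by rewrite cnormN; apply: lt_trans half1.
rewrite opprK in hk.
have kE : 1 - k = k * f by rewrite -hk mulrDr mulr1 addrC addKr.
have sk : is_sa k.
  have k' : (1 + f) * star k = 1.
    have s1f : is_sa (1 + f) by rewrite -sc1; apply: saD => //; exact: sc_sa.
    by rewrite -[in LHS]s1f -starM hk star1.
  by rewrite /is_sa -[LHS]mul1r -hk -mulrA k' mulr1.
have nk : cnorm (1 - k) < 1.
  have : cnorm (1 - k) <= 4^-1 * cnorm k.
    rewrite kE; apply: le_trans (cnormM _ _) _.
    by rewrite [leLHS]mulrC ler_wpM2r ?cnorm_ge0 // ltW.
  have : cnorm k <= cnorm (1 - k) + 1.
    rewrite -(cnorm1 A) cnormB -[k in leLHS](subrK 1).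
    exact: cnormD.
  move=> h1 h2; have : cnorm (1 - k) <= 4^-1 * (cnorm (1 - k) + 1).
    by apply: le_trans h2 _; rewrite ler_pM2l ?invr_gt0.
  by lra.
have [s [_ ss _] sE] : exists2 w, [/\ setT w, is_sa w & cnorm w < 1] &
    (1 - w) * (1 - w) = 1 - (1 - k).
  apply: (cstar_sqrt (@cstar_subalgT _ A)) => //.
  by rewrite -sc1; apply: saB => //; exact: sc_sa.
have [s' [_ ss' _] sE'] : exists2 w, [/\ setT w, is_sa w & cnorm w < 1] &
    (1 - w) * (1 - w) = 1 - f.
  by apply: (cstar_sqrt (@cstar_subalgT _ A)) => //; apply: lt_trans half1.
rewrite subKr in sE.
(* As d inverts 1 - e, v v = 1 + eps - e = (1 - e)(1 + f). The other two factors have squares k and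
   1 - f, which turn this into 1 - e and then into 1 - e - eps. *)
pose g := v * (1 - s) * (1 - s').
have sg : is_sa g.
  by apply: saM; first apply: saM => //; rewrite -sc1; apply: saB => //; exact: sc_sa.
have gE : t * t + g * g = sc (1 - eps).
  rewrite (_ : g * g = (v * v) * ((1 - s) * (1 - s)) * ((1 - s') * (1 - s'))).
    rewrite ve sE sE'.
    have -> : (sc (1 + eps) - e) * k = 1 - e.
      have -> : sc (1 + eps) - e = (1 - e) * (1 + f).
        rewrite mulrDr mulr1 /f scE -scalerAr [(1 - e) * d]comm dt -/(sc eps).
        by rewrite scD sc1 addrAC.
      by rewrite -mulrA [_ * k]comm hk mulr1.
    rewrite mulrBr mulr1 /f scE -scalerAr [(1 - e) * d]comm dt -/(sc eps).
    by rewrite scD scN sc1 -/e addrC addrAC subrK.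
  have sqM a b : a * b * (a * b) = a * a * (b * b).
    by rewrite -!mulrA; congr (_ * _); rewrite !mulrA [b * a]comm.
  by rewrite /g !sqM.
have : cnorm t ^+ 2 <= 1 - eps.
  by apply: cnorm_sumsq gE => //; rewrite subr_ge0 invf_le1 ?mulr_gt0 //; have := cnorm_ge0 d; lra.
by rewrite t1 expr1n lerDl oppr_ge0 leNgt eps0.
Qed.

(** * Maximal quadratic modules *)

Section Module.
Variable x0 : A.
Hypothesis x01 : cnorm x0 = 1.
Let y := star x0 * x0.

Let sos_y : sos y. Proof. exact: sos_star. Qed.
Let sa_y : is_sa y. Proof. exact: sos_sa. Qed.
Let norm_y : cnorm y = 1. Proof. by rewrite cnorm_star_mul x01 expr1n. Qed.

(** 1 + y is invertible since y is a sum of squares, so an inverse of 1 - y would give one of 1 - y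
    y. *)
Lemma one_sub_noninvertible b : b * (1 - y) <> 1.
Proof.
move=> b1; have [c c1] := sos_inv sos_y.
apply: (@sq_noninvertible y (c * b) sa_y norm_y).
have -> : 1 - y * y = (1 - y) * (1 + y).
  by rewrite mulrDr mulr1 mulrBl mul1r addrA subrK.
by rewrite -mulrA [b * _]mulrA b1 mul1r.
Qed.

(* The self-adjoint part of a character chi with [`|chi x0| = 1 = cnorm x0] is
   read off a maximal proper quadratic module containing [y - 1]: it contains a
   or [- a] for each self-adjoint a, and chi a is the resulting Dedekind cut. *)
Definition is_qmodule (Q : set A) :=
  [/\ forall a, Q a -> is_sa a, forall a b, Q a -> Q b -> Q (a + b),
      forall p a, sos p -> Q a -> Q (p * a), forall p, sos p -> Q p
    & Q (y - 1) /\ ~ Q (- 1)].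

Definition base_qmodule : set A :=
  [set b | exists p q, [/\ sos p, sos q & b = p + q * (y - 1)]].

(** The point is properness: -1 = p + q (y - 1) would make q (1 - y) equal to the invertible element
    1 + p, and so 1 - y would be invertible. *)
Lemma base_qmoduleP : is_qmodule base_qmodule.
Proof.
split.
- move=> _ [p [q [sp sq ->]]]; apply: saD; first exact: sos_sa.
  by apply: saM; first exact: sos_sa; rewrite -sc1; apply: saB => //; exact: sc_sa.
- move=> _ _ [p [q [sp sq ->]]] [p' [q' [sp' sq' ->]]].
  exists (p + p'), (q + q'); split; [exact: sosD|exact: sosD|].
  by rewrite mulrDl addrACA.
- move=> r _ sr [p [q [sp sq ->]]]; exists (r * p), (r * q).
  by split; [exact: sosM|exact: sosM|rewrite mulrDr mulrA].
- by move=> p sp; exists p, 0; split=> //; [exact: sos0|rewrite mul0r addr0].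
- split.
    exists 0, 1; split; [exact: sos0| |by rewrite mul1r add0r].
    by rewrite -sc1; apply: sos_sc.
  move=> [p [q [sp sq e]]]; have [b b1] := sos_inv sp.
  apply: (@one_sub_noninvertible (b * q)); rewrite -[RHS]b1 -mulrA; congr (_ * _).
  have e' : q * (y - 1) = - 1 - p.
    by apply/esym/(canLR (addrK p)); apply: etrans e (addrC _ _).
  by rewrite -[1 - y]opprB mulrN e' opprB opprK addrC.
Qed.

Lemma max_qmodule : exists Q, is_qmodule Q /\
  forall Q', is_qmodule Q' -> Q `<=` Q' -> Q' `<=` Q.
Proof.
pose M := base_qmodule.
(* Zorn's lemma is applied to sets whose union with [M] is a quadratic module; in this form the
   empty chain has an admissible union as well. *)
have [|B [BM Bmax]] := @Zorn_bigcup A (fun B => is_qmodule (B `|` M)).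
  move=> F FP Ftot; pose U := \bigcup_(X in F) X `|` M.
  have MQ := base_qmoduleP; have MU : M `<=` U by move=> z; right.
  have XU X : F X -> X `|` M `<=` U.
    by move=> FX z [Xz|Mz]; [left; exists X|right].
  (* Every closure property involves at most two elements of the union, and these lie in a single
     module of the chain. *)
  have pair a b : U a -> U b -> exists N, [/\ is_qmodule N, N `<=` U, N a & N b].
    move=> [[X FX Xa]|Ma] [[X' FX' X'b]|Mb].
    - have [XX'|X'X] := Ftot _ _ FX FX'.
        by exists (X' `|` M); split; [exact: FP|exact: XU|left; apply: XX'|left].
      by exists (X `|` M); split; [exact: FP|exact: XU|left|left; apply: X'X].
    - by exists (X `|` M); split; [exact: FP|exact: XU|left|right].
    - by exists (X' `|` M); split; [exact: FP|exact: XU|right|left].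
    - by exists M; split.
  split.
  - by move=> a Ua; have [N [[h _ _ _ _] _ Na _]] := pair a a Ua Ua; apply: h.
  - move=> a b Ua Ub; have [N [[_ h _ _ _] NU Na Nb]] := pair a b Ua Ub.
    by apply: NU; apply: h.
  - move=> p a sp Ua; have [N [[_ _ h _ _] NU Na _]] := pair a a Ua Ua.
    by apply: NU; apply: h.
  - by move=> p sp; apply: MU; have [_ _ _ h _] := MQ; apply: h.
  - split; first by apply: MU; have [_ _ _ _ []] := MQ.
    by move=> U1; have [N [[_ _ _ _ [_ h]] _ N1 _]] := pair _ _ U1 U1.
exists (B `|` M); split=> // Q' Q'm BQ a Q'a; apply: contrapT => Ba.
have MQ : M `<=` Q' by move=> z Mz; apply: BQ; right.
apply: (Bmax Q').
  split; first by move=> z Bz; apply: BQ; left.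
  by move=> /(_ a Q'a) B'a; apply: Ba; left.
suff -> : Q' `|` M = Q' by [].
by apply/setUidPl.
Qed.

(** * The character of a maximal quadratic module *)

Section Character.
Variable Q : set A.
Hypothesis Qm : is_qmodule Q.
Hypothesis Qmax : forall Q', is_qmodule Q' -> Q `<=` Q' -> Q' `<=` Q.

Let Qsa a : Q a -> is_sa a. Proof. by have [h _ _ _ _] := Qm; apply: h. Qed.
Let QD a b : Q a -> Q b -> Q (a + b).
Proof. by have [_ h _ _ _] := Qm; apply: h. Qed.
Let QM p a : sos p -> Q a -> Q (p * a).
Proof. by have [_ _ h _ _] := Qm; apply: h. Qed.
Let Qsos p : sos p -> Q p. Proof. by have [_ _ _ h _] := Qm; apply: h. Qed.
Let Qy : Q (y - 1). Proof. by have [_ _ _ _ []] := Qm. Qed.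
Let Q1 : ~ Q (- 1). Proof. by have [_ _ _ _ []] := Qm. Qed.

(** The set of all q + p a is closed like a quadratic module and strictly larger than Q, so by
    maximality it fails to be proper. *)
Let adjoin a : is_sa a -> ~ Q a ->
  exists q p, [/\ Q q, sos p & - 1 = q + p * a].
Proof.
move=> sa nQa; apply: contrapT => none; apply: nQa.
pose Q' : set A := [set b | exists q p, [/\ Q q, sos p & b = q + p * a]].
apply: (Qmax (Q' := Q')).
- split.
  + move=> _ [q [p [Qq sp ->]]]; apply: saD; first exact: Qsa.
    by apply: saM => //; apply: sos_sa.
  + move=> _ _ [q [p [Qq sp ->]]] [q' [p' [Qq' sp' ->]]].
    exists (q + q'), (p + p'); split; [exact: QD|exact: sosD|].
    by rewrite mulrDl addrACA.
  + move=> r _ sr [q [p [Qq sp ->]]]; exists (r * q), (r * p).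
    by split; [exact: QM|exact: sosM|rewrite mulrDr mulrA].
  + move=> p sp; exists p, 0; split; [exact: Qsos|exact: sos0|].
    by rewrite mul0r addr0.
  + split; last by move=> [q [p [Qq sp e]]]; apply: none; exists q, p.
    by exists (y - 1), 0; split; [exact: Qy|exact: sos0|rewrite mul0r addr0].
- by move=> q Qq; exists q, 0; split=> //; [exact: sos0|rewrite mul0r addr0].
- exists 0, 1; split; last by rewrite add0r mul1r.
    by apply: Qsos; apply: sos0.
  by rewrite -sc1; apply: sos_sc.
Qed.

(** Otherwise -1 = q1 + s1 a = q2 - s2 a, and eliminating a puts -s1 into Q next to s1. As a is a
    quarter of (a + 1)^2 - (a - 1)^2, also s1 a is in Q, and then so is -1. *)
Let Qtot a : is_sa a -> Q a \/ Q (- a).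
Proof.
move=> sa; apply: contrapT => /not_orP[na nNa].
have [q1 [s1 [Qq1 ss1 e1]]] := adjoin sa na.
have [q2 [s2 [Qq2 ss2 e2]]] := adjoin (saN sa) nNa.
have Qs1 : Q s1 by apply: Qsos.
have QNs1 : Q (- s1).
  rewrite (@adjoin_aux CA s1 s2 a q1 q2 e1 e2).
  by apply: QD; [exact: Qsos|apply: QD; exact: QM].
apply: Q1; rewrite e1; apply: QD => //.
have k4 : sc 4^-1 * 4%:R = 1.
  by rewrite sc_nat -scM mulVf ?sc1.
rewrite (@sum_sq_aux CA (sc 4^-1) s1 a k4).
have s1a : is_sa (1 : A) by exact: star1.
have k0 : sos (sc 4^-1) by apply: sos_sc; rewrite invr_ge0.
by apply: QD; apply: QM => //; apply: sosM => //; apply: sos_sq;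
  [exact: saD|exact: saB].
Qed.

Let Qsc (r : R) : Q (sc r) -> 0 <= r.
Proof.
move=> Qr; rewrite leNgt; apply/negP => r0; apply: Q1.
have -> : - 1 = sc (- r^-1) * sc r by rewrite -scM mulNr mulVf ?lt_eqF // scN sc1.
apply: QM => //; apply: sos_sc.
by rewrite oppr_ge0 invr_le0 ltW.
Qed.

Definition val_at a (r : R) := forall e : R, 0 < e ->
  Q (a - sc (r - e)) /\ Q (sc (r + e) - a).

Let val_uniq a (r s : R) : val_at a r -> val_at a s -> r = s.
Proof.
have le r1 r2 : val_at a r1 -> val_at a r2 -> r1 <= r2.
  move=> h1 h2; apply/ler_addgt0Pr => e e0.
  have e2 : 0 < e / 2 by rewrite divr_gt0.
  have [+ _] := h1 _ e2; have [_ +] := h2 _ e2 => Qa Qb.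
  have := QD Qa Qb; rewrite addrA subrK -scN -scD => /Qsc; lra.
by move=> h1 h2; apply/eqP; rewrite eq_le !le.
Qed.

(** The value is the supremum of the r with a - r in Q. It is finite because r - a and r + a are
    sums of squares for r above the norm of a, and the upper half of the cut is totality. *)
Let val_ex a : is_sa a -> exists r, val_at a r.
Proof.
move=> sa; pose D : set R := [set r | Q (a - sc r)].
have Dn : D (- (cnorm a + 1)).
  rewrite /D /= scN opprK addrC -[a]opprK; apply: Qsos; apply: sos_arch.
    exact: saN.
  by rewrite !cnormN ltrDl.
have Dub : ubound D (cnorm a + 1).
  move=> r Qr; have : Q (sc (cnorm a + 1) - a).
    by apply: Qsos; apply: sos_arch => //; rewrite ltrDl.
  move=> /QD /(_ Qr); rewrite addrA subrK -scN -scD => /Qsc.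
  by rewrite subr_ge0.
have hs : has_sup D by split; [exists (- (cnorm a + 1))|exists (cnorm a + 1)].
exists (sup D) => e e0; split.
  have [r Dr rs] := sup_adherent e0 hs.
  rewrite -[a](subrK (sc r)) -addrA; apply: QD => //.
  by rewrite -scN -scD; apply: Qsos; apply: sos_sc; rewrite subr_ge0 ltW.
have sb : is_sa (a - sc (sup D + e)) by apply: saB => //; exact: sc_sa.
have [Dr|] := Qtot sb; last by rewrite opprB.
have := ub_le_sup hs.2 Dr; rewrite gerDl leNgt e0 //.
Qed.

Let valD a b (r s : R) : val_at a r -> val_at b s -> val_at (a + b) (r + s).
Proof.
move=> ha hb e e0; have e2 : 0 < e / 2 by rewrite divr_gt0.
have [a1 a2] := ha _ e2; have [b1 b2] := hb _ e2; split.
  have -> : r + s - e = (r - e / 2) + (s - e / 2) by lra.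
  by rewrite scD opprD addrACA; apply: QD.
have -> : r + s + e = (r + e / 2) + (s + e / 2) by lra.
by rewrite scD opprD addrACA; apply: QD.
Qed.

Let val_sc (c : R) : val_at (sc c) c.
Proof.
move=> e e0; rewrite -!scN -!scD.
by split; apply: Qsos; apply: sos_sc; lra.
Qed.

Let valZ (c : R) a (r : R) : val_at a r -> val_at (sc c * a) (c * r).
Proof.
wlog c0 : c a r / 0 < c => [hw|] ha.
  have [c0|c0|<-] := ltgtP 0 c; first exact: hw.
    have vN : val_at (- a) (- r).
      move=> e /ha[h1 h2]; split.
        by rewrite -scN opprD !opprK addrC.
      by rewrite opprK addrC [- r + e]addrC -opprB scN.
    by rewrite -[c * r]mulrNN -[sc c * a]mulrNN -scN; apply: hw => //; rewrite oppr_gt0.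
  by rewrite sc0 !mul0r -sc0; apply: val_sc.
move=> e e0; have [|h1 h2] := ha (e / c); first by rewrite divr_gt0.
have ce : c * (e / c) = e by rewrite mulrCA divff ?mulr1 // gt_eqF.
have sosc : sos (sc c) by apply: sos_sc; apply: ltW.
have := QM sosc h1; have := QM sosc h2.
by rewrite !mulrBr -!scM mulrBr mulrDr ce.
Qed.

(** Products are not among the closure properties of Q, so e - a^2 = (d - a)(d + a), with d the
    square root of e, is rewritten with squares as multipliers: 2 d times it is (d - a)^2 (a + d) +
    (a + d)^2 (d - a). *)
Let val_sq0 a : is_sa a -> val_at a 0 -> val_at (a * a) 0.
Proof.
move=> sa ha e e0.
split.
  rewrite sub0r scN opprK; apply: QD; first by apply: Qsos; apply: sos_sq.
  by apply: Qsos; apply: sos_sc; apply: ltW.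
rewrite add0r; pose d := Num.sqrt e.
have d0 : 0 < d by rewrite sqrtr_gt0.
have [] := ha d d0; rewrite sub0r scN opprK add0r => h1 h2.
have -> : sc e - a * a = sc (2 * d)^-1 *
    ((sc d - a) * (sc d - a) * (a + sc d) + (a + sc d) * (a + sc d) * (sc d - a)).
  apply: (@sq_decomp_aux CA).
    change (sc (2 * d)^-1 * (2%:R * sc d) = 1 :> A).
    rewrite sc_nat -!scM mulVf ?sc1 // mulf_neq0 ?gt_eqF //.
  change (sc d * sc d = sc e :> A).
  by rewrite -scM -expr2 sqr_sqrtr // ltW.
have sd := sc_sa d.
apply: QM; first by apply: sos_sc; rewrite invr_ge0 mulr_ge0 // ltW.
by apply: QD; apply: QM => //; apply: sos_sq; [exact: saB|exact: saD].
Qed.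

Let val_sq a (r : R) : is_sa a -> val_at a r -> val_at (a * a) (r ^+ 2).
Proof.
move=> sa ha; pose b := a - sc r.
have sb : is_sa b by apply: saB => //; exact: sc_sa.
have hb : val_at b 0.
  by rewrite -(subrr r) /b -scN; exact: (valD ha (@val_sc (- r))).
have -> : a * a = b * b + (sc (2 * r) * b + sc (r ^+ 2)).
  by rewrite expr2 !scM -sc_nat; apply: (@shift_sq_aux CA).
have := valD (val_sq0 sb hb) (valD (valZ (2 * r) hb) (@val_sc (r ^+ 2))).
by rewrite mulr0 !add0r.
Qed.

(** Polarisation reduces products to the squares of a + b and a - b. *)
Let valM a b (r s : R) : is_sa a -> is_sa b -> val_at a r -> val_at b s ->
  val_at (a * b) (r * s).
Proof.
move=> sa sb ha hb.
have -> : r * s = 4^-1 * ((r + s) ^+ 2 + (- 1) * (r + (- 1) * s) ^+ 2).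
  by field.
have -> : a * b = sc 4^-1 * ((a + b) * (a + b) +
    sc (- 1) * ((a + sc (- 1) * b) * (a + sc (- 1) * b))).
  apply: (@polar_aux CA); last by rewrite scN sc1.
  change (sc 4^-1 * 4%:R = 1 :> A).
  by rewrite sc_nat -scM mulVf ?sc1.
have hN : val_at (a + sc (- 1) * b) (r + (- 1) * s).
  by apply: valD => //; apply: valZ.
apply: valZ; apply: valD.
  by apply: val_sq; [exact: saD|exact: valD].
apply: valZ; apply: val_sq => //; apply: saD => //; apply: saM => //; exact: sc_sa.
Qed.

(** The default 0 concerns only elements that are not self-adjoint; [qchar] applies [sa_val] to real
    and imaginary parts. *)
Definition sa_val a : R :=
  if pselect (is_sa a) is left sa then projT1 (cid (val_ex sa)) else 0.

Let sa_valP a : is_sa a -> val_at a (sa_val a).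
Proof.
by move=> sa; rewrite /sa_val; case: pselect => // h; case: (cid (val_ex h)).
Qed.

Let imag : A := ('i : R[i]) *: 1.

Let imagE x : ('i : R[i]) *: x = imag * x.
Proof. by rewrite /imag -scalerAl mul1r. Qed.

Let imag2 : imag * imag = - 1.
Proof. by rewrite -imagE /imag scalerA -expr2 sqrCi scaleN1r. Qed.

Let star_imag : star imag = - imag.
Proof. by rewrite /imag starZ star1 conjCi scaleNr. Qed.

Definition qchar x : R[i] := (sa_val (rpart x))%:C + 'i * (sa_val (ipart x))%:C.

Let qcharE a b (r s : R) : is_sa a -> is_sa b -> val_at a r -> val_at b s ->
  qchar (a + imag * b) = r%:C + 'i * s%:C.
Proof.
move=> sa sb ha hb.
have sx : star (a + imag * b) = a - imag * b.
  by rewrite starD starM sa sb star_imag mulrN [b * _]comm.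
have hr : rpart (a + imag * b) = a.
  rewrite /rpart sx addrACA subrr addr0 scalerDr -scalerDl -rmorphD /=.
  by rewrite -[2^-1]mul1r -splitr rmorph1 scale1r.
have hi : ipart (a + imag * b) = b.
  rewrite /ipart sx opprD addrACA subrr add0r -opprD scalerN -scaleNr.
  rewrite -imagE -scalerDr scalerA mulNr -mulrA -expr2 sqrCi mulrN1 opprK.
  by rewrite scalerDr -scalerDl -[2^-1]mul1r -splitr scale1r.
rewrite /qchar hr hi; congr (_%:C + 'i * _%:C).
  by apply: val_uniq ha; apply: sa_valP.
by apply: val_uniq hb; apply: sa_valP.
Qed.

Let qcharP x : exists a b (r s : R),
  [/\ is_sa a, is_sa b, val_at a r, val_at b s & x = a + imag * b].
Proof.
exists (rpart x), (ipart x), (sa_val (rpart x)), (sa_val (ipart x)).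
split; [exact: rpart_sa|exact: ipart_sa|apply: sa_valP; exact: rpart_sa|
  apply: sa_valP; exact: ipart_sa|by rewrite -imagE -cart_decomp].
Qed.

Lemma qchar_linear : linear (qchar : A -> R[i]^o).
Proof.
move=> k x x'; have [a [b [r [s [sa sb ha hb ->]]]]] := qcharP x.
have [c [d [t [w [sc' sd hc hd ->]]]]] := qcharP x'.
pose u := complex.Re k; pose v := complex.Im k.
have kE : k = u%:C + 'i * v%:C by rewrite /u /v; exact: complexE.
have -> : k *: (a + imag * b) + (c + imag * d) =
    (sc u * a + (sc (- v) * b + c)) + imag * (sc u * b + (sc v * a + d)).
  rewrite scN -(@complex_lin_aux CA imag (sc u) (sc v) a b c d imag2).
  change (k *: (a + imag * b) + (c + imag * d) =
    (sc u + imag * sc v) * (a + imag * b) + (c + imag * d)).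
  by rewrite {1}kE scalerDl -scalerA imagE -!scE mulrDl mulrA.
have saZ (e : R) z : is_sa z -> is_sa (sc e * z).
  by move=> sz; apply: saM => //; exact: sc_sa.
rewrite (@qcharE (sc u * a + (sc (- v) * b + c)) (sc u * b + (sc v * a + d))
  (u * r + (- v * s + t)) (u * s + (v * r + w)));
  [|by do ?[apply: saD|apply: saZ]..| |]; last 2 first.
- by apply: valD; [exact: valZ|apply: valD => //; exact: valZ].
- by apply: valD; [exact: valZ|apply: valD => //; exact: valZ].
rewrite (qcharE sa sb ha hb) (qcharE sc' sd hc hd) [in RHS]kE !(rmorphD, rmorphM, rmorphN) /=.
symmetry; apply: (@complex_lin_aux R[i] 'i).
by rewrite -expr2 sqrCi.
Qed.

Lemma qcharM x x' : qchar (x * x') = qchar x * qchar x'.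
Proof.
have [a [b [r [s [sa sb ha hb ->]]]]] := qcharP x.
have [c [d [t [w [sc' sd hc hd ->]]]]] := qcharP x'.
have -> : (a + imag * b) * (c + imag * d) =
    (a * c + sc (- 1) * (b * d)) + imag * (a * d + b * c).
  by apply: (@complex_mul_aux CA) => //; rewrite scN sc1.
rewrite (@qcharE (a * c + sc (- 1) * (b * d)) (a * d + b * c) (r * t + (- 1) * (s * w)) (r * w + s * t)).
- rewrite (qcharE sa sb ha hb) (qcharE sc' sd hc hd) !(rmorphD, rmorphM) /= rmorphN rmorph1.
  symmetry; apply: (@complex_mul_aux R[i] 'i) => //.
  by rewrite -expr2 sqrCi.
- by do ?[apply: saD|apply: saM] => //; exact: sc_sa.
- by do ?[apply: saD|apply: saM].
- by apply: valD; [exact: valM|apply: valZ; exact: valM].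
- by apply: valD; exact: valM.
Qed.

Lemma qchar1 : qchar 1 = 1.
Proof.
have -> : 1 = sc 1 + imag * sc 0 by rewrite sc1 sc0 mulr0 addr0.
rewrite (@qcharE (sc 1) (sc 0) 1 0); try exact: sc_sa; try exact: val_sc.
by rewrite rmorph0 mulr0 addr0 rmorph1.
Qed.

Lemma qchar_star x : qchar (star x) = (qchar x)^*.
Proof.
have [a [b [r [s [sa sb ha hb ->]]]]] := qcharP x.
have -> : star (a + imag * b) = a + imag * (sc (- 1) * b).
  by rewrite starD starM sa sb star_imag mulrN [b * _]comm scN sc1 mulN1r mulrN.
rewrite (@qcharE a (sc (- 1) * b) r (- 1 * s)) //; last 2 first.
- by apply: saM => //; exact: sc_sa.
- exact: valZ.
rewrite (qcharE sa sb ha hb) rmorphD rmorphM /= conjCi mulN1r rmorphN mulrN mulNr.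
by congr (_ - _ * _); apply/esym/conjc_real.
Qed.

(** The cut of y is squeezed: y - 1 is in Q by construction, and 1 + e - y is a sum of squares
    because y has norm 1. *)
Lemma qchar_y : qchar y = 1.
Proof.
have -> : y = y + imag * sc 0 by rewrite sc0 mulr0 addr0.
rewrite (@qcharE y (sc 0) 1 0); [by rewrite rmorph0 mulr0 addr0 rmorph1|by []|
  exact: sc_sa| |exact: val_sc].
move=> e e0; split; last first.
  by apply: Qsos; apply: sos_arch => //; rewrite norm_y ltrDl.
rewrite scD scN sc1 opprD opprK addrA; apply: QD => //.
by apply: Qsos; apply: sos_sc; apply: ltW.
Qed.

End Character.

End Module.

End Commutative.

(** * Characters that attain the norm *)

Definition is_character (R : realType) (A : starAlgType R) (chi : A -> R[i]) :=
  [/\ linear (chi : A -> R[i]^o), chi 1 = 1, {morph chi : x y / x * y}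
    & forall x, chi (star x) = (chi x)^*].

Section Gelfand.
Variables (R : realType) (A : cstarAlgType R).

(** For r above cnorm x, r^2 - star x * x is the square of a self-adjoint v, and chi is nonnegative
    on it. *)
Lemma character_norm_le (chi : A -> R[i]) (x : A) :
  is_character chi -> `|chi x| <= (cnorm x)%:C.
Proof.
move=> [chiL chi1 chiM chiS]; pose z := star x * x.
have zE : chi z = `|chi x| ^+ 2 by rewrite /z chiM chiS normCK mulrC.
have sz : is_sa z by rewrite /is_sa starM starK.
suff le r : cnorm x < r -> `|chi x| <= r%:C.
  have cE : `|chi x| = (complex.Re `|chi x|)%:C by apply/esym/RRe_real/normr_real.
  rewrite cE lecR; apply/ler_addgt0Pr => e e0.
  by rewrite -lecR -cE; apply: le; rewrite ltrDl.
move=> xr; have r0 : 0 <= r by apply: le_trans (ltW xr); apply: cnorm_ge0.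
have [|v sv ve] := @cstar_sqrtr _ A z (r ^+ 2) sz.
  by rewrite cnorm_star_mul ltrXn2r ?nnegrE ?cnorm_ge0.
rewrite -(@ler_pXn2r _ 2) ?nnegrE ?normr_ge0 ?lecR // -zE -rmorphXn /= -subr_ge0.
have -> : (r ^+ 2)%:C - chi z = chi (v * v).
  rewrite ve -[- z]scaleN1r chiL (linZ chiL) chi1 scaleN1r.
  by congr (_ - _); apply/esym/mulr1.
by rewrite chiM -{1}sv chiS mulrC mul_conjC_ge0.
Qed.

Hypothesis comm : forall x y : A, x * y = y * x.

Lemma exists_character (x : A) : exists2 chi : A -> R[i],
  is_character chi & `|chi x| = (cnorm x)%:C.
Proof.
have unit_case z : cnorm z = 1 -> exists2 chi : A -> R[i],
    is_character chi & `|chi z| = 1.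
  move=> z1; have [Q [Qm Qmax]] := max_qmodule comm z1.
  exists (qchar comm Qm Qmax).
    split; [exact: qchar_linear|exact: qchar1|exact: qcharM|exact: qchar_star].
  have := qchar_y comm z1 Qm Qmax.
  rewrite qcharM qchar_star mulrC -normCK => /eqP.
  by rewrite sqrp_eq1 ?normr_ge0 // => /eqP.
have [->|x0] := eqVneq x 0.
  have [chi chiP _] := unit_case 1 (cnorm1 A); exists chi => //.
  by have [chiL _ _ _] := chiP; rewrite (lin0 chiL) normr0 cnorm0.
have nx : 0 < cnorm x.
  rewrite lt_def cnorm_ge0 andbT; apply: contra_neq x0; exact: cnorm_eq0.
have [|chi chiP chix] := unit_case ((cnorm x)^-1%:C *: x).
  by rewrite cnormZr ger0_norm ?invr_ge0 ?cnorm_ge0 // mulVf // gt_eqF.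
exists chi => //; have [chiL _ _ _] := chiP.
move: chix; rewrite (linZ chiL) normrM => /(congr1 ( *%R (cnorm x)%:C)).
rewrite mulr1 mulrA ger0_norm ?lecR ?invr_ge0 ?cnorm_ge0 // -rmorphM /=.
by rewrite divff ?gt_eqF // rmorph1 mul1r.
Qed.

End Gelfand.

(** * Continuous functions on a compact space *)

Section CompactSpace.

(** The point ensures 1 <> 0 in the function algebra and gives the supremum norm a non-empty
    range. *)
Record compactSpace := CompactSpace {
  cs_space :> topologicalType;
  cs_point : cs_space;
  cs_compact : compact [set: cs_space]
}.

(** A tube lemma along a filter. It takes the place of finite subcovers wherever a local property
    has to become uniform. *)
Lemma compact_near_forall (X : topologicalType) (I : Type) (F : set_system I)
    (P : I -> X -> Prop) : compact [set: X] -> Filter F ->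
  (forall x : X, exists2 U : set X, nbhs x U & F [set i | forall x', U x' -> P i x']) ->
  F [set i | forall x, P i x].
Proof.
move=> /compact_near_coveringP cX FF PU.
have := cX I F P FF; have h : forall x, [set: X] x -> \near x & F, P F x.
  move=> x _; have [U nU FU] := PU x.
  by exists (U, [set i | forall x', U x' -> P i x']) => //= -[x' i] [Ux' h]; apply: h.
by move=> /(_ h); apply: filterS => i h' x; apply: h'.
Qed.

End CompactSpace.

(** * The C*-algebra of continuous functions *)

Section ContinuousFunctions.
Variables (R : realType) (X : compactSpace).

Definition Cfun : Type := contfun R X.
HB.instance Definition _ := GRing.Lmodule.on Cfun.

Definition fun_of_Cfun (f : Cfun) : X -> R[i] := fun_of_contfun f.
Coercion fun_of_Cfun : Cfun >-> Funclass.

Lemma CfunP (f g : Cfun) : f =1 g -> f = g.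
Proof. exact: contfunP. Qed.

Fact Cfun_mulA : associative (@contfun_mul R X : Cfun -> Cfun -> Cfun).
Proof. by move=> f g h; apply: CfunP => x; apply: mulrA. Qed.
Fact Cfun_mul1 : left_id (contfun1 R X : Cfun) (@contfun_mul R X).
Proof. by move=> f; apply: CfunP => x; apply: mul1r. Qed.
Fact Cfun_mulr1 : right_id (contfun1 R X : Cfun) (@contfun_mul R X).
Proof. by move=> f; apply: CfunP => x; apply: mulr1. Qed.
Fact Cfun_mulDl : left_distributive (@contfun_mul R X : Cfun -> Cfun -> Cfun) +%R.
Proof. by move=> f g h; apply: CfunP => x; apply: mulrDl. Qed.
Fact Cfun_mulDr : right_distributive (@contfun_mul R X : Cfun -> Cfun -> Cfun) +%R.
Proof. by move=> f g h; apply: CfunP => x; apply: mulrDr. Qed.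
Fact Cfun_1_neq0 : (contfun1 R X : Cfun) != 0.
Proof.
apply/eqP => /(congr1 (fun f : Cfun => f (cs_point X))) /eqP.
by rewrite [X in X == _]/= /fun_of_Cfun /= (oner_eq0 R[i]).
Qed.

HB.instance Definition _ := GRing.Zmodule_isNzRing.Build Cfun
  Cfun_mulA Cfun_mul1 Cfun_mulr1 Cfun_mulDl Cfun_mulDr Cfun_1_neq0.

Fact Cfun_scalerAl (k : R[i]) (f g : Cfun) : k *: (f * g) = k *: f * g.
Proof. by apply: CfunP => x; apply: mulrA. Qed.
Fact Cfun_scalerAr (k : R[i]) (f g : Cfun) : k *: (f * g) = f * (k *: g).
Proof. by apply: CfunP => x; apply: mulrCA. Qed.

HB.instance Definition _ := GRing.Lmodule_isLalgebra.Build R[i] Cfun Cfun_scalerAl.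
HB.instance Definition _ := GRing.Lalgebra_isAlgebra.Build R[i] Cfun Cfun_scalerAr.

Fact Cfun_starK : involutive (@contfun_conj R X : Cfun -> Cfun).
Proof. by move=> f; apply: CfunP => x; apply: conjCK. Qed.
Fact Cfun_star_semilinear (c : R[i]) (f g : Cfun) :
  (contfun_conj (c *: f + g) : Cfun) = c^* *: (contfun_conj f : Cfun) + contfun_conj g.
Proof.
apply: CfunP => x; change ((c * f x + g x)^* = c^* * (f x)^* + (g x)^*).
by rewrite rmorphD rmorphM.
Qed.
Fact Cfun_starM (f g : Cfun) :
  (contfun_conj (f * g) : Cfun) = (contfun_conj g : Cfun) * contfun_conj f.
Proof.
apply: CfunP => x; change ((f x * g x)^* = (g x)^* * (f x)^*).
by rewrite mulrC rmorphM.
Qed.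

HB.instance Definition _ := hasStar.Build R Cfun
  Cfun_starK Cfun_star_semilinear Cfun_starM.

Implicit Types (f g : Cfun) (x : X).
Lemma CfunD f g x : (f + g : Cfun) x = f x + g x. Proof. by []. Qed.
Lemma CfunN f x : (- f : Cfun) x = - f x. Proof. by []. Qed.
Lemma CfunB f g x : (f - g : Cfun) x = f x - g x. Proof. by []. Qed.
Lemma CfunM f g x : (f * g : Cfun) x = f x * g x. Proof. by []. Qed.
Lemma CfunZ c f x : (c *: f : Cfun) x = c * f x. Proof. by []. Qed.
Lemma Cfun1 x : (1 : Cfun) x = 1. Proof. by []. Qed.
Lemma Cfun0 x : (0 : Cfun) x = 0. Proof. by []. Qed.
Lemma Cfun_star f x : (star f : Cfun) x = (f x)^*. Proof. by []. Qed.
Lemma Cfun_comm f g : f * g = g * f :> Cfun.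
Proof. by apply: CfunP => x; rewrite !CfunM mulrC. Qed.

(** The modulus as an element of the totally ordered field R, where suprema are taken. *)
Definition cabs (z : R[i]) : R := complex.Re `|z|.

Lemma cabsE z : (cabs z)%:C = `|z|.
Proof. exact/RRe_real/normr_real. Qed.

Lemma cabs_ge0 z : 0 <= cabs z.
Proof. by rewrite -lecR cabsE normr_ge0. Qed.

Lemma Cfun_near f x (e : R) : 0 < e -> nbhs x [set y | cabs (f x - f y) < e].
Proof.
move=> e0; have e1 : 0 < e%:C by rewrite ltcR.
have := cvgr_dist_lt _ _ (@contfun_continuous _ _ f x) _ e1.
by move=> /(_ (nbhs_filter x)); apply: filterS => y /=; rewrite -ltcR cabsE.
Qed.

Lemma Cfun_bounded f : exists M : R, forall x, cabs (f x) <= M.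
Proof.
have := @compact_near_forall X R (+oo)%classic (fun M x => cabs (f x) <= M)
  (@cs_compact X) _.
case=> [x|M [_ h]].
  exists [set y | cabs (f x - f y) < 1]; first exact: Cfun_near.
  exists (cabs (f x) + 1); split; first exact: num_real.
  move=> M /= xM y xy; apply: ltW; apply: le_lt_trans xM.
  rewrite -lecR rmorphD /= !cabsE -lerBlDl.
  apply: le_trans (lerB_dist _ _) _.
  by rewrite distrC -cabsE lecR ltW.
by exists (M + 1); apply: h; rewrite ltrDl.
Qed.

Definition Cnorm f : R := sup (range (fun x => cabs (f x))).

Let norm_sup f : has_sup (range (fun x => cabs (f x))).
Proof.
split; first by exists (cabs (f (cs_point X))); exists (cs_point X).
by have [M h] := Cfun_bounded f; exists M => _ [x _ <-].
Qed.

Lemma Cnorm_ge f x : cabs (f x) <= Cnorm f.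
Proof. by apply: ub_le_sup; [have [] := norm_sup f|exists x]. Qed.

Lemma Cnorm_le f M : (forall x, cabs (f x) <= M) -> Cnorm f <= M.
Proof.
move=> h; apply: ge_sup; first by have [] := norm_sup f.
by move=> _ [x _ <-].
Qed.

Lemma cabsD z w : cabs (z + w) <= cabs z + cabs w.
Proof. by rewrite -lecR rmorphD /= !cabsE ler_normD. Qed.
Lemma cabsM z w : cabs (z * w) = cabs z * cabs w.
Proof. by apply: complexI; rewrite rmorphM /= !cabsE normrM. Qed.
Lemma cabsJ z : cabs z^* = cabs z.
Proof. by rewrite /cabs norm_conjC. Qed.
Lemma cabs0_eq z : cabs z <= 0 -> z = 0.
Proof. by rewrite -lecR cabsE normr_le0 => /eqP. Qed.

Fact CnormD f g : Cnorm (f + g) <= Cnorm f + Cnorm g.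
Proof.
apply: Cnorm_le => x; apply: le_trans (cabsD _ _) _.
by apply: lerD; apply: Cnorm_ge.
Qed.

Fact CnormZ (c : R[i]) f : (Cnorm (c *: f))%:C = `|c| * (Cnorm f)%:C.
Proof.
rewrite -cabsE -rmorphM /=; congr _%:C.
have le d g : Cnorm (d *: g) <= cabs d * Cnorm g.
  apply: Cnorm_le => x; rewrite CfunZ cabsM.
  by rewrite ler_wpM2l ?cabs_ge0 ?Cnorm_ge.
apply/eqP; rewrite eq_le le /=.
have [->|c0] := eqVneq c 0.
  rewrite /cabs normr0 mul0r.
  by apply: le_trans (Cnorm_ge _ (cs_point X)); apply: cabs_ge0.
have cc : cabs c != 0.
  by apply: contra_neq c0 => c0; apply: cabs0_eq; rewrite c0.
(* The converse inequality is [le] for the inverse scalar. *)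
have := le c^-1 (c *: f); rewrite scalerA mulVf // scale1r.
have -> : cabs c^-1 = (cabs c)^-1.
  by apply: (mulfI cc); rewrite -cabsM !divff // /cabs normr1.
by rewrite mulrC ler_pdivlMr 1?mulrC // lt_def cc cabs_ge0.
Qed.

Fact Cnorm_eq0 f : Cnorm f = 0 -> f = 0.
Proof.
by move=> f0; apply: CfunP => x; apply: cabs0_eq; rewrite -f0 Cnorm_ge.
Qed.

Fact CnormM f g : Cnorm (f * g) <= Cnorm f * Cnorm g.
Proof.
apply: Cnorm_le => x; rewrite CfunM cabsM.
by apply: ler_pM; rewrite ?cabs_ge0 ?Cnorm_ge.
Qed.

Fact Cnorm_star_mul f : Cnorm (star f * f) = Cnorm f ^+ 2.
Proof.
have n0 : 0 <= Cnorm f by apply: le_trans (Cnorm_ge _ (cs_point X)); apply: cabs_ge0.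
apply/eqP; rewrite eq_le; apply/andP; split.
  apply: Cnorm_le => x; rewrite CfunM Cfun_star cabsM cabsJ expr2.
  by apply: ler_pM; rewrite ?cabs_ge0 ?Cnorm_ge.
have m0 : 0 <= Cnorm (star f * f).
  by apply: le_trans (Cnorm_ge _ (cs_point X)); apply: cabs_ge0.
rewrite -[leRHS](sqr_sqrtr m0) lerXn2r ?nnegrE ?sqrtr_ge0 //.
apply: Cnorm_le => x; rewrite -[leLHS]ger0_norm ?cabs_ge0 // -sqrtr_sqr.
rewrite ler_sqrt // expr2 -{1}cabsJ -cabsM.
exact: (Cnorm_ge (star f * f)).
Qed.

HB.instance Definition _ := hasCstarNorm.Build R Cfun
  CnormD CnormZ Cnorm_eq0 CnormM Cnorm_star_mul.

Lemma cabs_ge_Re (z : R[i]) : `|complex.Re z| <= cabs z.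
Proof. by rewrite -lecR cabsE; exact: normc_ge_Re. Qed.

Lemma cabs_ge_Im (z : R[i]) : `|complex.Im z| <= cabs z.
Proof.
have -> : complex.Im z = - complex.Re (z * 'i%C).
  by rewrite ReiNIm opprK.
rewrite normrN; apply: le_trans (cabs_ge_Re _) _.
rewrite cabsM; have -> : cabs 'i%C = 1; last by rewrite mulr1.
by rewrite complexiE /cabs normCi.
Qed.

Lemma ReB (z w : R[i]) : complex.Re (z - w) = complex.Re z - complex.Re w.
Proof. exact: raddfB. Qed.
Lemma ImB (z w : R[i]) : complex.Im (z - w) = complex.Im z - complex.Im w.
Proof. exact: raddfB. Qed.

Lemma cabs_real (r : R) : cabs r%:C = `|r|.
Proof. by rewrite /cabs normc_def /= expr0n addr0 sqrtr_sqr. Qed.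

Lemma cabs_le_ReIm (z : R[i]) : cabs z <= `|complex.Re z| + `|complex.Im z|.
Proof.
rewrite {1}[z]complexE; apply: le_trans (cabsD _ _) _.
rewrite cabsM !cabs_real; have -> : cabs 'i%C = 1; last by rewrite mul1r.
by rewrite complexiE /cabs normCi.
Qed.

Lemma Cfun_uniform_limit (l : X -> R[i]^o) :
  (forall e : R, 0 < e -> exists f, forall x, cabs (f x - l x) < e) ->
  continuous l.
Proof.
move=> fl x; apply/cvgrPdist_lt => e e0.
have eE : e = (complex.Re e)%:C by apply/esym/RRe_real/gtr0_real.
have e1 : 0 < complex.Re e / 3 by rewrite divr_gt0 // -ltcR -eE.
have [f hf] := fl _ e1.
have := @Cfun_near f x _ e1; apply: filterS => y /= xy.
rewrite -cabsE eE ltcR.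
have -> : l x - l y = - (f x - l x) + (f x - f y) + (f y - l y) by ring.
apply: le_lt_trans (cabsD _ _) _; apply: le_lt_trans (lerD (cabsD _ _) (lexx _)) _.
have -> : complex.Re e = complex.Re e / 3 + complex.Re e / 3 + complex.Re e / 3 by lra.
by rewrite {1}/cabs normrN -/(cabs _) !ltrD.
Qed.

Let filter_lim_le (F : set_system R) (FF : ProperFilter F) (a e L : R) :
  F --> L -> F [set r | `|a - r| < e] -> `|a - L| <= e.
Proof.
move=> FL Fa; apply/ler_addgt0Pr => d d0.
have FLd : F [set r | `|L - r| < d].
  exact: (cvgr_dist_lt _ _ FL _ d0).
have [r [/= ar Lr]] := filter_ex (filterI Fa FLd).
have -> : a - L = (a - r) - (L - r) by ring.
by apply: le_trans (ler_normB _ _) _; apply: lerD; apply: ltW.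
Qed.

Fact Cfun_complete (F : set_system (normed_space Cfun)) :
  ProperFilter F -> cauchy F -> cvg F.
Proof.
move=> FF /cauchyP Fc.
have Fe (e : R) : 0 < e -> exists f0 : Cfun, F [set f | cnorm (f0 - (f : Cfun)) < e].
  move=> e0; have [|f0 Ff0] := Fc e%:C; first by rewrite ltcR.
  exists f0; apply: filterS Ff0 => f; rewrite -ball_normE /=.
  by rewrite ltcR.
have Fx e f0 x : F [set f | cnorm (f0 - (f : Cfun)) < e] ->
    F [set f | cabs (f0 x - (f : Cfun) x) < e].
  apply: filterS => f /=; apply: le_lt_trans; rewrite -CfunB; exact: Cnorm_ge.
(* Pointwise limits are taken for real and imaginary parts separately, by completeness of R. *)
pose part (p : R[i] -> R) x (f : normed_space Cfun) := p ((f : Cfun) x).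
have lim (p : R[i] -> R) x : (forall z w, p (z - w) = p z - p w) ->
    (forall z, `|p z| <= cabs z) -> cvg (part p x @ F).
  move=> pB ple; apply: cauchy_cvg; apply: cauchy_exP => e e0.
  have [f0 /(Fx _ _ x) Ff0] := Fe e e0.
  exists (p (f0 x)); change (F [set f | ball (p (f0 x)) e (part p x f)]).
  apply: filterS Ff0 => f /= xf.
  rewrite -ball_normE /= /part -pB; apply: le_lt_trans xf; exact: ple.
have limRe x := lim _ x (fun z w => raddfB (@complex.Re R) z w) cabs_ge_Re.
have limIm x := lim _ x (fun z w => raddfB (@complex.Im R) z w) cabs_ge_Im.
have [lr lrP] := choice (fun x => (cvg_ex _).1 (limRe x)).
have [li liP] := choice (fun x => (cvg_ex _).1 (limIm x)).
pose l x : R[i]^o := (lr x)%:C + 'i%C * (li x)%:C.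
have Rel x : complex.Re (l x) = lr x.
  by rewrite /l /=; ring.
have Iml x : complex.Im (l x) = li x.
  by rewrite /l /=; ring.
(* Each of the two parts contributes e; hence the fractions e / 3 and e / 4 below. *)
have close (e : R) f0 x : F [set f | cnorm (f0 - (f : Cfun)) < e] ->
    cabs (f0 x - l x) <= e + e.
  move=> /(Fx _ _ x) Ff0; apply: le_trans (cabs_le_ReIm _) _.
  rewrite ReB ImB Rel Iml; apply: lerD.
    apply: (filter_lim_le _ (lrP x)).
    change (F [set f | `|complex.Re (f0 x) - complex.Re ((f : Cfun) x)| < e]).
    apply: filterS Ff0 => f /=; apply: le_lt_trans; rewrite -ReB.
    exact: cabs_ge_Re.
  apply: (filter_lim_le _ (liP x)).
  change (F [set f | `|complex.Im (f0 x) - complex.Im ((f : Cfun) x)| < e]).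
  apply: filterS Ff0 => f /=; apply: le_lt_trans; rewrite -ImB.
  exact: cabs_ge_Im.
have cl : continuous l.
  apply: Cfun_uniform_limit => e e0.
  have e1 : 0 < e / 3 by rewrite divr_gt0.
  have [f0 Ff0] := Fe _ e1; exists f0 => x.
  by apply: le_lt_trans (close _ _ x Ff0) _; lra.
pose L : Cfun := Contfun cl.
apply/cvg_ex; exists (L : normed_space Cfun).
apply/cvgrPdist_lt => e e0.
have eE : e = (complex.Re e)%:C by apply/esym/RRe_real/gtr0_real.
have e1 : 0 < complex.Re e / 4 by rewrite divr_gt0 // -ltcR -eE.
have [f0 Ff0] := Fe _ e1.
have Lf0 : cnorm (L - f0) <= complex.Re e / 4 + complex.Re e / 4.
  rewrite cnormB; apply: Cnorm_le => x; exact: close.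
apply: filterS Ff0 => f /= ff0; rewrite eE ltcR.
apply: le_lt_trans (cnorm_distD _ f0 _) _.
by apply: le_lt_trans (lerD Lf0 (ltW ff0)) _; lra.
Qed.

HB.instance Definition _ := isCstarComplete.Build R Cfun Cfun_complete.

End ContinuousFunctions.

(** * The Stone-Weierstrass theorem *)

Section StoneWeierstrass.
Variables (R : realType) (X : compactSpace).
Local Notation CX := (Cfun R X).
Implicit Types (f g h : CX) (x y : X).

Definition rfun f x : R := complex.Re (f x).

Lemma rfunE f x : is_sa f -> f x = (rfun f x)%:C.
Proof.
move=> sf; rewrite /rfun RRe_real //; apply/CrealP.
by rewrite -[in RHS]sf Cfun_star.
Qed.

Lemma sa_rfun f : (forall x, f x = (rfun f x)%:C) -> is_sa f.
Proof.
move=> fE; apply: CfunP => x; rewrite Cfun_star fE.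
exact: conjc_real.
Qed.

Lemma rfunN f x : rfun (- f) x = - rfun f x.
Proof. by rewrite /rfun CfunN raddfN. Qed.

Lemma rfun_near f x (e : R) : 0 < e -> nbhs x [set y | `|rfun f x - rfun f y| < e].
Proof.
move=> /(Cfun_near f x); apply: filterS => y /=; apply: le_lt_trans.
by rewrite -raddfB; exact: cabs_ge_Re.
Qed.

Variable S : set CX.
Hypotheses (Ssub : is_cstar_subalg S) (S1 : S 1).
Hypothesis Ssep : forall x y, x <> y -> exists2 f, S f & f x <> f y.

Let SL c f g : S f -> S g -> S (c *: f + g). Proof. by case: Ssub => _ _ h _ _; apply: h. Qed.
Let S0 : S 0. Proof. by case: Ssub. Qed.
Let SM f g : S f -> S g -> S (f * g). Proof. by case: Ssub => _ _ _ h _; apply: h. Qed.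
Let Sstar f : S f -> S (star f). Proof. by case: Ssub => _ _ _ _; apply. Qed.
Let SZ c f : S f -> S (c *: f). Proof. by move=> Sf; rewrite -[_ *: _]addr0; apply: SL. Qed.
Let SD f g : S f -> S g -> S (f + g).
Proof. by move=> Sf Sg; rewrite -[f]scale1r; apply: SL. Qed.
Let SB f g : S f -> S g -> S (f - g).
Proof. by move=> Sf Sg; rewrite -scaleN1r addrC; apply: SL. Qed.
Let Sclosed f : (forall e : R, 0 < e -> exists2 g, S g & cnorm (f - g) < e) -> S f.
Proof. by move=> fS; case: Ssub => cS _ _ _ _; apply: cS; apply/cnorm_closureP. Qed.

Lemma cabs_continuous f : continuous (fun x => (cabs (f x))%:C : R[i]^o).
Proof.
move=> x; apply/cvgrPdist_lt => e e0.
have eE : e = (complex.Re e)%:C by apply/esym/RRe_real/gtr0_real.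
have e1 : 0 < complex.Re e by rewrite -ltcR -eE.
have := @Cfun_near _ _ f x _ e1; apply: filterS => y /= xy.
rewrite !cabsE eE; apply: le_lt_trans (ler_dist_dist _ _) _.
by rewrite -cabsE ltcR.
Qed.

Definition Cabs f : CX := Contfun (@cabs_continuous f).

Lemma CabsE f x : Cabs f x = (cabs (f x))%:C. Proof. by []. Qed.

(** The modulus is within d of the square root of f^2 + d^2. Divided by M this radicand becomes b,
    with values between d^2 / M and 1, so 1 - b has norm below 1 and [cstar_sqrt] finds the root 1 -
    w of b inside S. *)
Lemma Cabs_mem f : S f -> is_sa f -> S (Cabs f).
Proof.
move=> Sf sf; apply: Sclosed => e e0.
pose d := e / 2; have d0 : 0 < d by rewrite divr_gt0.
pose M := cnorm f ^+ 2 + d ^+ 2 + 1.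
have M0 : 0 < M by rewrite ltr_wpDl ?ltr01 // addr_ge0 ?sqr_ge0.
pose b : CX := (M^-1)%:C *: (f * f + (d ^+ 2)%:C *: 1).
have bE x : b x = (M^-1 * (rfun f x ^+ 2 + d ^+ 2))%:C.
  rewrite /b CfunZ CfunD CfunM CfunZ Cfun1 mulr1 (rfunE _ sf).
  by rewrite -expr2 -!rmorphXn -rmorphD -rmorphM.
have oneC : (1 : R[i]) = (1 : R)%:C by [].
have sb : is_sa b by apply: sa_rfun => x; rewrite /rfun bE.
have cfE x : cabs (f x) = `|rfun f x| by rewrite {1}(rfunE _ sf) cabs_real.
have bM x : rfun f x ^+ 2 + d ^+ 2 <= M.
  rewrite /M -addrA lerD //; last by rewrite lerDl.
  rewrite -[leLHS]real_normK ?num_real // -cfE lerXn2r ?nnegrE ?cabs_ge0 ?cnorm_ge0 //.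
  exact: Cnorm_ge.
have d2 : 0 < d ^+ 2 by rewrite exprn_gt0.
have [|||w [Sw sw w1] wE] := @cstar_sqrt R _ S (1 - b) Ssub.
- by apply: SB => //; apply: SZ; apply: SD; [exact: SM|exact: SZ].
- by rewrite /is_sa starD starN star1 sb.
- apply: (@le_lt_trans _ _ (1 - M^-1 * d ^+ 2)); last first.
    by rewrite ltrBlDr ltrDl mulr_gt0 // invr_gt0.
  apply: Cnorm_le => x; rewrite CfunB Cfun1 bE oneC -rmorphB /= cabs_real.
  rewrite ger0_norm; last by rewrite subr_ge0 ler_pdivrMl // mulr1.
  by rewrite lerD2l lerN2 ler_pM2l ?invr_gt0 // lerDr sqr_ge0.
rewrite subKr in wE.
(* This makes 1 - w the positive root, so that [V] below is the square root of f^2 + d^2 at x. *)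
have w1x x : rfun w x < 1.
  apply: le_lt_trans w1; apply: le_trans (Cnorm_ge w x).
  exact: le_trans (ler_norm _) (cabs_ge_Re _).
have SqM : 0 < Num.sqrt M by rewrite sqrtr_gt0.
exists ((Num.sqrt M)%:C *: (1 - w)).
  by apply: SZ; apply: SB.
apply: le_lt_trans (_ : d < e); last by rewrite /d; lra.
apply: Cnorm_le => x; rewrite CfunB CabsE CfunZ CfunB Cfun1 (rfunE x sw).
rewrite oneC -rmorphB -rmorphM -rmorphB cabs_real /=.
have := congr1 (fun g : CX => g x) wE.
rewrite CfunM CfunB Cfun1 bE (rfunE x sw).
rewrite oneC -rmorphB -rmorphM => /complexI e1.
set V := Num.sqrt M * (1 - rfun w x).
have V0 : 0 < V by rewrite mulr_gt0 // subr_gt0.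
have V2 : V ^+ 2 = cabs (f x) ^+ 2 + d ^+ 2.
  rewrite /V exprMn sqr_sqrtr ?(ltW M0) // expr2 e1 mulrA divff ?gt_eqF // mul1r.
  by rewrite cfE real_normK ?num_real.
have T0 := cabs_ge0 (f x).
by rewrite ler_norml; apply/andP; split; nra.
Qed.

Let half_sum f g h : S f -> S g -> S h -> S ((2^-1 : R)%:C *: (f + g + h)).
Proof. by move=> Sf Sg Sh; apply: SZ; apply: SD => //; apply: SD. Qed.

Definition real_part_of : set CX := [set f | S f /\ is_sa f].

Lemma real_part_max f g : real_part_of f -> real_part_of g ->
  exists2 h, real_part_of h & forall x, rfun h x = Num.max (rfun f x) (rfun g x).
Proof.
move=> [Sf sf] [Sg sg].
have sfg : is_sa (f - g) by rewrite /is_sa starD starN sf sg.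
have Sabs := Cabs_mem (SB Sf Sg) sfg.
pose h : CX := (2^-1 : R)%:C *: (f + g + Cabs (f - g)).
have hE x : h x = (Num.max (rfun f x) (rfun g x))%:C.
  rewrite /h CfunZ !CfunD CabsE CfunB (rfunE x sf) (rfunE x sg).
  rewrite -rmorphB cabs_real -!rmorphD -rmorphM; congr _%:C => /=.
  by have := maxr_absE (rfun f x) (rfun g x) => ->; rewrite mulrC.
exists h; last by move=> x; rewrite {1}/rfun hE.
split; first exact: half_sum.
by apply: sa_rfun => x; rewrite /rfun hE.
Qed.

Lemma real_partN f : real_part_of f -> real_part_of (- f).
Proof.
move=> [Sf sf]; split; last by rewrite /is_sa starN sf.
by rewrite -[- f]add0r; apply: SB.
Qed.

Lemma real_part_min f g : real_part_of f -> real_part_of g ->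
  exists2 h, real_part_of h & forall x, rfun h x = Num.min (rfun f x) (rfun g x).
Proof.
move=> /real_partN rf /real_partN rg; have [h /real_partN rh hE] := real_part_max rf rg.
by exists (- h) => // x; rewrite rfunN hE !rfunN oppr_max !opprK.
Qed.

(** A constant covers equal points, which is why the premise has this form; for distinct points an
    affine image of a separating element interpolates. *)
Lemma real_part_interp x y (a b : R) : (x = y -> a = b) ->
  exists2 f, real_part_of f & rfun f x = a /\ rfun f y = b.
Proof.
have cst (c : R) : real_part_of (c%:C *: 1).
  split; first exact: SZ.
  by rewrite /is_sa starZr star1.
have cstE (c : R) z : rfun (c%:C *: 1) z = c by rewrite /rfun CfunZ Cfun1 mulr1.
have [->|xy] := pselect (x = y).
  by move=> /(_ erefl) ->; exists (b%:C *: 1); rewrite // cstE.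
move=> _.
(* The real or the imaginary part of a separating element already separates. *)
have [g [Sg sg] gxy] : exists2 g, real_part_of g & rfun g x != rfun g y.
  have [f Sf fxy] := Ssep xy.
  have rp : real_part_of (rpart f).
    split; last exact: rpart_sa.
    by apply: SZ; apply: SD => //; apply: Sstar.
  have ip : real_part_of (ipart f).
    split; last exact: ipart_sa.
    by apply: SZ; apply: SB => //; apply: Sstar.
  have [|rxy] := eqVneq (rfun (rpart f) x) (rfun (rpart f) y); last by exists (rpart f).
  move=> rE; have [|rxy] := eqVneq (rfun (ipart f) x) (rfun (ipart f) y); last by exists (ipart f).
  move=> iE; exfalso; apply: fxy; rewrite [f]cart_decomp !CfunD !(CfunZ _ (ipart f)).
  by rewrite !(rfunE _ rp.2) !(rfunE _ ip.2) rE iE.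
pose k := (b - a) / (rfun g y - rfun g x).
have gxy' : rfun g y - rfun g x != 0 by rewrite subr_eq0 eq_sym.
have hE z : (k%:C *: g + (a - k * rfun g x)%:C *: 1 : CX) z =
    (k * rfun g z + (a - k * rfun g x))%:C.
  by rewrite CfunD !CfunZ Cfun1 mulr1 (rfunE z sg) -rmorphM -rmorphD.
exists (k%:C *: g + (a - k * rfun g x)%:C *: 1).
  split; first by apply: SL => //; apply: SZ.
  by apply: sa_rfun => z; rewrite /rfun hE.
split; rewrite {1}/rfun hE /=; first by rewrite addrCA subrr addr0.
have -> : k * rfun g y + (a - k * rfun g x) = a + k * (rfun g y - rfun g x) by ring.
by rewrite /k divfK // addrC subrK.
Qed.

Lemma one_sided_approx f x (e : R) : 0 < e ->
  exists2 g, real_part_of g & rfun g x = rfun f x /\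
    forall z, rfun g z < rfun f z + e.
Proof.
(* [Lx] is directed downwards; compactness along the filter [F] of its tails
   replaces the minimum over a finite subcover. *)
move=> e0; pose Lx := [set g | real_part_of g /\ rfun g x = rfun f x].
pose F (P : set CX) := exists2 g0, Lx g0 &
  forall g, Lx g -> (forall z, rfun g z <= rfun g0 z) -> P g.
have interp y : exists2 g, Lx g & rfun g y = rfun f y.
  have [|g rg [gx gy]] := @real_part_interp x y (rfun f x) (rfun f y).
    by move=> ->.
  by exists g.
have FF : Filter F.
  split.
  - by have [g Lg _] := interp x; exists g.
  - move=> P Q [g0 [r0 x0] hP] [g1 [r1 x1] hQ].
    have [g2 r2 g2E] := real_part_min r0 r1.
    exists g2; first by split=> //; rewrite g2E x0 x1 minxx.
    by move=> g Lg gg2; split; [apply: hP|apply: hQ] => // z;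
      apply: le_trans (gg2 z) _; rewrite g2E ge_min lexx ?orbT.
  - move=> P Q PQ [g0 L0 hP]; exists g0 => // g Lg gg0; apply: PQ.
    exact: hP.
have := @compact_near_forall X CX F
  (fun g z => rfun g z < rfun f z + e) (@cs_compact X) FF.
case=> [y|g0 L0 hg0]; last first.
  by exists g0; [case: L0|split; [case: L0|apply: hg0]].
have [g0 L0 g0y] := interp y.
have e2 : 0 < e / 2 by rewrite divr_gt0.
exists ([set z | `|rfun g0 y - rfun g0 z| < e / 2] `&`
        [set z | `|rfun f y - rfun f z| < e / 2]).
  by apply: filterI; apply: rfun_near.
exists g0 => // g Lg gg0 z [/= h1 h2]; apply: le_lt_trans (gg0 z) _.
by move: h1 h2; rewrite g0y !ltr_norml => /andP[h1 _] /andP[_ h2]; lra.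
Qed.

(** The second half of the lattice argument, dual to [one_sided_approx]: the self-adjoint elements
    of S below f + e are directed upwards, and for each point one of them agrees with f there. *)
Lemma stone_weierstrass f : S f.
Proof.
suff saS g : is_sa g -> S g.
  rewrite [f]cart_decomp; apply: SD; first by apply: saS; apply: rpart_sa.
  by apply: SZ; apply: saS; apply: ipart_sa.
move=> {f}; move: g => f sf; apply: Sclosed => e' e'0.
pose e := e' / 2; have e0 : 0 < e by rewrite divr_gt0.
pose Lf := [set g | real_part_of g /\ forall z, rfun g z < rfun f z + e].
pose F (P : set CX) := exists2 g0, Lf g0 &
  forall g, Lf g -> (forall z, rfun g0 z <= rfun g z) -> P g.
have app y : exists2 g, Lf g & rfun g y = rfun f y.
  by have [g rg [gx gf]] := one_sided_approx f y e0; exists g.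
have FF : Filter F.
  split.
  - by have [g Lg _] := app (cs_point X); exists g.
  - move=> P Q [g0 [r0 l0] hP] [g1 [r1 l1] hQ].
    have [g2 r2 g2E] := real_part_max r0 r1.
    exists g2; first by split=> // z; rewrite g2E gt_max l0 l1.
    by move=> g Lg gg2; split; [apply: hP|apply: hQ] => // z;
      apply: le_trans (gg2 z); rewrite g2E le_max lexx ?orbT.
  - move=> P Q PQ [g0 L0 hP]; exists g0 => // g Lg gg0; apply: PQ.
    exact: hP.
have := @compact_near_forall X CX F
  (fun g z => rfun f z - e < rfun g z) (@cs_compact X) FF.
case=> [y|g0 L0 hg0].
  have [g0 L0 g0y] := app y.
  have e2 : 0 < e / 2 by rewrite divr_gt0.
  exists ([set z | `|rfun g0 y - rfun g0 z| < e / 2] `&`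
          [set z | `|rfun f y - rfun f z| < e / 2]).
    by apply: filterI; apply: rfun_near.
  exists g0 => // g Lg gg0 z [/= h1 h2]; apply: lt_le_trans (gg0 z).
  by move: h1 h2; rewrite g0y !ltr_norml => /andP[_ h1] /andP[h2 _]; lra.
have [[S0' s0] l0] := L0; exists g0 => //.
apply: (@le_lt_trans _ _ e); last by rewrite /e; lra.
apply: Cnorm_le => z; rewrite CfunB (rfunE z sf) (rfunE z s0) -rmorphB cabs_real.
rewrite ler_norml; apply/andP; split=> /=.
  by have := l0 z; lra.
by have := hg0 g0 L0 (fun z => lexx _) z; lra.
Qed.

End StoneWeierstrass.

(** * Closures and linear spans of subalgebras *)

Section Closure.
Variables (R : realType) (A : cstarAlgType R).

Lemma closure_cstar_subalg (B : set A) :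
  B 0 -> (forall c x y, B x -> B y -> B (c *: x + y)) ->
  (forall x y, B x -> B y -> B (x * y)) -> (forall x, B x -> B (star x)) ->
  is_cstar_subalg (closure (B : set (normed_space A)) : set A).
Proof.
move=> B0 BL BM Bs; split.
- exact: closed_closure.
- by apply/cnorm_closureP => e e0; exists 0 => //; rewrite subr0 cnorm0.
- move=> c x y /cnorm_closureP cx /cnorm_closureP cy.
  apply/cnorm_closureP => e e0; pose M := cabs c + 1.
  have M0 : 0 < M by rewrite ltr_wpDl ?cabs_ge0.
  have [|x' Bx' xx'] := cx (e / 2 / M); first by rewrite !divr_gt0.
  have [|y' By' yy'] := cy (e / 2); first by rewrite divr_gt0.
  exists (c *: x' + y'); first exact: BL.
  rewrite opprD addrACA -scalerBr; apply: le_lt_trans (cnormD _ _) _.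
  rewrite [e]splitr; apply: ler_ltD => //.
  have -> : cnorm (c *: (x - x')) = cabs c * cnorm (x - x').
    by apply: complexI; rewrite cnormZ -cabsE rmorphM.
  rewrite ltr_pdivlMr // in xx'.
  apply: le_trans (ltW xx'); rewrite mulrC ler_wpM2l ?cnorm_ge0 //.
  by rewrite /M lerDl.
- move=> x y /cnorm_closureP cx /cnorm_closureP cy.
  apply/cnorm_closureP => e e0.
  pose M := cnorm y + 1; have M0 : 0 < M by rewrite ltr_wpDl ?cnorm_ge0.
  have [|x' Bx' xx'] := cx (e / 2 / M); first by rewrite !divr_gt0.
  pose N := cnorm x' + 1; have N0 : 0 < N by rewrite ltr_wpDl ?cnorm_ge0.
  have [|y' By' yy'] := cy (e / 2 / N); first by rewrite !divr_gt0.
  exists (x' * y'); first exact: BM.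
  have -> : x * y - x' * y' = (x - x') * y + x' * (y - y').
    by rewrite mulrBl mulrBr addrA subrK.
  apply: le_lt_trans (cnormD _ _) _; rewrite [e]splitr.
  rewrite ltr_pdivlMr // in xx'; rewrite ltr_pdivlMr // in yy'.
  apply: ler_ltD.
    apply: le_trans (cnormM _ _) _; apply: le_trans (ltW xx').
    by rewrite ler_wpM2l ?cnorm_ge0 // lerDl.
  apply: le_lt_trans (cnormM _ _) _; apply: le_lt_trans yy'.
  by rewrite mulrC ler_wpM2l ?cnorm_ge0 // lerDl.
- move=> x /cnorm_closureP cx; apply/cnorm_closureP => e /cx[y By xy].
  by exists (star y); [exact: Bs|rewrite -starN -starD cnorm_star].
Qed.

Lemma lin_span_mem (S : set A) x : S x -> lin_span S x.
Proof.
by move=> Sx; exists 1%N, (fun=> 1), (fun=> x); rewrite big_ord1 scale1r.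
Qed.

Lemma lin_span0 (S : set A) : lin_span S 0.
Proof. by exists 0%N, (fun=> 0), (fun=> 0); split=> [[]|] //; rewrite big_ord0. Qed.

Lemma lin_spanD (S : set A) x y : lin_span S x -> lin_span S y -> lin_span S (x + y).
Proof.
move=> [n [c [v [Sv ->]]]] [m [d [w [Sw ->]]]].
exists (n + m)%N, (fun i : 'I_(n + m) => match fintype.split i with inl j => c j | inr j => d j end),
  (fun i : 'I_(n + m) => match fintype.split i with inl j => v j | inr j => w j end).
split=> [i|]; first by case: fintype.split.
rewrite big_split_ord /=; congr (_ + _); apply: eq_bigr => i _.
  by rewrite (unsplitK (inl _ i)).
by rewrite (unsplitK (inr _ i)).
Qed.

Lemma lin_spanZ (S : set A) c x : lin_span S x -> lin_span S (c *: x).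
Proof.
move=> [n [d [v [Sv ->]]]]; exists n, (fun i => c * d i), v; split=> //.
by rewrite scaler_sumr; apply: eq_bigr => i _; rewrite scalerA.
Qed.

Lemma lin_span_sum (S : set A) (I : Type) (r : seq I) (F : I -> A) :
  (forall i, lin_span S (F i)) -> lin_span S (\sum_(i <- r) F i).
Proof.
by move=> SF; elim/big_ind: _ => // [|x y]; [exact: lin_span0|exact: lin_spanD].
Qed.

Lemma lin_spanM (S : set A) : (forall x y, S x -> S y -> S (x * y)) ->
  forall x y, lin_span S x -> lin_span S y -> lin_span S (x * y).
Proof.
move=> SM x y [n [c [v [Sv ->]]]] [m [d [w [Sw ->]]]].
rewrite mulr_suml; apply: lin_span_sum => i.
rewrite mulr_sumr; apply: lin_span_sum => j.
rewrite -scalerAl -scalerAr; do 2! apply: lin_spanZ.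
by apply: lin_span_mem; apply: SM.
Qed.

Lemma lin_span_star (S : set A) : (forall x, S x -> S (star x)) ->
  forall x, lin_span S x -> lin_span S (star x).
Proof.
move=> Ss x [n [c [v [Sv ->]]]]; rewrite star_sum; apply: lin_span_sum => i.
by rewrite starZ; apply: lin_spanZ; apply: lin_span_mem; apply: Ss.
Qed.

End Closure.

(** * Pullbacks and dense subalgebras of functions *)

Section Pullback.
Variable R : realType.

Lemma Cpull_subproof (X Y : compactSpace) (p : X -> Y) (pc : continuous p)
  (f : Cfun R Y) : continuous (fun x => f (p x) : R[i]^o).
Proof.
by move=> x; apply: continuous_comp; [exact: pc|exact: contfun_continuous].
Qed.

Definition Cpull (X Y : compactSpace) (p : X -> Y) (pc : continuous p)
  (f : Cfun R Y) : Cfun R X := Contfun (@Cpull_subproof X Y p pc f).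

Lemma CpullE (X Y : compactSpace) (p : X -> Y) (pc : continuous p) f x :
  Cpull pc f x = f (p x).
Proof. by []. Qed.

Lemma Cpull_hom (X Y : compactSpace) (p : X -> Y) (pc : continuous p) :
  is_star_hom (alg_star (Cfun R Y)) (alg_star (Cfun R X)) (Cpull pc).
Proof. by split=> [c f g||f g|f]; apply: CfunP => x. Qed.

(* A unital *-subalgebra generated by the ranges of two homomorphisms is dense
   as soon as these ranges jointly separate the points. *)
Lemma dense_prod (X Y T : compactSpace) (u : Cfun R X -> Cfun R T)
    (v : Cfun R Y -> Cfun R T) :
  is_star_hom (alg_star (Cfun R X)) (alg_star (Cfun R T)) u ->
  is_star_hom (alg_star (Cfun R Y)) (alg_star (Cfun R T)) v ->
  (forall t t', t <> t' -> (exists f, u f t <> u f t') \/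
                           (exists g, v g t <> v g t')) ->
  closure (lin_span [set u f * v g | f in setT & g in setT]
    : set (normed_space (Cfun R T))) = setT.
Proof.
move=> [uL u1 uM us] [vL v1 vM vs] sep.
set S := [set u f * v g | f in setT & g in setT].
have Suv f g : S (u f * v g) by exists f => //; exists g.
apply/seteqP; split=> // f _.
have sub : is_cstar_subalg (closure (lin_span S : set (normed_space (Cfun R T)))
    : set (Cfun R T)).
  apply: closure_cstar_subalg.
  - exact: lin_span0.
  - by move=> c x y Sx Sy; apply: lin_spanD => //; apply: lin_spanZ.
  - apply: lin_spanM => _ _ [f1 _ [g1 _ <-]] [f2 _ [g2 _ <-]].
    have -> : u f1 * v g1 * (u f2 * v g2) = u (f1 * f2) * v (g2 * g1).
      have -> : u (f1 * f2) = u f1 * u f2 by exact: uM.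
      have -> : v (g2 * g1) = v g2 * v g1 by exact: vM.
      by rewrite -!mulrA [v g1 * _]Cfun_comm -!mulrA.
    exact: Suv.
  - apply: lin_span_star => _ [f1 _ [g1 _ <-]]; rewrite starM Cfun_comm.
    have -> : star (u f1) = u (star f1) by exact: (esym (us f1)).
    have -> : star (v g1) = v (star g1) by exact: (esym (vs g1)).
    exact: Suv.
have inS g : S g -> closure (lin_span S : set (normed_space (Cfun R T))) g.
  by move=> Sg; apply: subset_closure; apply: lin_span_mem.
have u1' : u 1 = 1 by exact: u1.
have v1' : v 1 = 1 by exact: v1.
apply: (stone_weierstrass sub).
- by apply: inS; have := Suv 1 1; rewrite u1' v1' mulr1.
- move=> t t' /sep[[g gt]|[g gt]].
    by exists (u g * v 1); [exact: inS|rewrite v1' mulr1].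
  by exists (u 1 * v g); [exact: inS|rewrite u1' mul1r].
Qed.

End Pullback.

(** * States on function algebras *)

Section States.
Variables (R : realType) (X : compactSpace).
Local Notation CX := (Cfun R X).
Implicit Types f g : CX.

(** For e > 0, f + e is the square of a self-adjoint function: with M the norm of f, the function M
    - f has norm at most M, and f + e = (M + e) - (M - f). So phi is nonnegative at f + e, for every
    e > 0. *)
Lemma state_ge0 (phi : CX -> R[i]) f : is_state phi ->
  (forall x, 0 <= f x) -> 0 <= phi f.
Proof.
move=> [phiL phip phi1] f0.
have sf : is_sa f.
  by apply: sa_rfun => x; rewrite /rfun RRe_real //; apply: ger0_real.
suff le (e : R) : 0 < e -> 0 <= phi f + e%:C.
  have ReE (e : R) : complex.Re (phi f + e%:C) = complex.Re (phi f) + e.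
    by case: (phi f).
  have ImE (e : R) : complex.Im (phi f + e%:C) = complex.Im (phi f).
    by case: (phi f) => r s /=; rewrite addr0.
  rewrite lecE; apply/andP; split.
    by have := le 1 ltr01; rewrite lecE ImE => /andP[].
  apply/ler_addgt0Pr => e /le.
  by rewrite lecE ReE => /andP[].
move=> e0; pose M := cnorm f; pose b : CX := M%:C *: 1 - f.
have [||v sv ve] := @cstar_sqrtr _ CX b (M + e).
- by rewrite /is_sa /b starD starN starZr star1 sf.
- apply: le_lt_trans (_ : M < _); last by rewrite ltrDl.
  apply: Cnorm_le => x; rewrite CfunB CfunZ Cfun1 mulr1 (rfunE x sf) -rmorphB cabs_real /=.
  have fx : 0 <= rfun f x by rewrite -lecR -rfunE.
  have fM : rfun f x <= M.
    apply: le_trans (Cnorm_ge f x); exact: le_trans (ler_norm _) (cabs_ge_Re _).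
  by rewrite ger0_norm ?subr_ge0 // gerBl.
have := phip v; rewrite sv ve.
have -> : (M + e)%:C *: 1 - b = e%:C *: 1 + f.
  by rewrite /b rmorphD scalerDl opprB [LHS]addrC addrA subrK addrC.
by rewrite phiL phi1 addrC => h; apply: le_trans h _; rewrite [X in _ + X]mulr1.
Qed.

Lemma eval_state (x : X) : is_state (fun f : CX => f x).
Proof.
split=> // f; rewrite CfunM Cfun_star mulrC; exact: mul_conjC_ge0.
Qed.

End States.

(** * The minimal tensor product of function algebras *)

Section MinTensor.
Variables (R : realType) (X Y T : compactSpace).
Variables (p : T -> X) (q : T -> Y) (pc : continuous p) (qc : continuous q).
Hypothesis pq_surj : forall x y, exists2 t, p t = x & q t = y.
Local Notation CX := (Cfun R X).
Local Notation CY := (Cfun R Y).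
Local Notation CT := (Cfun R T).

(** The legs p and q are maps on T rather than the projections of a product, so that one threefold
    product can be split in both ways and associativity is an equality of functions on it. *)
Definition Ctens (f : CX) (g : CY) : CT := Cpull pc f * Cpull qc g.

Lemma CtensE f g t : Ctens f g t = f (p t) * g (q t).
Proof. by []. Qed.

Let ft := formal_tensor CX CY.
Let real_of (z : ft) : CT := \sum_(u <- z) Ctens u.1 u.2.

Let Cfun_sum (I : Type) (r : seq I) (F : I -> CT) t :
  (\sum_(i <- r) F i : CT) t = \sum_(i <- r) F i t.
Proof. by elim/big_rec2: _ => // i x f _ <-. Qed.

Let Cfun_sumX (I : Type) (r : seq I) (F : I -> CX) t :
  (\sum_(i <- r) F i : CX) t = \sum_(i <- r) F i t.
Proof. by elim/big_rec2: _ => // i x f _ <-. Qed.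

Let Cfun_sumY (I : Type) (r : seq I) (F : I -> CY) t :
  (\sum_(i <- r) F i : CY) t = \sum_(i <- r) F i t.
Proof. by elim/big_rec2: _ => // i x f _ <-. Qed.

Let real_ofM x y : real_of (ft_mul x y) = real_of x * real_of y.
Proof.
rewrite /real_of /ft_mul big_allpairs_dep mulr_suml; apply: eq_bigr => u _.
rewrite mulr_sumr; apply: eq_bigr => w _ /=.
by apply: CfunP => t; rewrite CfunM !CtensE !CfunM mulrACA.
Qed.

Let real_of_star x : real_of (ft_star x) = star (real_of x).
Proof.
rewrite /real_of /ft_star big_map star_sum; apply: eq_bigr => u _.
by apply: CfunP => t; rewrite Cfun_star !CtensE !Cfun_star rmorphM.
Qed.

(* Integrate first over Y, then over X. *)
Let ft_eval_le (phi : CX -> R[i]) (psi : CY -> R[i]) (c : R[i]) (z z' : ft) :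
  is_state phi -> is_state psi ->
  (forall t, 0 <= c * real_of z' t - real_of z t) ->
  0 <= c * ft_eval phi psi z' - ft_eval phi psi z.
Proof.
move=> sphi spsi zz'; have [phiL _ _] := sphi; have [psiL _ _] := spsi.
have lphi : linear (phi : CX -> R[i]^o) by exact: phiL.
have lpsi : linear (psi : CY -> R[i]^o) by exact: psiL.
pose g (w : ft) : CX := \sum_(u <- w) psi u.2 *: u.1.
have gE w : ft_eval phi psi w = phi (g w).
  rewrite /g (big_morph phi (linD lphi) (lin0 lphi)); apply: eq_bigr => u _.
  by rewrite (linZ lphi) mulrC.
pose k x (w : ft) : CY := \sum_(u <- w) u.1 x *: u.2.
have kE x w : g w x = psi (k x w).
  rewrite /g /k (big_morph psi (linD lpsi) (lin0 lpsi)) Cfun_sumX.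
  by apply: eq_bigr => u _; rewrite (linZ lpsi) CfunZ mulrC.
have lin_sub (W : lmodType R[i]) (f : W -> R[i]) : linear (f : W -> R[i]^o) ->
    forall a b, c * f a - f b = f (c *: a - b).
  move=> lf a b; rewrite -[- b]scaleN1r (linD lf) !(linZ lf).
  by congr (_ + _); apply/esym/mulN1r.
rewrite !gE (lin_sub _ phi lphi); apply: state_ge0 => // x.
rewrite CfunB CfunZ !kE (lin_sub _ psi lpsi); apply: state_ge0 => // y.
have [t pt qt] := pq_surj x y.
have e w : real_of w t = k x w y.
  rewrite /real_of /k Cfun_sum Cfun_sumY; apply: eq_bigr => u _.
  by rewrite CtensE CfunZ pt qt.
by have := zz' t; rewrite !e CfunB CfunZ.
Qed.

(** Product states stay below the supremum norm because they are monotone; the evaluations at p t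
    and q t, tested on 1 ⊗ 1, attain the modulus of x at t. *)
Lemma Ctens_norm (x : ft) : (cnorm (real_of x))%:E = min_norm x.
Proof.
apply/eqP; rewrite eq_le; apply/andP; split; last first.
  apply: ge_ereal_sup => _ [phi [psi [y [sphi spsi y0 ->]]]].
  pose ev (z : ft) := complex.Re (ft_eval phi psi (ft_mul (ft_star z) z)).
  change (is_true (ev y != 0)) in y0.
  change ((Num.sqrt (ev (ft_mul x y) / ev y))%:E <= (cnorm (real_of x))%:E)%E.
  have sqE (w : ft) t : real_of (ft_mul (ft_star w) w) t = (cabs (real_of w t) ^+ 2)%:C.
    by rewrite real_ofM real_of_star CfunM Cfun_star mulrC -normCK rmorphXn /= cabsE.
  have evp z : 0 <= ft_eval phi psi (ft_mul (ft_star z) z).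
    (* Positivity is the comparison with the empty tensor, which stands for 0. *)
    have := @ft_eval_le phi psi 1 [::] (ft_mul (ft_star z) z) sphi spsi.
    rewrite {2}/ft_eval big_nil subr0 mul1r; apply => t.
    by rewrite mul1r /real_of big_nil Cfun0 subr0 -/(real_of _) sqE lecR sqr_ge0.
  have evE z : (ev z)%:C = ft_eval phi psi (ft_mul (ft_star z) z).
    by apply: RRe_real; apply: ger0_real.
  have ev_ge0 z : 0 <= ev z by rewrite -lecR evE.
  have evy : 0 < ev y by rewrite lt_def y0 ev_ge0.
  have n0 := cnorm_ge0 (real_of x).
  have evxy : ev (ft_mul x y) <= cnorm (real_of x) ^+ 2 * ev y.
    rewrite -lecR rmorphM /= !evE -subr_ge0; apply: ft_eval_le => // t.
    rewrite !sqE -rmorphM -rmorphB /= lecR real_ofM CfunM cabsM exprMn subr_ge0.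
    rewrite ler_wpM2r ?sqr_ge0 // lerXn2r ?nnegrE ?cabs_ge0 //.
    exact: Cnorm_ge.
  rewrite lee_fin -[leRHS]ger0_norm // -sqrtr_sqr ler_wsqrtr //.
  by rewrite ler_pdivrMr.
have hx t : ((cabs (real_of x t))%:E <= min_norm x)%E.
  apply: ereal_sup_ubound.
  exists (fun f : CX => f (p t)), (fun f : CY => f (q t)), [:: (1, 1)].
  have evE z : ft_eval (fun f : CX => f (p t)) (fun f : CY => f (q t)) z = real_of z t.
    by rewrite /real_of Cfun_sum; apply: eq_bigr => u _; rewrite CtensE.
  have one : real_of [:: (1, 1)] = 1.
    by rewrite /real_of big_seq1; apply: CfunP => s; rewrite CtensE !Cfun1 mulr1.
  move=> ev; have ev1 : ev [:: (1, 1)] = 1.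
    by rewrite /ev evE real_ofM real_of_star one star1 mulr1.
  split; [exact: eval_state|exact: eval_state|by rewrite ev1 oner_neq0|].
  rewrite ev1 divr1 /ev evE real_ofM real_of_star real_ofM one mulr1.
  rewrite CfunM Cfun_star mulrC -normCK -cabsE -rmorphXn /= sqrtr_sqr.
  by rewrite ger0_norm ?cabs_ge0.
move: hx; case: (min_norm x) => [r hx|_|/(_ (cs_point T))].
- by rewrite lee_fin; apply: Cnorm_le => t; rewrite -lee_fin.
- by rewrite leey.
- by rewrite leeNy_eq.
Qed.

Hypothesis pq_inj : forall t t', p t = p t' -> q t = q t' -> t = t'.
Hypothesis sepX : forall x x' : X, x <> x' -> exists f : CX, f x <> f x'.
Hypothesis sepY : forall y y' : Y, y <> y' -> exists f : CY, f y <> f y'.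

Lemma Ctens_is_min_tensor : is_min_tensor Ctens.
Proof.
split.
- by move=> g c f f'; apply: CfunP => t; rewrite CfunD CfunZ !CtensE mulrDl mulrA.
- move=> f c g g'; apply: CfunP => t; rewrite CfunD CfunZ !CtensE.
  by rewrite CfunD CfunZ mulrDr mulrCA.
- by apply: CfunP => t; rewrite CtensE !Cfun1 mulr1.
- by move=> f f' g g'; apply: CfunP => t; rewrite CtensE !CfunM mulrACA.
- by move=> f g; apply: CfunP => t; rewrite CtensE !Cfun_star CtensE rmorphM.
- exact: Ctens_norm.
- apply: (dense_prod (Cpull_hom R pc) (Cpull_hom R qc)) => t t' tt'.
  have [pt|/sepX[f fp]] := pselect (p t = p t'); last by left; exists f.
  have [qt|/sepY[f fp]] := pselect (q t = q t'); last by right; exists f.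
  by exfalso; apply: tt'; apply: pq_inj.
Qed.

End MinTensor.

(** * Products of compact spaces *)

Section ProductSpace.
Variables X Y : compactSpace.

Fact prod_space_compact : compact [set: X * Y].
Proof. by rewrite -setXTT; apply: compact_setX; apply: cs_compact. Qed.

Definition prod_space : compactSpace :=
  @CompactSpace (X * Y)%type (cs_point X, cs_point Y) prod_space_compact.

Lemma fst_cont : continuous (fst : prod_space -> X).
Proof. by move=> z; apply: cvg_fst. Qed.

Lemma snd_cont : continuous (snd : prod_space -> Y).
Proof. by move=> z; apply: cvg_snd. Qed.

Lemma pair_cont (Z : topologicalType) (f : Z -> X) (g : Z -> Y) :
  continuous f -> continuous g -> continuous (fun z => (f z, g z) : prod_space).
Proof. by move=> cf cg z; apply: cvg_pair; [exact: cf|exact: cg]. Qed.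

End ProductSpace.

(** * The compact quantum group of a compact cancellative semigroup *)

Section GroupCqg.
Variables (R : realType) (X : compactSpace) (op : X * X -> X).
Hypothesis op_cont : continuous op.
Hypothesis opA : forall x y z, op (op (x, y), z) = op (x, op (y, z)).
Hypothesis op_injl : forall x y y', op (x, y) = op (x, y') -> y = y'.
Hypothesis op_injr : forall x x' y, op (x, y) = op (x', y) -> x = x'.
Hypothesis sep : forall x x' : X, x <> x' -> exists f : Cfun R X, f x <> f x'.

Let X2 := prod_space X X.
Let X3 := prod_space X2 X.
Let opc : continuous (op : X2 -> X) := op_cont.

Let sep2 (t t' : X2) : t <> t' -> exists f : Cfun R X2, f t <> f t'.
Proof.
case: t t' => [x y] [x' y'] tt'.
have [xx'|/sep[f fx]] := pselect (x = x').
  have /sep[f fy] : y <> y' by move=> yy'; apply: tt'; rewrite xx' yy'.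
  by exists (Cpull (@snd_cont X X) f).
by exists (Cpull (@fst_cont X X) f).
Qed.

Definition gtens : Cfun R X -> Cfun R X -> Cfun R X2 :=
  Ctens (@fst_cont X X) (@snd_cont X X).

Fact gtensP : is_min_tensor gtens.
Proof.
apply: Ctens_is_min_tensor => //; first by move=> x y; exists (x, y).
by move=> [x y] [x' y'] /= -> ->.
Qed.

Definition gtensl : Cfun R X2 -> Cfun R X -> Cfun R X3 :=
  Ctens (@fst_cont X2 X) (@snd_cont X2 X).

Fact gtenslP : is_min_tensor gtensl.
Proof.
apply: Ctens_is_min_tensor => //; first by move=> x y; exists (x, y).
by move=> [x y] [x' y'] /= -> ->.
Qed.

Let p11 : continuous (fun t : X3 => t.1.1).
Proof.
by move=> t; apply: (@continuous_comp _ _ _ (fst : X3 -> X2) (fst : X2 -> X));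
  apply: fst_cont.
Qed.
Let p12 : continuous (fun t : X3 => t.1.2).
Proof.
move=> t; apply: (@continuous_comp _ _ _ (fst : X3 -> X2) (snd : X2 -> X)).
  exact: fst_cont.
exact: snd_cont.
Qed.
Let p23 : continuous (fun t : X3 => (t.1.2, t.2) : X2).
Proof. by apply: pair_cont => //; exact: snd_cont. Qed.

Definition gtensr : Cfun R X -> Cfun R X2 -> Cfun R X3 := Ctens p11 p23.

Fact gtensrP : is_min_tensor gtensr.
Proof.
apply: Ctens_is_min_tensor => //; first by move=> x [y z]; exists ((x, y), z).
by move=> [[x y] z] [[x' y'] z'] /= -> [-> ->].
Qed.

Fact gtensA a b c : gtensl (gtens a b) c = gtensr a (gtens b c).
Proof. by apply: CfunP => t; rewrite !CtensE mulrA. Qed.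

Definition gcomul : Cfun R X -> Cfun R X2 := Cpull opc.

Let op_id_cont : continuous (fun t : X3 => (op t.1, t.2) : X2).
Proof.
apply: pair_cont; last exact: snd_cont.
move=> t; apply: (@continuous_comp _ _ _ (fst : X3 -> X2) op).
  exact: fst_cont.
exact: opc.
Qed.
Let id_op_cont : continuous (fun t : X3 => (t.1.1, op (t.1.2, t.2)) : X2).
Proof.
apply: pair_cont; first exact: p11.
move=> t; apply: (@continuous_comp _ _ _ (fun t : X3 => (t.1.2, t.2) : X2) op).
  exact: p23.
exact: opc.
Qed.

Fact gcoassoc : exists comul_id id_comul : Cfun R X2 -> Cfun R X3,
    [/\ is_star_hom (alg_star (Cfun R X2)) (alg_star (Cfun R X3)) comul_id,
        forall a b, comul_id (gtens a b) = gtensl (gcomul a) b,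
        is_star_hom (alg_star (Cfun R X2)) (alg_star (Cfun R X3)) id_comul,
        forall a b, id_comul (gtens a b) = gtensr a (gcomul b)
      & forall a, comul_id (gcomul a) = id_comul (gcomul a)].
Proof.
exists (Cpull op_id_cont), (Cpull id_op_cont); split.
- exact: Cpull_hom.
- by move=> a b; apply: CfunP.
- exact: Cpull_hom.
- by move=> a b; apply: CfunP.
- by move=> a; apply: CfunP => -[[x y] z]; rewrite !CpullE /= opA.
Qed.

Lemma gtens_r1 (b : Cfun R X) : gtens b 1 = Cpull (@fst_cont X X) b.
Proof. by apply: CfunP => t; rewrite CtensE Cfun1 mulr1. Qed.

Lemma gtens_1l (b : Cfun R X) : gtens 1 b = Cpull (@snd_cont X X) b.
Proof. by apply: CfunP => t; rewrite CtensE Cfun1 mul1r. Qed.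

(** By cancellation the pair of maps op and fst is injective on X × X, so the pullbacks along them
    jointly separate points. *)
Fact gdensel :
  closure (lin_span [set gcomul a * gtens b 1 | a in setT & b in setT]
           : set (normed_space (Cfun R X2))) = setT.
Proof.
have -> : [set gcomul a * gtens b 1 | a in setT & b in setT] =
    [set gcomul a * Cpull (@fst_cont X X) b | a in setT & b in setT].
  by apply/seteqP; split=> f [a _ [b _ <-]]; exists a => //; exists b => //;
    rewrite gtens_r1.
apply: dense_prod; [exact: Cpull_hom|exact: Cpull_hom|].
move=> [x y] [x' y'] tt'.
have [xx'|/sep[f fx]] := pselect (x = x'); last by right; exists f.
have /sep[f fx] : op (x, y) <> op (x', y').
  by rewrite xx' => /op_injl yy'; apply: tt'; rewrite xx' yy'.
by left; exists f.
Qed.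

Fact gdenser :
  closure (lin_span [set gcomul a * gtens 1 b | a in setT & b in setT]
           : set (normed_space (Cfun R X2))) = setT.
Proof.
have -> : [set gcomul a * gtens 1 b | a in setT & b in setT] =
    [set gcomul a * Cpull (@snd_cont X X) b | a in setT & b in setT].
  by apply/seteqP; split=> f [a _ [b _ <-]]; exists a => //; exists b => //;
    rewrite gtens_1l.
apply: dense_prod; [exact: Cpull_hom|exact: Cpull_hom|].
move=> [x y] [x' y'] tt'.
have [yy'|/sep[f fx]] := pselect (y = y'); last by right; exists f.
have /sep[f fx] : op (x, y) <> op (x', y').
  by rewrite yy' => /op_injr xx'; apply: tt'; rewrite xx' yy'.
by left; exists f.
Qed.

Definition group_cqg : compact_quantum_group R :=
  CompactQuantumGroup gtensP gtenslP gtensrP gtensA (Cpull_hom R opc) gcoassoc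
    gdensel gdenser.

End GroupCqg.

(** * The compact group of Hopf automorphisms *)

Section ComplexParts.
Variable R : realType.
Implicit Types z w : R[i].

Lemma lec0_sub (A : R) z : 0 <= A%:C - z -> complex.Im z = 0 /\ complex.Re z <= A.
Proof.
case: z => z1 z2; rewrite subr_ge0 lecE => /andP[/eqP /= e l].
by split.
Qed.

Lemma ReD z w : complex.Re (z + w) = complex.Re z + complex.Re w.
Proof. by case: z; case: w. Qed.
Lemma ImD z w : complex.Im (z + w) = complex.Im z + complex.Im w.
Proof. by case: z; case: w. Qed.
Lemma ReN z : complex.Re (- z) = - complex.Re z. Proof. by case: z. Qed.
Lemma ImN z : complex.Im (- z) = - complex.Im z. Proof. by case: z. Qed.
Lemma Re_imul z : complex.Re ('i%C * z) = - complex.Im z.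
Proof. by rewrite mulrC ReiNIm. Qed.
Lemma Im_imul z : complex.Im ('i%C * z) = complex.Re z.
Proof. by case: z => a b /=; rewrite mul0r mul1r add0r. Qed.

(** The values 1, -1, i, -i of c force w to be the conjugate of z and bound the real and the
    imaginary part of z by A / 2 each. *)
Lemma hermitian_bound (A : R) z w :
  (forall c : R[i], `|c| = 1 -> 0 <= A%:C - (c * z + c^* * w)) ->
  `|complex.Re z| + `|complex.Im z| <= A.
Proof.
move=> key.
have k1 := key 1 (normr1 _); rewrite conjC1 !mul1r in k1.
have k2 := key (- 1) (normrN1 _); rewrite conjCN1 !mulN1r in k2.
have k3 := key 'i (normCi _).
have Ni : `|- 'i : R[i]| = 1 by rewrite normrN normCi.
have k4 := key (- 'i) Ni.
have cNi : (- 'i : R[i])^* = 'i by rewrite -conjCi conjCK.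
rewrite conjCi !mulNr -complexiE in k3; rewrite cNi !mulNr -complexiE in k4.
have [i1 r1] := lec0_sub k1; have [_ r2] := lec0_sub k2.
have [i3 r3] := lec0_sub k3; have [_ r4] := lec0_sub k4.
clear k1 k2 k3 k4 key Ni cNi.
rewrite ReD in r1; rewrite ReD !ReN in r2; rewrite ReD ReN !Re_imul in r3.
rewrite ReD ReN !Re_imul in r4; rewrite ImD in i1; rewrite ImD ImN !Im_imul in i3.
by case: (ger0P (complex.Re z)) => z1; case: (ger0P (complex.Im z)) => z2; lra.
Qed.
End ComplexParts.

(** * What a Hopf automorphism preserves *)

Section HopfAut.
Variables (R : realType) (G : finite_quantum_group R) (h : dual G).
Local Notation C := R[i].
Hypothesis haar_h : is_haar h.

Section One.
Variable theta : 'End(G).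
Hypothesis aut : is_hopf_aut theta.

Let theta_inj : injective theta.
Proof. by have [/bij_inj] := aut. Qed.

Lemma hopf_aut_surj a : exists b, theta b = a.
Proof. by have [[g _ gK] _ _] := aut; exists (g a); rewrite gK. Qed.

Lemma hopf_autM a b : theta (a * b) = theta a * theta b.
Proof. by have [_ [_ _ h' _] _] := aut; apply: h'. Qed.

Lemma hopf_aut1 : theta 1 = 1.
Proof. by have [_ [_ h' _ _] _] := aut. Qed.

Lemma hopf_aut_star a : theta (star a) = star (theta a).
Proof. by have [_ [_ _ _ h'] _] := aut; apply: h'. Qed.

Lemma hopf_aut_comul (W : lmodType C) (T : G -> G -> W) a : bilin T ->
  tlift T (comul (theta a)) = tlift (fun b c => T (theta b) (theta c)) (comul a).
Proof.
move=> bT; have [T1 T2] := bT; have [_ _ co] := aut.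
rewrite -co tlift_bind //; apply: eq_tlift => b c.
by rewrite tlift_tensE.
Qed.

(** Uniqueness of the Haar functional: the composite of h and theta is left invariant and h is right
    invariant, so the former tensored with h, on comul(a), takes both values. *)
Lemma hopf_aut_haar a : h (theta a) = h a.
Proof.
have lc := @comul_linear _ G.
have lh := haar_linear h.
have linv : tlift (fun b c => h (theta b) *: c) (comul a) = h (theta a) *: 1.
  apply: theta_inj.
  rewrite linearZ /= hopf_aut1 -(haarl haar_h) hopf_aut_comul; last by lin.
  have lt : linear theta by exact: linearP.
  by rewrite (tlift_lin _ _ lt); apply: eq_tlift => b c; rewrite linearZ.
have e1 : h (tlift (fun b c => h (theta b) *: c) (comul a)) = h (theta a).
  by rewrite linv linearZ /= haar1 // [_ *: _]mulr1.
have lht : linear (fun x => h (theta x)) by lin.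
have : h (theta (tlift (fun b c => h c *: b) (comul a))) = h a.
  by rewrite haarr // linearZ /= hopf_aut1 linearZ /= haar1 // [_ *: _]mulr1.
move=> <-; rewrite -e1 (tlift_lin _ _ lht) (tlift_lin _ _ lh).
apply: eq_tlift => b c; rewrite !linearZ /=; exact: mulrC.
Qed.

(** Uniqueness of the counit: the composite of the counit and theta is a left counit, and it is
    compared with the right counit on comul(a). *)
Lemma hopf_aut_counit a : counit G (theta a) = counit G a.
Proof.
have lc := @comul_linear _ G.
have lt : linear theta by exact: linearP.
have inv : tlift (fun b c => counit G (theta b) *: c) (comul a) = a.
  apply: theta_inj.
  rewrite (tlift_lin _ _ lt) -[RHS](comul_counitl _ (@lin_id _ _)).
  rewrite hopf_aut_comul; last by lin.
  by apply: eq_tlift => b c; rewrite linearZ.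
have le : linear (counit G) by exact: linearP.
rewrite -[in RHS]inv (tlift_lin _ _ le).
rewrite -[in LHS](counitr a).
have let' : linear (fun x => counit G (theta x)) by lin.
rewrite (tlift_lin _ _ let'); apply: eq_tlift => b c; rewrite !linearZ /=.
exact: mulrC.
Qed.

(** Both sides are convolution inverses of theta: theta(S(a1)) theta(a2) S(theta(a3)) collapses to
    either of them. *)
Lemma hopf_aut_antipode a : theta (antipode G a) = antipode G (theta a).
Proof.
have lc := @comul_linear _ G.
have lt : linear theta by exact: linearP.
pose Q (u c : G) := theta u * antipode G (theta c).
have bQ : bilin Q by rewrite /Q; lin.
have <- : Q 1 a = antipode G (theta a) by rewrite /Q hopf_aut1 mul1r.
rewrite -(comul_absorbl a bQ).
have ltS : linear (fun x => theta (antipode G x)) by lin.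
rewrite -[in LHS](counitr a) (tlift_lin _ _ ltS).
apply: eq_tlift => b c.
transitivity (theta (antipode G b) * (counit G c *: 1)).
  by rewrite !linearZ /= -scalerAr mulr1.
rewrite -hopf_aut_counit -antipoder hopf_aut_comul; last by lin.
have lm : linear (fun x => theta (antipode G b) * x) by lin.
rewrite (tlift_lin _ _ lm); apply: eq_tlift => x y.
by rewrite /Q hopf_autM mulrA.
Qed.

End One.

(** The basis dual to [vbasis] under the pairing h(a b). *)
Definition dual_basis i : G := (fourier h)^-1%VF (@dual_coord R G i).

Lemma coord_dual_basis i a : dual_coord i a = h (a * dual_basis i).
Proof. by rewrite -fourierE // fourierVK. Qed.

(* As automorphisms preserve h, this bounds their matrix entries uniformly. *)
Lemma haar_bound x y :
  cabs (h (x * y)) <= cabs (h (x * star x)) + cabs (h (star y * y)).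
Proof.
have hp a : 0 <= h (star a * a) by exact: haar_positive.
have hpx : 0 <= h (x * star x) by rewrite -[X in X * _](@starK R); apply: hp.
pose A := complex.Re (h (x * star x)) + complex.Re (h (star y * y)).
have AE : h (x * star x) + h (star y * y) = A%:C.
  by rewrite rmorphD /= !RRe_real //; apply: ger0_real.
have key (c : C) : `|c| = 1 ->
    0 <= A%:C - (c * h (x * y) + c^* * h (star y * star x)).
  move=> c1; have cc : c^* * c = 1 by rewrite mulrC -normCK c1 expr1n.
  have := haar_positive haar_h (star x - c *: y).
  have -> : star (star x - c *: y) * (star x - c *: y) =
      (x * star x + star y * y) - (c *: (x * y) + c^* *: (star y * star x)).
    rewrite starD starN starK starZ mulrDl !mulrDr !mulrN !mulNr opprK.
    rewrite -!scalerAl -!scalerAr scalerA cc scale1r.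
    by rewrite opprD [- _ + star y * y]addrC addrACA.
  by rewrite linearB !linearD /= !linearZ /= AE.
have [ReA ImA] : cabs (h (x * star x)) = complex.Re (h (x * star x)) /\
    cabs (h (star y * y)) = complex.Re (h (star y * y)).
  have cabsp z : 0 <= z -> cabs z = complex.Re z by move=> z0; rewrite /cabs ger0_norm.
  by split; apply: cabsp.
rewrite ReA ImA -/A; apply: le_trans (cabs_le_ReIm _) _.
exact: hermitian_bound key.
Qed.

Let X := hopf_aut G.

Lemma val_hopf_aut (theta : X) : is_hopf_aut (val theta).
Proof. exact: (asboolW (valP theta)). Qed.

Lemma hopf_aut_ext (theta theta' : X) :
  (forall i a, dual_coord i (val theta a) = dual_coord i (val theta' a)) ->
  theta = theta'.
Proof.
move=> e; apply: val_inj; apply/lfunP => a.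
rewrite [LHS]dual_coordK [RHS]dual_coordK.
by apply: eq_bigr => i _; rewrite e.
Qed.

Lemma hopf_aut_mxE (theta : X) i j :
  hopf_aut_mx theta i j = dual_coord j (val theta (vbasis {:G})`_i).
Proof.
rewrite /hopf_aut_mx /passmx.mxof mxE /=.
by rewrite passmx.vecof_delta mxE dual_coordE.
Qed.

Lemma hopf_aut_coord_bounded i a :
  exists M : R, forall theta : X, cabs (dual_coord i (val theta a)) <= M.
Proof.
exists (cabs (h (a * star a)) + cabs (h (star (dual_basis i) * dual_basis i))).
move=> theta; rewrite coord_dual_basis; apply: le_trans (haar_bound _ _) _.
have aut := val_hopf_aut theta.
by rewrite -hopf_aut_star // -hopf_autM // hopf_aut_haar.
Qed.

(** The function is a fixed linear combination of the matrix entries that define the topology. *)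
Lemma hopf_aut_coord_continuous (rho : dual G) (a : G) :
  continuous (fun theta : X => rho (val theta a) : C^o).
Proof.
have entry i j : continuous (fun theta : X => hopf_aut_mx theta i j : C^o).
  move=> theta; apply: (@cvg_comp _ _ _ (@hopf_aut_mx R G)
    (fun M : 'M[C^o]_(\dim {:G}) => M i j) _ (nbhs (hopf_aut_mx theta))).
    exact: (@initial_continuous _ _ (@hopf_aut_mx R G) theta).
  exact: (@coord_continuous C _ _ i j (hopf_aut_mx theta)).
pose n := \dim {:G}.
rewrite (_ : (fun theta : X => _) = fun theta : X =>
    \sum_(i < n) \sum_(j < n)
      (dual_coord i a * rho (vbasis {:G})`_j : C^o) * hopf_aut_mx theta i j : C^o).
  apply: (@continuous_big C^o) => [|i _]; first exact: add_continuous.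
  apply: (@continuous_big C^o) => [|j _ theta]; first exact: add_continuous.
  exact: (cvgM (cvg_cst _) (entry i j theta)).
apply/funext => theta; rewrite {1}[a]dual_coordK linear_sum linear_sum.
apply: eq_bigr => i _; rewrite !linearZ /=.
rewrite [val theta _]dual_coordK linear_sum scaler_sumr.
apply: eq_bigr => j _; rewrite hopf_aut_mxE linearZ /= scalerA.
by rewrite [RHS]mulrAC.
Qed.

(** * Limits along an ultrafilter and compactness *)

Section UltraLimit.
Variables (T : Type) (F : set_system T).
Hypothesis FU : UltraFilter F.

Definition ultra_lim (u : T -> C) (l : C) :=
  forall e : R, 0 < e -> F [set t | cabs (l - u t) < e].

Let FF : ProperFilter F := @ultra_proper _ _ FU.

(** The limit is the supremum of the c with c <= u on a set of F. The set where sup + e <= u cannot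
    be in F, so its complement is. *)
Let ultra_real (u : T -> R) (M : R) : (forall t, `|u t| <= M) ->
  exists l : R, forall e, 0 < e -> F [set t | `|l - u t| < e].
Proof.
move=> uM; pose D := [set c : R | F [set t | c <= u t]].
have D0 : D (- M) by apply: filterS filterT => t _ /=; have := uM t; rewrite ler_norml => /andP[].
have Dub : ubound D M.
  move=> c /= /filter_ex[t /= ct]; apply: le_trans ct _.
  exact: le_trans (ler_norm _) (uM t).
have hs : has_sup D by split; [exists (- M)|exists M].
exists (sup D) => e e0.
have [c Dc cs] := sup_adherent e0 hs.
have : F [set t | u t < sup D + e].
  have [Fe|] := in_ultra_setVsetC [set t | sup D + e <= u t] FU.
    by have := ub_le_sup hs.2 Fe; rewrite gerDl leNgt e0.
  by apply: filterS => t /= /negP; rewrite -ltNge.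
move=> /(filterI Dc); apply: filterS => t /= [cu us].
by rewrite ltr_norml; apply/andP; split; lra.
Qed.

Lemma ultra_lim_ex (u : T -> C) (M : R) : (forall t, cabs (u t) <= M) ->
  exists l, ultra_lim u l.
Proof.
move=> uM.
have [|r hr] := @ultra_real (fun t => complex.Re (u t)) M.
  by move=> t; apply: le_trans (cabs_ge_Re _) (uM t).
have [|s hs] := @ultra_real (fun t => complex.Im (u t)) M.
  by move=> t; apply: le_trans (cabs_ge_Im _) (uM t).
exists (r +i* s) => e e0; have e1 : 0 < e / 2 by rewrite divr_gt0.
apply: filterS (filterI (hr _ e1) (hs _ e1)) => t /= [h1 h2].
apply: le_lt_trans (cabs_le_ReIm _) _; rewrite ReB ImB /=.
by rewrite [e]splitr; apply: ltrD.
Qed.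

Lemma ultra_lim_uniq u l l' : ultra_lim u l -> ultra_lim u l' -> l = l'.
Proof.
move=> ul ul'; apply/eqP; rewrite -subr_eq0; apply/eqP/cabs0_eq.
apply/ler_addgt0Pr => e e0; rewrite add0r; have e1 : 0 < e / 2 by rewrite divr_gt0.
have [t /= [h1 h2]] := filter_ex (filterI (ul _ e1) (ul' _ e1)).
have -> : l - l' = (l - u t) + - (l' - u t) by ring.
apply: le_trans (cabsD _ _) _; rewrite {2}/cabs normrN -/(cabs _).
by rewrite [e]splitr; apply: lerD; apply: ltW.
Qed.

Lemma ultra_lim_cst c : ultra_lim (fun=> c) c.
Proof.
by move=> e e0; apply: filterS filterT => t _ /=; rewrite subrr /cabs normr0.
Qed.

Lemma ultra_limD u v l m : ultra_lim u l -> ultra_lim v m ->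
  ultra_lim (fun t => u t + v t) (l + m).
Proof.
move=> ul vm e e0; have e1 : 0 < e / 2 by rewrite divr_gt0.
apply: filterS (filterI (ul _ e1) (vm _ e1)) => t /= [h1 h2].
rewrite opprD addrACA [e]splitr; apply: le_lt_trans (cabsD _ _) _.
exact: ltrD.
Qed.

Lemma ultra_limM u v l m : ultra_lim u l -> ultra_lim v m ->
  ultra_lim (fun t => u t * v t) (l * m).
Proof.
move=> ul vm e e0.
pose M := cabs m + 1; have M0 : 0 < M by rewrite ltr_wpDl ?cabs_ge0.
pose N := cabs l + 1; have N0 : 0 < N by rewrite ltr_wpDl ?cabs_ge0.
have e1 : 0 < e / 2 / M by rewrite !divr_gt0.
have e2 : 0 < e / 2 / N by rewrite !divr_gt0.
apply: filterS (filterI (filterI (ul _ e1) (vm _ e2)) (ul _ ltr01)) => t /= [[h1 h2] h3].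
have -> : l * m - u t * v t = (l - u t) * m + u t * (m - v t) by ring.
apply: le_lt_trans (cabsD _ _) _; rewrite !cabsM.
have un : cabs (u t) <= N.
  have -> : u t = l + - (l - u t) by ring.
  apply: le_trans (cabsD _ _) _; rewrite {2}/cabs normrN -/(cabs _) lerD2l.
  exact: ltW.
rewrite ltr_pdivlMr // in h1; rewrite ltr_pdivlMr // in h2.
rewrite [e]splitr; apply: ler_ltD.
  apply: le_trans (ltW h1); rewrite ler_wpM2l ?cabs_ge0 //.
  by rewrite lerDl.
apply: le_lt_trans h2; rewrite mulrC ler_wpM2l ?cabs_ge0 //.
Qed.

Lemma ultra_lim_conj u l : ultra_lim u l -> ultra_lim (fun t => (u t)^*) l^*.
Proof.
move=> ul e /ul; apply: filterS => t /=.
by rewrite -rmorphB cabsJ.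
Qed.

Lemma ultra_lim_sum (I : Type) (r : seq I) (u : I -> T -> C) (l : I -> C) :
  (forall i, ultra_lim (u i) (l i)) ->
  ultra_lim (fun t => \sum_(i <- r) u i t) (\sum_(i <- r) l i).
Proof.
move=> ul; elim: r => [|i r IH].
  by move=> e e0; apply: filterS filterT => t _ /=; rewrite !big_nil subrr /cabs normr0.
have := ultra_limD (ul i) IH; rewrite big_cons => h' e /h'; apply: filterS => t /=.
by rewrite big_cons.
Qed.

End UltraLimit.

Section HopfAutLimit.
Variable F : set_system X.
Hypothesis FU : UltraFilter F.

Let FF : ProperFilter F := @ultra_proper _ _ FU.

(** Coordinates are bounded uniformly in theta and so have limits; uniqueness of limits makes these
    linear in a. *)
Lemma hopf_aut_ultra_lim : exists theta0 : 'End(G),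
  forall (rho : dual G) a, ultra_lim F (fun theta => rho (val theta a)) (rho (theta0 a)).
Proof.
have lex i a : exists l, ultra_lim F (fun theta => dual_coord i (val theta a)) l.
  have [M hM] := hopf_aut_coord_bounded i a.
  exact: (ultra_lim_ex FU hM).
pose l i a := projT1 (cid (lex i a)).
have lP i a : ultra_lim F (fun theta => dual_coord i (val theta a)) (l i a).
  by rewrite /l; case: (cid (lex i a)).
have lL i : linear (l i : G -> C^o).
  move=> k x y; apply: (ultra_lim_uniq FU (lP i _)).
  have := ultra_limD FU (ultra_limM FU (ultra_lim_cst FU k) (lP i x)) (lP i y).
  move=> h' e /h'; apply: filterS => t /=.
  by rewrite !linearP.
pose f a : G := \sum_i l i a *: (vbasis {:G})`_i.
have fL : linear f.
  move=> k x y; rewrite /f scaler_sumr -big_split; apply: eq_bigr => i _ /=.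
  by rewrite lL scalerDl scalerA.
have fc i a : dual_coord i (f a) = l i a.
  rewrite dual_coordE /f coord_sum_free //; exact: basis_free (vbasisP _).
exists (linfun f) => rho a; rewrite linfunE //.
have := ultra_lim_sum FU (index_enum _)
  (fun i => ultra_limM FU (lP i a) (ultra_lim_cst FU (rho (vbasis {:G})`_i))).
rewrite /f linear_sum.
have -> : \sum_i rho (l i a *: (vbasis {:G})`_i) =
    \sum_i l i a * rho (vbasis {:G})`_i.
  by apply: eq_bigr => i _; rewrite linearZ.
move=> h' e /h'; apply: filterS => t /=.
rewrite (_ : rho (val t a) =
    \sum_i dual_coord i (val t a) * rho (vbasis {:G})`_i) //.
rewrite {1}[val t a]dual_coordK linear_sum.
by apply: eq_bigr => i _; rewrite linearZ.
Qed.

(** The defining equations are polynomial in coordinates and their conjugates, hence pass to the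
    limit. Bijectivity is recovered from h(theta0(a) theta0(b)) = h(a b) and the non-degeneracy of
    h. *)
Lemma hopf_aut_lim_is_hopf_aut (theta0 : 'End(G)) :
  (forall (rho : dual G) a,
    ultra_lim F (fun theta => rho (val theta a)) (rho (theta0 a))) ->
  is_hopf_aut theta0.
Proof.
move=> lim0.
have ext a b : (forall i, dual_coord i a = dual_coord i b) -> a = b.
  move=> e; rewrite [LHS]dual_coordK [RHS]dual_coordK.
  by apply: eq_bigr => i _; rewrite e.
have bilim (T : G -> G -> C^o) a b : bilin T ->
    ultra_lim F (fun theta => T (val theta a) (val theta b)) (T (theta0 a) (theta0 b)).
  move=> [T1 T2].
  have TE x y : T x y = \sum_i \sum_j
      (dual_coord i x * dual_coord j y) * T (vbasis {:G})`_i (vbasis {:G})`_j.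
    rewrite {1}[x]dual_coordK (big_morph (T^~ y) (linD (T1 y)) (lin0 (T1 y))).
    apply: eq_bigr => i _; rewrite (linZ (T1 y)).
    rewrite {1}[y]dual_coordK (big_morph (T _) (linD (T2 _)) (lin0 (T2 _))).
    rewrite scaler_sumr; apply: eq_bigr => j _; rewrite (linZ (T2 _)).
    exact: mulrA.
  rewrite TE.
  have := ultra_lim_sum FU (index_enum _) (fun i =>
    ultra_lim_sum FU (index_enum _) (fun j =>
      ultra_limM FU (ultra_limM FU (lim0 (dual_coord i) a) (lim0 (dual_coord j) b))
        (ultra_lim_cst FU (T (vbasis {:G})`_i (vbasis {:G})`_j)))).
  by move=> h' e /h'; apply: filterS => t /=; rewrite TE.
have eqlim u v l m : (forall theta : X, u theta = v theta) ->
    ultra_lim F u l -> ultra_lim F v m -> l = m.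
  by move=> uv ul vm; apply: (ultra_lim_uniq FU ul); rewrite (funext uv).
have haar0 a b : h (theta0 a * theta0 b) = h (a * b).
  pose T (x y : G) : C^o := h (x * y).
  have bT : bilin T by rewrite /T; lin.
  apply: (eqlim _ _ _ _ _ (bilim T a b bT) (ultra_lim_cst FU (h (a * b)))).
  move=> theta; have aut := val_hopf_aut theta.
  by rewrite /T -hopf_autM // hopf_aut_haar.
have ker0 : lker theta0 == 0%VS.
  apply/lker0P => a b ab; apply/eqP; rewrite -subr_eq0; apply/eqP.
  apply: (haar_nondegenerate haar_h) => x.
  by rewrite -haar0 linearB /= ab subrr mulr0 linear0.
split.
- exists (theta0^-1)%VF; [exact: lker0_lfunK|exact: lker0_lfunVK].
- split.
  + exact: linearP.
  + apply: ext => i; apply: (eqlim _ _ _ _ _ (lim0 (dual_coord i) 1)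
      (ultra_lim_cst FU (dual_coord i 1))) => theta.
    by rewrite hopf_aut1 //; exact: val_hopf_aut.
  + move=> a b; apply: ext => i.
    pose T (x y : G) : C^o := dual_coord i (x * y).
    have bT : bilin T by rewrite /T; lin.
    apply: (eqlim _ _ _ _ _ (lim0 (dual_coord i) (a * b)) (bilim T a b bT)).
    by move=> theta; rewrite /T -hopf_autM //; exact: val_hopf_aut.
  + move=> a; apply: ext => i.
    (* The star is antilinear, so a coordinate of it is expressed as the conjugate of a linear
       functional, to which [lim0] applies. *)
    have sE x : dual_coord i (star x) = (dual_conj (dual_coord i) x : C)^*.
      by rewrite dual_conjE conjCK.
    change (dual_coord i (theta0 (star a)) = dual_coord i (star (theta0 a))).
    rewrite sE.
    have uv (theta : X) : dual_coord i (val theta (star a)) =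
        (dual_conj (dual_coord i) (val theta a) : C)^*.
      by rewrite -sE hopf_aut_star //; exact: val_hopf_aut.
    exact: (eqlim _ _ _ _ uv (lim0 (dual_coord i) (star a))
      (ultra_lim_conj FU (lim0 (dual_conj (dual_coord i)) a))).
- move=> a; apply/ffunP => k; apply: ext => j.
  have lc := @comul_linear _ G.
  have lrho : linear (fun x : G => dual_coord j (comul x k) : C^o).
    by move=> c x y; rewrite lc !ffunE linearP.
  (* A single coordinate of the coproduct is a functional on G, so its limit is known. *)
  pose rho : dual G := linfun (fun x : G => dual_coord j (comul x k) : C^o).
  have tE (theta : 'End(G)) :
      dual_coord j (tlift (fun b c => tens (theta b) (theta c)) (comul a) k) =
      \sum_(i < \dim {:G}) dual_coord k (theta (vbasis {:G})`_i) * dual_coord j (theta (comul a i)).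
    rewrite /tlift sum_ffunE linear_sum; apply: eq_bigr => i _.
    by rewrite ffunE linearZ /= -dual_coordE.
  rewrite tE.
  have <- : rho (theta0 a) = dual_coord j (comul (theta0 a) k) by rewrite linfunE.
  have ul := ultra_lim_sum FU (index_enum _) (fun i : 'I_(\dim {:G}) =>
    ultra_limM FU (lim0 (dual_coord k) (vbasis {:G})`_i)
      (lim0 (dual_coord j) (comul a i))).
  have uv (theta : X) : \sum_(i < \dim {:G})
      dual_coord k (val theta (vbasis {:G})`_i) * dual_coord j (val theta (comul a i)) =
      rho (val theta a).
    by rewrite linfunE // -tE; have [_ _ ->] := val_hopf_aut theta.
  exact: (eqlim _ _ _ _ uv ul (lim0 rho a)).
Qed.

End HopfAutLimit.

Lemma hopf_aut_compact : compact [set: X].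
Proof.
rewrite compact_ultra => F FU _.
have [theta0 lim0] := hopf_aut_ultra_lim FU.
have aut0 := hopf_aut_lim_is_hopf_aut FU lim0.
pose t0 : X := exist _ theta0 (introT (asboolP _) aut0).
have FF : ProperFilter F := @ultra_proper _ _ FU.
exists t0; split=> //= B /= [_ [[U Uop <-] Ut] sUB].
have : nbhs (hopf_aut_mx t0) U by apply: open_nbhs_nbhs.
move=> [P nP sPU]; rewrite nbhs_filterE; apply: filterS sUB _.
have Fij i j : F [set theta : X | P i j (hopf_aut_mx theta i j)].
  have /nbhs_ballP[e /= e0 eP] := nP i j.
  have eE : e = (complex.Re e)%:C by apply/esym/RRe_real/gtr0_real.
  have e1 : 0 < complex.Re e by rewrite -ltcR -eE.
  have := lim0 (dual_coord j) (vbasis {:G})`_i _ e1.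
  apply: filterS => theta /= h'; apply: eP; rewrite -ball_normE /= eE.
  by rewrite !hopf_aut_mxE -cabsE ltcR.
have FFl : Filter F by exact: filter_filter.
have Fi i : F [set theta : X | forall j, P i j (hopf_aut_mx theta i j)].
  exact: (@filter_forall _ _ (fun j (theta : X) => P i j (hopf_aut_mx theta i j)) _ FFl (Fij i)).
apply: filterS (filter_forall FFl Fi) => theta Ptheta.
by apply: sPU.
Qed.

End HopfAut.

(** * Evaluation of tensors at points *)

Section Evaluation.
Variables (R : realType) (Z : compactSpace).
Local Notation C := R[i].
Local Notation CZ := (Cfun R Z).

Lemma Cfun_eval_linear (z : Z) : linear (fun f : CZ => f z : C^o).
Proof. by []. Qed.

Section Eval.
Variable V : vectType C.

(** Elements of V ⊗ C(Z) are functions from Z to V; equations between them are checked pointwise, by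
    [teval_inj]. *)
Definition teval (z : Z) (t : tensor V CZ) : V := tlift (fun v (f : CZ) => f z *: v) t.

Lemma teval_bilin z : bilin (fun (v : V) (f : CZ) => f z *: v).
Proof.
split=> [f|v]; first by lin.
by move=> k f g; rewrite CfunD CfunZ scalerDl scalerA.
Qed.

Lemma teval_tens z v (f : CZ) : teval z (tens v f) = f z *: v.
Proof. by rewrite /teval tlift_tensE //; apply: teval_bilin. Qed.

Lemma teval_linear z : linear (teval z).
Proof. by have [b1 b2] := teval_bilin z; rewrite /teval; lin. Qed.

Lemma teval_tlift z (V' : vectType C) (B' : lmodType C)
    (S : V' -> B' -> tensor V CZ) (t : tensor V' B') :
  teval z (tlift S t) = tlift (fun v b => teval z (S v b)) t.
Proof. by apply: tlift_lin; apply: teval_linear. Qed.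

Lemma teval_coord z (t : tensor V CZ) i : coord (vbasis {:V}) i (teval z t) = t i z.
Proof. by rewrite /teval /tlift coord_sum_free //; apply: basis_free (vbasisP _). Qed.

Lemma teval_inj (t t' : tensor V CZ) : (forall z, teval z t = teval z t') -> t = t'.
Proof.
move=> e; apply/ffunP => i; apply: CfunP => z.
by have := congr1 (coord (vbasis {:V}) i) (e z); rewrite !teval_coord.
Qed.

Variable v : star_ops V.
Let ops := tensor_star v (alg_star CZ).

Lemma teval_one z : teval z (sone ops) = sone v.
Proof. by rewrite /= teval_tens Cfun1 scale1r. Qed.

Lemma teval_mul z (t t' : tensor V CZ) : bilin (smul v) ->
  teval z (smul ops t t') = smul v (teval z t) (teval z t').
Proof.
move=> [m1 m2]; rewrite /= teval_tlift {2}/teval.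
rewrite (tlift_lin _ _ (m1 (teval z t'))); apply: eq_tlift => a f.
rewrite teval_tlift /teval.
have lm : linear (smul v (f z *: a)) by exact: m2.
rewrite (tlift_lin _ _ lm); apply: eq_tlift => b g.
by rewrite -/(teval z _) teval_tens CfunM (linZ (m2 _)) (linZ (m1 _)) scalerA mulrC.
Qed.

Lemma teval_star z (t : tensor V CZ) :
  (forall (k : C) x y, sstar v (k *: x + y) = k^* *: sstar v x + sstar v y) ->
  teval z (sstar ops t) = sstar v (teval z t).
Proof.
move=> sL; rewrite /= teval_tlift /teval.
have sD : {morph sstar v : x y / x + y}.
  by move=> x y; have := sL 1 x y; rewrite conjC1 !scale1r.
have s0 : sstar v 0 = 0 by apply: (addrI (sstar v 0)); rewrite -sD !addr0.
rewrite [in RHS]/tlift (big_morph _ sD s0); apply: eq_bigr => i _.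
rewrite -/(teval z _) teval_tens Cfun_star.
by have := sL (t i z) (vbasis {:V})`_i 0; rewrite !addr0 s0 addr0.
Qed.

End Eval.
End Evaluation.

(** * C(Aut) and its action by automorphisms *)

Section AutCqg.
Variables (R : realType) (G : finite_quantum_group R) (h : dual G).
Local Notation C := R[i].
Hypothesis haar_h : is_haar h.

Lemma is_hopf_aut_id : is_hopf_aut (\1%VF : 'End(G)).
Proof.
split.
- by exists id => x; rewrite id_lfunE.
- split; first exact: linearP.
  + by rewrite id_lfunE.
  + by move=> x y; rewrite !id_lfunE.
  + by move=> x; rewrite !id_lfunE.
- move=> a; rewrite id_lfunE -[RHS]tlift_id; apply: eq_tlift => b c.
  by rewrite !id_lfunE.
Qed.

Definition hopf_aut_id : hopf_aut G :=
  exist (fun theta : 'End(G) => `[< is_hopf_aut theta >]) \1%VF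
    (introT (asboolP _) is_hopf_aut_id).

Definition aut_space : compactSpace :=
  CompactSpace hopf_aut_id (hopf_aut_compact haar_h).

Definition aut_coef (rho : dual G) (a : G) : Cfun R aut_space :=
  Contfun (@hopf_aut_coord_continuous _ _ rho a).

Lemma aut_coefE rho a (theta : aut_space) :
  aut_coef rho a theta = rho (val (theta : hopf_aut G) a).
Proof. by []. Qed.

Lemma aut_space_sep (theta theta' : aut_space) :
  theta <> theta' -> exists f : Cfun R aut_space, f theta <> f theta'.
Proof.
move=> tt'; apply: contrapT => none; apply: tt'; apply: hopf_aut_ext => i a.
apply: contrapT => ia; apply: none; exists (aut_coef (dual_coord i) a).
by rewrite !aut_coefE.
Qed.

Let op : aut_space * aut_space -> aut_space := @hopf_aut_comp R G.

Let opE x y a : val (op (x, y) : hopf_aut G) a =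
  val (x : hopf_aut G) (val (y : hopf_aut G) a).
Proof. by rewrite /= comp_lfunE. Qed.

Fact aut_opA x y z : op (op (x, y), z) = op (x, op (y, z)).
Proof. by apply: hopf_aut_ext => i a; rewrite !opE. Qed.

Fact aut_op_injl x y y' : op (x, y) = op (x, y') -> y = y'.
Proof.
move=> e; apply: hopf_aut_ext => i a; congr (dual_coord i _).
have [/bij_inj xi _ _] := val_hopf_aut (x : hopf_aut G).
by apply: xi; rewrite -!opE e.
Qed.

Fact aut_op_injr x x' y : op (x, y) = op (x', y) -> x = x'.
Proof.
move=> e; apply: hopf_aut_ext => i a; congr (dual_coord i _).
have [b <-] := hopf_aut_surj (val_hopf_aut (y : hopf_aut G)) a.
by rewrite -!opE e.
Qed.

Definition aut_cqg : compact_quantum_group R :=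
  group_cqg (@hopf_aut_comp_continuous R G : continuous op)
    aut_opA aut_op_injl aut_op_injr aut_space_sep.

Definition aut_action (a : G) : tensor G aut_cqg :=
  [ffun i => aut_coef (dual_coord i) a].

Local Notation ev := (@teval R aut_space _).

Lemma teval_aut_action (theta : aut_space) a :
  ev theta (aut_action a) = val (theta : hopf_aut G) a.
Proof.
rewrite [RHS]dual_coordK /teval /tlift; apply: eq_bigr => i _.
by rewrite ffunE aut_coefE.
Qed.

Let GK := tensor_star (alg_star G) (alg_star aut_cqg).

Lemma aut_action_linear : linear (aut_action : G -> tensor G aut_cqg).
Proof.
move=> k x y; apply/ffunP => i; rewrite !ffunE; apply: CfunP => theta.
change (dual_coord i (val (theta : hopf_aut G) (k *: x + y)) =
  k * dual_coord i (val (theta : hopf_aut G) x) +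
  dual_coord i (val (theta : hopf_aut G) y)).
by rewrite !linearP.
Qed.

Let mul_bilin : bilin (smul (alg_star G)).
Proof. by split=> [b|a] /=; lin. Qed.

Lemma aut_action_is_action : is_action aut_action.
Proof.
split.
- split; first exact: aut_action_linear.
  + apply: (@teval_inj R aut_space) => theta.
    rewrite teval_aut_action (teval_one (alg_star G)).
    by rewrite hopf_aut1 //; exact: val_hopf_aut.
  + move=> a b; apply: (@teval_inj R aut_space) => theta.
    rewrite teval_aut_action (teval_mul _ _ _ mul_bilin) !teval_aut_action.
    by rewrite hopf_autM //; exact: val_hopf_aut.
  + move=> a; apply: (@teval_inj R aut_space) => theta.
    rewrite teval_aut_action teval_star ?teval_aut_action; last exact: star_semilinear.
    by rewrite hopf_aut_star //; exact: val_hopf_aut.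
- move=> a; apply: (@teval_inj R (prod_space aut_space aut_space)) => -[t1 t2].
  have la := aut_action_linear.
  pose q1 : prod_space aut_space aut_space := (t1, t2).
  rewrite -[(t1, t2)]/q1 !teval_tlift.
  (* The outer application of the action is evaluated at the second point and the inner one at the
     first, in accordance with the order of composition. *)
  transitivity (val (t1 : hopf_aut G) (val (t2 : hopf_aut G) a)).
    rewrite -[val t2 a]teval_aut_action.
    have lt : linear (val (t1 : hopf_aut G)) by exact: linearP.
    rewrite [in RHS]/teval (tlift_lin _ _ lt); apply: eq_tlift => b k.
    rewrite teval_tlift linearZ /= -teval_aut_action.
    have lz : linear (fun x : G => (k : Cfun R aut_space) t2 *: x) by lin.
    rewrite [in RHS]/teval (tlift_lin _ _ lz); apply: eq_tlift => c l.
    by rewrite teval_tens CtensE scalerA mulrC.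
  transitivity (ev (op (t1, t2)) (aut_action a)).
    by rewrite teval_aut_action opE.
  by apply: eq_tlift => b k; rewrite teval_tens.
- apply/seteqP; split=> // t _.
  (* The basis and [dual_basis h] are dual with respect to h, which theta
     preserves; hence [\sum_n h (e_i * theta f_n) *: theta e_n = e_i]. *)
  pose phi (i : 'I_(\dim {:G})) : dual G := (h \o amull (vbasis {:G})`_i)%VF.
  pose k n : Cfun R aut_space :=
    \sum_i (aut_coef (phi i) (dual_basis h n) * t i : Cfun R aut_space).
  exists (\dim {:G}), (fun=> 1),
    (fun n : 'I_(\dim {:G}) => smul GK (aut_action (vbasis {:G})`_n) (tens 1 (k n))).
  split=> [n|]; first by exists (vbasis {:G})`_n => //; exists (k n).
  apply: (@teval_inj R aut_space) => theta.
  have lev := @teval_linear R aut_space G theta.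
  have aut := val_hopf_aut (theta : hopf_aut G).
  rewrite (big_morph _ (linD lev) (lin0 lev)).
  under eq_bigr => n _.
    rewrite (linZ lev) scale1r (teval_mul _ _ _ mul_bilin) teval_aut_action teval_tens.
    rewrite (big_morph (fun f : Cfun R aut_space => f theta : C^o)
      (linD (@Cfun_eval_linear R aut_space theta))
      (lin0 (@Cfun_eval_linear R aut_space theta))) /= -scalerAr mulr1 scaler_suml.
    over.
  rewrite exchange_big; apply: eq_bigr => i _.
  have [y yE] := hopf_aut_surj aut (vbasis {:G})`_i.
  have lth : linear (val (theta : hopf_aut G)) by exact: linearP.
  symmetry; transitivity (\sum_(n < \dim {:G}) t i theta *:
    val (theta : hopf_aut G) (dual_coord n y *: (vbasis {:G})`_n)).
    apply: eq_bigr => n _.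
    rewrite -[X in X *: _]/(phi i (val (theta : hopf_aut G) (dual_basis h n)) * t i theta).
    rewrite comp_lfunE lfunE /= -yE -hopf_autM // hopf_aut_haar //.
    by rewrite -coord_dual_basis // mulrC -scalerA (linZ lth).
  by rewrite -scaler_sumr -linear_sum /= -dual_coordK yE.
Qed.

Lemma fourier_hopf_aut (theta : 'End(G)) a y : is_hopf_aut theta ->
  fourier h (theta a) (theta y) = fourier h a y.
Proof. by move=> aut; rewrite !fourierE -hopf_autM // hopf_aut_haar. Qed.

Lemma aut_action_automorphisms : acts_by_automorphisms aut_action h.
Proof.
split; first exact: aut_action_is_action.
set beta := (X in is_star_hom _ _ X).
(* At theta the dual action precomposes phi with the inverse of theta; evaluating at theta y keeps
   this inverse out. *)
have betaE (theta : aut_space) phi y :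
    (ev theta (beta phi) : dual G) (val (theta : hopf_aut G) y) = phi y.
  rewrite /beta teval_tlift.
  have lF : linear (fourier h) by exact: linearP.
  rewrite (_ : tlift _ _ = fourier h (ev theta (aut_action ((fourier h)^-1%VF phi)))).
    rewrite teval_aut_action fourier_hopf_aut ?fourierVK //; exact: val_hopf_aut.
  rewrite [in RHS]/teval (tlift_lin _ _ lF); apply: eq_tlift => b k.
  by rewrite teval_tens linearZ.
have ext (t : tensor (dual G) aut_cqg) (phi : dual G) : (forall (theta : aut_space) y,
    (ev theta t : dual G) (val (theta : hopf_aut G) y) = phi y) -> beta phi = t.
  move=> e; apply: (@teval_inj R aut_space) => theta; apply/lfunP => a.
  by have [y <-] := hopf_aut_surj (val_hopf_aut (theta : hopf_aut G)) a; rewrite betaE e.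
split.
- move=> c phi psi; apply: ext => theta y.
  rewrite (@teval_linear R aut_space (dual G) theta c (beta phi) (beta psi)).
  rewrite !(add_lfunE, scale_lfunE).
  have e1 := betaE theta phi y; have e2 := betaE theta psi y.
  exact: (f_equal2 (fun u v : C^o => c *: u + v) e1 e2).
- apply: ext => theta y; rewrite (teval_one (dual_star G)).
  by rewrite hopf_aut_counit //; exact: val_hopf_aut.
- move=> phi psi; apply: ext => theta y; rewrite teval_mul; last first.
    by split=> ?; [exact: dual_conv_linl|exact: dual_conv_linr].
  rewrite -/(dual_conv _ _) -/(dual_conv phi psi) !dual_convE hopf_aut_comul; first last.
  + by split=> ?; lin.
  + exact: val_hopf_aut.
  by apply: eq_tlift => b c; congr (_ * _); apply: betaE.
- move=> phi; apply: ext => theta y.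
  have starE (psi : dual G) a :
      sstar (dual_star G) psi a = (psi (star (antipode G a)) : C)^*.
    rewrite /= linfunE // => k u v.
    by rewrite linearP star_semilinear linearP rmorphD rmorphM /= conjCK.
  rewrite teval_star; last first.
    move=> k psi psi'; apply/lfunP => a.
    by rewrite !(add_lfunE, scale_lfunE, starE) rmorphD rmorphM.
  have aut := val_hopf_aut (theta : hopf_aut G).
  rewrite !starE -hopf_aut_antipode // -hopf_aut_star //.
  exact: (congr1 Num.conj (betaE theta phi _)).
Qed.

End AutCqg.

(** * Comparison with the universal quantum group *)

Section CharacterMaps.
Variables (R : realType) (A : cstarAlgType R).

(** Characters are contractive, so the set where two of them agree is closed. *)
Lemma character_eq_cstar_subalg (chi psi : A -> R[i]) :
  is_character chi -> is_character psi ->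
  is_cstar_subalg [set x | chi x = psi x].
Proof.
move=> hchi hpsi; have [cL c1 cM cS] := hchi; have [pL p1 pM pS] := hpsi.
have dB chi' : is_character chi' -> {morph chi' : x y / x - y}.
  move=> [l _ _ _] x y.
  by rewrite (linD l) -scaleN1r (linZ l) scaleN1r.
split=> /=.
- apply: closed_cnorm => x clx /=; apply/eqP; rewrite -subr_eq0; apply/eqP.
  apply: cabs0_eq; rewrite leNgt; apply/negP => x0.
  have [|y /= yE xy] := clx (cabs (chi x - psi x) / 2); first by rewrite divr_gt0.
  have bnd chi' : is_character chi' -> cabs (chi' x - chi' y) <= cnorm (x - y).
    by move=> hc; rewrite -lecR cabsE -dB //; apply: character_norm_le.
  have : cabs (chi x - psi x) <= cnorm (x - y) + cnorm (x - y).
    have -> : chi x - psi x = (chi x - chi y) - (psi x - psi y).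
      by rewrite yE opprB addrA subrK.
    apply: le_trans (cabsD _ _) _; rewrite lerD ?bnd //.
    by rewrite -[cabs (- _)]/(complex.Re `|_|) normrN; apply: bnd.
  by rewrite leNgt => /negP; apply; move: xy; lra.
- by rewrite (lin0 cL) (lin0 pL).
- by move=> c x y xE yE; rewrite cL pL xE yE.
- by move=> x y xE yE; rewrite cM pM xE yE.
- by move=> x xE; rewrite cS pS xE.
Qed.

(** Closedness: preimages of a sequence converging to y form a Cauchy sequence, and pi of their
    limit is y. *)
Lemma isometric_range (B : cstarAlgType R) (pi : A -> B) :
  is_star_hom (alg_star A) (alg_star B) pi ->
  (forall x, cnorm (pi x) = cnorm x) -> is_cstar_subalg (range pi).
Proof.
move=> [piL pi1 piM piS] iso.
have piB : {morph pi : x y / x - y}.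
  by move=> x y; rewrite (linD piL) -scaleN1r (linZ piL) scaleN1r.
split.
- apply: closed_cnorm => y cly.
  have sel (n : nat) : {x | cnorm (y - pi x) < n.+1%:R^-1}.
    apply: cid; have [|_ [x _ <-] yx] := cly n.+1%:R^-1; first by rewrite invr_gt0.
    by exists x.
  pose u n := sval (sel n).
  have uP n : cnorm (y - pi (u n)) < n.+1%:R^-1 by exact: (svalP (sel n)).
  have small (e : R) : 0 < e ->
      exists N, forall n, (N <= n)%N -> cnorm (y - pi (u n)) < e.
    move=> e0; have [N _ Ne] := near_infty_natSinv_lt (PosNum e0).
    by exists N => n Nn; apply: lt_trans (uP n) _; exact: (Ne n Nn).
  have [|l lu] := @cnorm_cauchy_cvg _ A u.
    move=> e e0; have [|N NP] := small (e / 2); first by rewrite divr_gt0.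
    exists N => m n Nm Nn; rewrite -iso piB.
    apply: le_lt_trans (cnorm_distD _ y _) _; rewrite cnormB.
    by have := NP m Nm; have := NP n Nn; lra.
  exists l => //; apply/eqP; rewrite eq_sym -subr_eq0; apply/eqP.
  apply: cnorm_le0; apply/ler_addgt0Pr => e e0; rewrite add0r.
  have e2 : 0 < e / 2 by rewrite divr_gt0.
  have [N NP] := small _ e2; have [M MP] := lu _ e2.
  apply: le_trans (cnorm_distD _ (pi (u (maxn N M))) _) _.
  rewrite -piB iso [X in _ + X]cnormB.
  have := NP _ (leq_maxl N M); have := MP _ (leq_maxr N M); lra.
- by exists 0 => //; exact: lin0 piL.
- by move=> c _ _ [x _ <-] [y _ <-]; exists (c *: x + y) => //; rewrite piL.
- by move=> _ _ [x _ <-] [y _ <-]; exists (x * y); rewrite ?[pi _]piM.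
- by move=> _ [x _ <-]; exists (star x); rewrite ?[pi _]piS.
Qed.

End CharacterMaps.

(** * The Hopf automorphism of a character *)

Section CharacterAut.
Variables (R : realType) (G : finite_quantum_group R) (h : dual G).
Local Notation C := R[i].
Hypothesis haar_h : is_haar h.
Variables (H : compact_quantum_group R) (alpha : G -> tensor G H).
Hypothesis auth : acts_by_automorphisms alpha h.
Variable chi : H -> C.
Hypothesis chiP : is_character chi.

Let alpha_hom := action_hom (proj1 auth).

Let chiL : linear (chi : H -> C^o). Proof. by have [] := chiP. Qed.

Definition character_aut : 'End(G) :=
  linfun (fun a => tlift (fun x k => chi k *: x) (alpha a)).

Lemma character_autE a :
  character_aut a = tlift (fun x k => chi k *: x) (alpha a).
Proof. by have la := action_linear auth; rewrite linfunE //; lin. Qed.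

Lemma character_aut_coef (rho : dual G) a :
  rho (character_aut a) = chi (coefficient alpha rho a).
Proof.
have lrho : linear rho by exact: linearP.
rewrite character_autE (tlift_lin _ _ lrho) (tlift_lin _ _ chiL).
by apply: eq_tlift => x k; rewrite linearZ (linZ chiL) /=; exact: mulrC.
Qed.

Lemma character_autM a b :
  character_aut (a * b) = character_aut a * character_aut b.
Proof.
have [_ _ cM _] := chiP; rewrite !character_autE (hom_tliftM _ _ alpha_hom); last by lin.
have lr (c : G) : linear (fun x : G => x * c) by lin.
have ll (c : G) : linear (fun x : G => c * x) by lin.
rewrite (tlift_lin _ _ (lr _)); apply: eq_tlift => x k.
rewrite (tlift_lin _ _ (ll _)); apply: eq_tlift => y l.
by rewrite cM -scalerAl -scalerAr scalerA.
Qed.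

Lemma character_aut_haar a : h (character_aut a) = h a.
Proof.
have [_ c1 _ _] := chiP.
by rewrite character_aut_coef (action_haar haar_h auth) (linZ chiL) c1 [_ *: 1]mulr1.
Qed.

(** Invariance and non-degeneracy of h give injectivity, hence bijectivity in finite dimension.
    Compatibility with the coproduct is [action_comul] under the multiplicative chi. *)
Lemma character_aut_is_hopf_aut : is_hopf_aut character_aut.
Proof.
have [_ c1 cM cS] := chiP; have la := action_linear auth.
have lc := @comul_linear _ G.
split.
- have ker : lker character_aut == 0%VS.
    apply/lker0P => a b ab; apply/eqP; rewrite -subr_eq0; apply/eqP.
    apply: (haar_nondegenerate haar_h) => x.
    by rewrite -character_aut_haar character_autM linearB /= ab subrr mulr0 linear0.
  exists (character_aut^-1)%VF; [exact: lker0_lfunK ker|exact: lker0_lfunVK ker].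
- split; first exact: linearP.
  + by rewrite character_autE (hom_tlift1 alpha_hom) ?c1 ?scale1r //; lin.
  + exact: character_autM.
  + move=> a /=; rewrite !character_autE (hom_tlift_star _ alpha_hom); last by lin.
    rewrite /tlift star_sum; apply: eq_bigr => i _.
    by rewrite starZ cS.
- move=> a; rewrite [in RHS]character_autE (tlift_lin _ _ lc).
  transitivity (tlift (fun x k => tlift (fun x1 x2 => chi k *: tens x1 x2) (comul x))
      (alpha a)); last first.
    apply: eq_tlift => x k; rewrite (linZ lc).
    have lk : linear (fun t : tensor G G => chi k *: t) by lin.
    by rewrite -(tlift_lin _ _ lk) tlift_id.
  rewrite (action_comul haar_h auth (T := fun x1 x2 k => chi k *: tens x1 x2));
    last by split; lin.
  apply: eq_tlift => a1 a2; rewrite !character_autE.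
  have lr (c : G) : linear (fun x : G => tens x c) by lin.
  have ll (c : G) : linear (fun x : G => tens c x) by lin.
  rewrite (tlift_lin _ _ (lr _)); apply: eq_tlift => x k.
  rewrite (tlift_lin _ _ (ll _)); apply: eq_tlift => y l.
  by rewrite cM (linZ (ll _)) (linZ (lr _)) scalerA mulrC.
Qed.

Definition character_hopf_aut : hopf_aut G :=
  exist (fun theta : 'End(G) => `[< is_hopf_aut theta >]) character_aut
    (introT (asboolP _) character_aut_is_hopf_aut).

End CharacterAut.

(** * The comparison map is an isometric isomorphism *)

Section Universal.
Variables (R : realType) (G : finite_quantum_group R) (h : dual G).
Local Notation C := R[i].
Hypothesis haar_h : is_haar h.
Variables (H : compact_quantum_group R) (alpha : G -> tensor G H).
Hypothesis auth : acts_by_automorphisms alpha h.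
Hypothesis faith : is_faithful alpha.
Local Notation K := (aut_cqg haar_h).
Variable pi : H -> Cfun R (aut_space haar_h).
Hypothesis pi_hom : is_star_hom (alg_star H) (alg_star K) pi.
Hypothesis pi_action : forall a,
  aut_action haar_h a = tlift (fun b k => tens b (pi k)) (alpha a).

Let piL : linear pi. Proof. by have [] := pi_hom. Qed.

Lemma comparison_coefficient (rho : dual G) a :
  pi (coefficient alpha rho a) = aut_coef haar_h rho a.
Proof.
have lrho : linear rho by exact: linearP.
apply: CfunP => theta; rewrite aut_coefE -teval_aut_action pi_action teval_tlift.
rewrite (tlift_lin _ _ lrho) /coefficient (tlift_lin _ _ piL).
rewrite (tlift_lin _ _ (@Cfun_eval_linear R (aut_space haar_h) theta)).
apply: eq_tlift => x k; rewrite teval_tens (linZ piL) CfunZ linearZ.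
exact: mulrC.
Qed.

Lemma comparison_character (theta : aut_space haar_h) :
  is_character (fun z => pi z theta).
Proof.
have [_ p1 pM pS] := pi_hom; split.
- by move=> c x y; rewrite piL.
- by rewrite [pi 1]p1.
- by move=> x y; rewrite [pi _]pM.
- by move=> x; rewrite [pi _]pS.
Qed.

(** Both sides are characters of C(H) in z and agree on the coefficients, which generate C(H). *)
Lemma comparison_eval chi (hchi : is_character chi) (z : H) :
  pi z (character_hopf_aut haar_h auth hchi : aut_space haar_h) = chi z.
Proof.
have : setT z by [].
rewrite -faith => /(_ [set z | pi z (character_hopf_aut haar_h auth hchi) = chi z]).
apply; split.
  by apply: character_eq_cstar_subalg; [exact: comparison_character|exact: (hchi)].
move=> _ [rho _ [a _ <-]] /=.
rewrite -/(coefficient alpha rho a) comparison_coefficient aut_coefE.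
by rewrite -(character_aut_coef auth hchi rho a).
Qed.

Lemma comparison_isometry z : cnorm (pi z) = cnorm z.
Proof.
apply/eqP; rewrite eq_le; apply/andP; split.
  apply: Cnorm_le => theta; rewrite -lecR cabsE.
  exact: character_norm_le (comparison_character theta).
have [chi hchi chiz] := exists_character (faithful_action_comm haar_h auth faith) z.
rewrite -lecR -chiz -(comparison_eval hchi) -cabsE lecR.
exact: Cnorm_ge.
Qed.

Lemma comparison_bijective : bijective pi.
Proof.
have inj : injective pi.
  move=> x y xy; apply/eqP; rewrite -subr_eq0; apply/eqP/cnorm_eq0.
  rewrite -comparison_isometry (linD piL) -scaleN1r (linZ piL) scaleN1r xy subrr.
  exact: cnorm0.
have surj f : range pi f.
  apply: stone_weierstrass.
  - exact: isometric_range pi_hom comparison_isometry.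
  - by exists 1 => //; have [_ p1 _ _] := pi_hom.
  - move=> t t' tt'; apply: contrapT => none; apply: tt'; apply: hopf_aut_ext => i a.
    apply: contrapT => ia; apply: none; exists (aut_coef haar_h (dual_coord i) a) => //.
    by exists (coefficient alpha (dual_coord i) a) => //; exact: comparison_coefficient.
have ex f : exists z, pi z = f by have [z _ <-] := surj f; exists z.
exists (fun f => sval (cid (ex f))) => [z|f]; last exact: (svalP (cid (ex f))).
by apply: inj; exact: (svalP (cid (ex (pi z)))).
Qed.

End Universal.

Theorem corollary3p3 (R : realType) (G : finite_quantum_group R) (h : dual G)
    (haar_h : is_haar h) :
  (forall (H : compact_quantum_group R) (alpha : G -> tensor G H),
     is_quantum_automorphism_group h alpha ->
     (forall x y : H, x * y = y * x) /\
     comul_isomorphic (cqg_comul_alg H) (hopf_aut_comul_alg G)) /\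
  (forall (K : compact_quantum_group R) (alpha : G -> tensor G K),
     acts_by_automorphisms alpha h -> is_faithful alpha ->
     forall x y : K, x * y = y * x).
Proof.
split=> [H alpha [auth faith univ]|K alpha auth faith]; last first.
  exact: faithful_action_comm haar_h auth faith.
split; first exact: faithful_action_comm haar_h auth faith.
have [pi [[[pi_hom [pi2 [pi2_hom pi2_tens pi2_comul]]] pi_action] _]] :=
  univ _ _ (aut_action_automorphisms haar_h).
exists pi; split; last exact: (comparison_bijective auth faith pi_hom pi_action).
split; first exact: pi_hom.
(* The tensor square in [aut_cqg] consists of the same functions on the product space as that of
   [hopf_aut_comul_alg], so [pi2] serves unchanged. *)
exists pi2; split; [exact: pi2_hom| |] => a *.
  by rewrite pi2_tens; apply: contfunP.
by rewrite pi2_comul; apply: contfunP.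
Qed.
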